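(* Let $b$ be a bounded analytic function on $\mathbb{D}$ with $\|b\|_{H^\infty(\mathbb{D})}=1$, and let $\zeta\in\mathbb{T}$ be such that $\zeta\notin\overline{\sigma(b)}$ (the closure of the boundary spectrum of $b$). Then the embedding $H(b)\hookrightarrow \mathcal{D}_\zeta$ holds.
   Context: $\mathbb{D}$ is the open unit disk in $\mathbb{C}$, $\mathbb{T}=\partial\mathbb{D}$, $dA$ is two-dimensional Lebesgue measure, and $H^2(\mathbb{D})$, $H^\infty(\mathbb{D})$ are the usual Hardy spaces. For an analytic function $b$ on $\mathbb{D}$ with $\|b\|_{H^\infty(\mathbb{D})}\le 1$, the de Branges-Rovnyak space $H(b)$ is the reproducing kernel Hilbert space of functions on $\mathbb{D}$ with reproducing kernel $k^b(z,\omega)=\frac{1-\overline{b(\omega)}b(z)}{1-\overline{\omega}z}$, $z,\omega\in\mathbb{D}$; its norm is denoted $\|\cdot\|_b$. One has $H(b)\subseteq H^2(\mathbb{D})$ with $\|f\|_{H^2}\le\|f\|_b$. For $b$ with $\|b\|_{H^\infty(\mathbb{D})}=1$, the boundary spectrum is $\sigma(b)=\{\lambda\in\mathbb{T}: \liminf_{z\to\lambda}|b(z)|<1\}$, where $z$ ranges over $\mathbb{D}$. This set is not necessarily closed. For $\zeta\in\mathbb{T}$ and $f$ holomorphic on $\mathbb{D}$, the local Dirichlet integral is $D_\zeta(f)=\frac1\pi\int_{\mathbb{D}}|f'(z)|^2\frac{1-|z|^2}{|z-\zeta|^2}\,dA(z)$. The local Dirichlet space is $\mathcal{D}_\zeta=\{f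 \text{ holomorphic on }\mathbb{D}: D_\zeta(f)<\infty\}\subseteq H^2(\mathbb{D})$, with norm given by $\|f\|_{\mathcal{D}_\zeta}^2=\|f\|_{H^2}^2+D_\zeta(f)$. The embedding $H(b)\hookrightarrow\mathcal{D}_\zeta$ holds means: $H(b)\subseteq\mathcal{D}_\zeta$ and the inclusion is bounded, i.e. there is $C>0$ with $\|f\|_{H^2}^2+D_\zeta(f)\le C\|f\|_b^2$ for all $f\in H(b)$. *)

(* Defs.v *)
From HB Require Import structures.
From mathcomp Require Import all_boot all_order all_algebra.
From mathcomp Require Import sesquilinear complex.
From mathcomp Require Import all_classical all_reals all_analysis.

Set Implicit Arguments.
Unset Strict Implicit.
Unset Printing Implicit Defensive.

Import Order.TTheory GRing.Theory Num.Theory.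
Import numFieldNormedType.Exports.

Local Open Scope classical_set_scope.
Local Open Scope ring_scope.

(* The library puts the norm topology on R[i]^o only, not on R[i] itself. *)
HB.instance Definition _ (R : realType) := GRing.ComAlgebra.copy R[i] R[i]^o.
HB.instance Definition _ (R : realType) := Vector.copy R[i] R[i]^o.
HB.instance Definition _ (R : realType) := NormedModule.copy R[i] R[i]^o.

(* Norms in a space over R[i] take their values in R[i]; this is the same
   nonnegative number as an element of R. *)
Definition rnorm (R : realType) (V : normedModType R[i]) (v : V) : R :=
  complex.Re `|v|.

Definition unit_disk (R : realType) : set R[i] := [set z | `|z| < 1].

Definition disk (R : realType) := {z : R[i] | `|z| < 1}.

(* A function on the disk is given by a function on R[i], whose values off the
   disk are irrelevant. *)
Definition restrict_disk (R : realType) (f : R[i] -> R[i]) : disk R -> R[i] :=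
  fun z => f (val z).

Definition holomorphic_disk (R : realType) (f : R[i] -> R[i]) :=
  forall z, unit_disk z -> derivable f z 1.

Definition Hinfty_norm (R : realType) (f : R[i] -> R[i]) : \bar R :=
  ereal_sup [set (rnorm (f z))%:E | z in @unit_disk R].

Definition expi (R : realType) (t : R) : R[i] := Complex (cos t) (sin t).

Definition H2_norm_sqr (R : realType) (f : R[i] -> R[i]) : \bar R :=
  ereal_sup [set ((2 * pi)^-1%:E *
      \int[lebesgue_measure]_(t in `[0%R, (2 * pi)%R])
        (rnorm (f (real_complex R r * expi t)) ^+ 2)%:E)%E
    | r in `[0, 1[%classic].

Definition local_dirichlet_integral (R : realType) (zeta : R[i])
    (f : R[i] -> R[i]) : \bar R :=
  (pi^-1%:E *
    \int[lebesgue_measure \x lebesgue_measure]_(p in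
        [set p : R * R | unit_disk (Complex p.1 p.2)])
      (let z : R[i] := Complex p.1 p.2 in
       rnorm (derive1 f z) ^+ 2 *
         ((1 - rnorm z ^+ 2) / rnorm (z - zeta) ^+ 2))%:E)%E.

Definition local_dirichlet_space (R : realType) (zeta : R[i]) :
    set (R[i] -> R[i]) :=
  [set f | holomorphic_disk f /\ (local_dirichlet_integral zeta f < +oo)%E].

(* A Hilbert space of functions on X with reproducing kernel K: ev u is the
   function represented by u.  Forms in {dot _ for Num.conj} are linear in
   their first argument. *)
Record rkhs (R : realType) (X : Type) (K : X -> X -> R[i]) := RKHS {
  space : completeNormedModType R[i];
  inner : {dot space for Num.conj};
  inner_norm : forall u : space, `|u| ^+ 2 = inner u u;
  ev : {linear space -> (X -> R[i])};
  ev_inj : injective ev;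
  kernel_at : X -> space;
  kernel_atE : forall z w, ev (kernel_at w) z = K z w;
  reproducing : forall u w, ev u w = inner u (kernel_at w)
}.

Definition dbr_kernel (R : realType) (b : R[i] -> R[i]) (z w : disk R) : R[i] :=
  (1 - (b (val w))^* * b (val z)) / (1 - (val w)^* * val z).

(* A reproducing kernel Hilbert space is determined by its kernel up to a
   unique isometry commuting with ev; an inhabitant of this type is H(b). *)
Definition de_branges_rovnyak (R : realType) (b : R[i] -> R[i]) :=
  rkhs (dbr_kernel b).

Definition boundary_spectrum (R : realType) (b : R[i] -> R[i]) : set R[i] :=
  [set lambda | `|lambda| = 1 /\
    (limf_einf (fun z => (rnorm (b z))%:E)
       (within (@unit_disk R) (nbhs lambda)) < 1)%E].

Definition embeds_local_dirichlet (R : realType) (b : R[i] -> R[i])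
    (Hb : de_branges_rovnyak b) (zeta : R[i]) : Prop :=
  (forall (u : space Hb) (f : R[i] -> R[i]), restrict_disk f = ev Hb u ->
     local_dirichlet_space zeta f) /\
  exists C : R, 0 < C /\
    forall (u : space Hb) (f : R[i] -> R[i]), restrict_disk f = ev Hb u ->
      (H2_norm_sqr f + local_dirichlet_integral zeta f
         <= (C * rnorm u ^+ 2)%:E)%E.

(* Main.v *)
Require Import Defs.
From mathcomp Require Import all_boot all_order all_algebra.
From mathcomp Require Import sesquilinear complex.
From mathcomp Require Import cyclic separable cyclotomic.
From mathcomp Require Import ring lra.
From mathcomp Require Import all_classical all_reals all_analysis.
From mathcomp Require Import measurable_realfun.
Set Implicit Arguments.
Unset Strict Implicit.
Unset Printing Implicit Defensive.
Import Order.TTheory GRing.Theory Num.Theory.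
Import numFieldNormedType.Exports.
Local Open Scope classical_set_scope.
Local Open Scope ring_scope.

(** Write D for the unit disk and [k w] for the kernel vectors of H(b), so that
    the functions of H(b) are [f z = <u, k z>].

    Since [zeta] is outside the closure of the boundary spectrum, [|b|] tends to
    1 at every point of an arc around [zeta].  The heart of the matter is that
    this makes [k] Lipschitz on the part of D near [zeta] ([kernel_lipschitz]).
    Then every [f] satisfies [|f'| <= A |u|] near [zeta], where the weight
    [(1 - |z|^2) / |z - zeta|^2] of the local Dirichlet integral is at most
    [2 / |z - zeta|], an integrable function on the plane.  Away from [zeta] the
    weight is at most a multiple of [1 - |z|^2], and the Littlewood-Paley
    integral of [|f'|^2 (1 - |z|^2)] is controlled by the Taylor coefficients of
    [f] ([local_dirichlet_le], [lp_integral_le]).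

    Taylor coefficients are bounded because the kernel of H(b) is the Szego
    kernel minus a positive kernel: the map sending the Szego kernel at [w] to
    [k w] is a contraction, so [k w] is the sum of the [w^* ^n e_n] for vectors
    [e_n] obeying a Bessel inequality ([kernel_power_series]).  Hence
    [f z] is the sum of the [<u, e_n> z^n] with square-summable coefficients.

    Regularity of [k] near [zeta] is usually seen by continuing [b] analytically
    across the arc by reflection.  Here it is obtained from three estimates.
    - [1 - |b|^2 <= K (1 - |z|^2)] near [zeta] ([one_sub_sqr_b_le]): the
      subharmonic function [|1/b|] is compared with an explicit superharmonic
      barrier.
    - Consequently the kernel is bounded near [(zeta, zeta)], which keeps [b]
      close to one point of the circle there ([clark_parameter]).  For a suitable
      unimodular [alpha], put [B = alpha^* b] and [G = (1 + B) / (1 - B)].  This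
      function has nonnegative real part in D, at most [K (1 - |z|^2)] near
      [zeta].  So the measure of its Herglotz representation, the Clark measure
      of [b], does not charge a neighbourhood of [zeta], and both [G] and the
      positive kernel [(G z + (G w)^* ) / (2 (1 - w^* z))] are smooth there
      ([herglotz_lipschitz], [herglotz_kernel_lipschitz]).
    - That kernel is the Gram kernel of the vectors [(1 - B z)^-1^* k z], so
      these are Lipschitz near [zeta], and therefore so is [k].

    Holomorphic functions are handled as uniform limits of polynomials on the
    disks of radius [r < 1], and integrals over circles as means over roots of
    unity, which are exact on polynomials of smaller degree. *)

(** * Real-valued norms over the complex numbers *)

Section RealNorm.
Variable R : realType.
Local Notation C := R[i].
Implicit Types (V : normedModType C) (a b z w : C).

Lemma RcD (x y : R) : ((x + y)%:C = x%:C + y%:C)%C. Proof. exact: rmorphD. Qed.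
Lemma RcB (x y : R) : ((x - y)%:C = x%:C - y%:C)%C. Proof. exact: rmorphB. Qed.
Lemma RcM (x y : R) : ((x * y)%:C = x%:C * y%:C)%C. Proof. exact: rmorphM. Qed.
Lemma RcX (x : R) n : ((x ^+ n)%:C = x%:C ^+ n)%C. Proof. exact: rmorphXn. Qed.
Lemma RcV (x : R) : (x^-1%:C = x%:C^-1)%C. Proof. exact: fmorphV. Qed.
Lemma Rc_nat n : (n%:R : R)%:C%C = n%:R. Proof. exact: rmorph_nat. Qed.
Lemma Rc_sum I (r : seq I) (P : pred I) (F : I -> R) :
  ((\sum_(i <- r | P i) F i)%:C = \sum_(i <- r | P i) (F i)%:C)%C.
Proof. exact: rmorph_sum. Qed.

Lemma norm_rnorm V (v : V) : `|v| = (rnorm v)%:C%C.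
Proof. by rewrite /rnorm RRe_real. Qed.

Lemma rnorm_ge0 V (v : V) : 0 <= rnorm v.
Proof. by rewrite -lecR -norm_rnorm normr_ge0. Qed.

Lemma rnormD V (u v : V) : rnorm (u + v) <= rnorm u + rnorm v.
Proof. by rewrite -lecR rmorphD /= -!norm_rnorm ler_normD. Qed.

Lemma rnormN V (v : V) : rnorm (- v) = rnorm v.
Proof. by rewrite /rnorm normrN. Qed.

Lemma rnormB V (u v : V) : rnorm (u - v) <= rnorm u + rnorm v.
Proof. by rewrite -(rnormN v) rnormD. Qed.

Lemma rdistC V (u v : V) : rnorm (u - v) = rnorm (v - u).
Proof. by rewrite /rnorm distrC. Qed.

Lemma rnorm0 V : rnorm (0 : V) = 0.
Proof. by rewrite /rnorm normr0. Qed.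

Lemma rnorm0_eq0 V (v : V) : rnorm v = 0 -> v = 0.
Proof. by move=> v0; apply: normr0_eq0; rewrite norm_rnorm v0. Qed.

Lemma rnormZ V a (v : V) : rnorm (a *: v) = rnorm a * rnorm v.
Proof. by apply: complexI; rewrite rmorphM /= -!norm_rnorm normrZ. Qed.

Lemma rnorm_sum V I (r : seq I) (P : pred I) (F : I -> V) :
  rnorm (\sum_(i <- r | P i) F i) <= \sum_(i <- r | P i) rnorm (F i).
Proof.
elim/big_rec2: _ => [|i x y _ le_xy]; first by rewrite rnorm0.
by rewrite (le_trans (rnormD _ _)) // lerD2l.
Qed.

Lemma rnormM a b : rnorm (a * b) = rnorm a * rnorm b.
Proof. exact: (rnormZ a (b : C)). Qed.

Lemma rnorm1 : rnorm (1 : C) = 1.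
Proof. by rewrite /rnorm normr1. Qed.

Lemma rnormX a n : rnorm (a ^+ n) = rnorm a ^+ n.
Proof. by elim: n => [|n IH]; rewrite ?expr0 ?rnorm1 // !exprS rnormM IH. Qed.

Lemma rnormV a : rnorm a^-1 = (rnorm a)^-1.
Proof. by apply: complexI; rewrite fmorphV /= -!norm_rnorm normfV. Qed.

Lemma rnorm_real (x : R) : rnorm (x%:C%C : C) = `|x|.
Proof. by rewrite /rnorm normc_def /= expr0n addr0 sqrtr_sqr. Qed.

Lemma rnorm_sqrE a : rnorm a ^+ 2 = complex.Re a ^+ 2 + complex.Im a ^+ 2.
Proof. by rewrite /rnorm normc_def /= sqr_sqrtr // addr_ge0 ?sqr_ge0. Qed.

(** Two conjugations coexist on [R[i]]: that of numeric fields and that of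
    pairs. *)
Lemma conjCE a : a^* = a^*%C.
Proof.
have [-> | nz] := eqVneq a 0; first by rewrite !rmorph0.
by apply: (mulfI nz); apply: etrans (esym (normCK a)) _; exact: sqr_normc.
Qed.

Lemma conjC_Complex (x y : R) : (Complex x y)^* = Complex x (- y).
Proof. by rewrite conjCE. Qed.

Lemma rnorm_conj a : rnorm a^* = rnorm a.
Proof. by rewrite /rnorm norm_conjC. Qed.

Lemma mulC_conj a : a * a^* = (rnorm a ^+ 2)%:C%C.
Proof. by rewrite -normCK norm_rnorm rmorphXn. Qed.

Lemma Re_le_rnorm a : complex.Re a <= rnorm a.
Proof.
rewrite -[leRHS]ger0_norm ?rnorm_ge0 // -sqrtr_sqr rnorm_sqrE.
by rewrite (le_trans (ler_norm _)) // -sqrtr_sqr ler_wsqrtr // lerDl sqr_ge0.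
Qed.

Lemma ReD a b : complex.Re (a + b) = complex.Re a + complex.Re b.
Proof. by case: a b => [? ?] [? ?]. Qed.
Lemma ReN a : complex.Re (- a) = - complex.Re a.
Proof. by case: a. Qed.
Lemma ReB a b : complex.Re (a - b) = complex.Re a - complex.Re b.
Proof. by rewrite ReD ReN. Qed.
Lemma Re_rM (x : R) a : complex.Re (x%:C%C * a) = x * complex.Re a.
Proof. by case: a => ? ? /=; rewrite mul0r subr0. Qed.

Lemma rnorm_ge_sub V (u v : V) : rnorm u - rnorm v <= rnorm (u - v).
Proof. by rewrite lerBlDr -{1}(subrK v u) rnormD. Qed.

Lemma rnorm_triangle V (x y z : V) : rnorm (x - z) <= rnorm (x - y) + rnorm (y - z).
Proof. by rewrite -{1}(subrK y x) -addrA rnormD. Qed.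

Lemma unit_diskE z : unit_disk z = (rnorm z < 1) :> Prop.
Proof. by rewrite /unit_disk /mkset norm_rnorm -[1]/((1:R)%:C%C) ltcR. Qed.

Lemma rnorm_eq1 z : `|z| = 1 -> rnorm z = 1.
Proof. by rewrite /rnorm => ->. Qed.

End RealNorm.

(** * Power series of the kernel vectors *)

Section InnerProduct.
Variables (R : realType) (H : completeNormedModType R[i]).
Variable ip : {dot H for Num.conj}.
Hypothesis ip_norm : forall u : H, `|u| ^+ 2 = ip u u.
Local Notation C := R[i].
Implicit Types (u v : H) (c : C).

Lemma ip_sqr u : ip u u = (rnorm u ^+ 2)%:C%C.
Proof. by rewrite -ip_norm norm_rnorm rmorphXn. Qed.

Lemma ipBl u v w : ip (u - v) w = ip u w - ip v w.
Proof. by rewrite linearBl. Qed.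

Lemma ipZl c u v : ip (c *: u) v = c * ip u v.
Proof. by rewrite linearZl_LR. Qed.

Lemma ipC u v : ip u v = (ip v u)^*.
Proof. by rewrite hermC expr0 mul1r. Qed.

Lemma ipBr u v w : ip w (u - v) = ip w u - ip w v.
Proof. by rewrite linearBr. Qed.

Lemma ipZr c u v : ip u (c *: v) = c^* * ip u v.
Proof. by rewrite linearZr_LR. Qed.

Lemma ip_suml I (r : seq I) (F : I -> H) v :
  ip (\sum_(i <- r) F i) v = \sum_(i <- r) ip (F i) v.
Proof. exact: linear_sumlz. Qed.

Lemma ip_sumr I (r : seq I) (F : I -> H) v :
  ip v (\sum_(i <- r) F i) = \sum_(i <- r) ip v (F i).
Proof. exact: linear_sumr. Qed.

Lemma cauchy_schwarz u v : rnorm (ip u v) <= rnorm u * rnorm v.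
Proof.
have [v0 | v0] := eqVneq (rnorm v) 0.
  by rewrite (rnorm0_eq0 v0) linear0r !rnorm0 mulr0.
set t := ip u v; set nu := rnorm u ^+ 2; set nv := rnorm v ^+ 2.
have nv_gt0 : 0 < nv by rewrite exprn_gt0 // lt0r v0 rnorm_ge0.
have E : rnorm (nv%:C%C *: u - t *: v) ^+ 2 = nv * (nv * nu - rnorm t ^+ 2).
  apply: complexI; rewrite -ip_sqr !(ipBl, ipBr, ipZl, ipZr) (ipC v u) -/t.
  rewrite !ip_sqr conjCE conjc_real -/nu -/nv.
  have := mulC_conj t; set nt := rnorm t ^+ 2 => E.
  clearbody nt; clear nv_gt0; clearbody nu nv.
  by rewrite RcM RcB RcM -E; ring.
have : 0 <= nv * (nv * nu - rnorm t ^+ 2) by rewrite -E sqr_ge0.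
rewrite pmulr_rge0 // subr_ge0 mulrC /nu /nv -exprMn.
by rewrite ler_sqr // nnegrE ?mulr_ge0 ?rnorm_ge0.
Qed.

End InnerProduct.

Section SquareSums.
Variable R : realType.
Local Notation C := R[i].
Implicit Types (a c : nat -> C).

Lemma expr_small (x e : R) : 0 <= x < 1 -> 0 < e ->
  exists n0, forall n, (n0 <= n)%N -> x ^+ n <= e.
Proof.
move=> /andP[x0 x1] e0.
have /cvgrPdist_le/(_ _ e0)[n0 _ Hn] : (fun n => x ^+ n) @ \oo --> (0 : R).
  by apply: cvg_expr; rewrite ger0_norm.
by exists n0 => n /Hn; rewrite sub0r normrN ger0_norm ?exprn_ge0.
Qed.

Definition sq_sum_le a (M : R) := forall n, \sum_(m < n) rnorm (a m) ^+ 2 <= M.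

Lemma rnorm_sqrD (V : normedModType C) (u v : V) :
  rnorm (u + v) ^+ 2 <= 2 * (rnorm u ^+ 2 + rnorm v ^+ 2).
Proof.
have le2 : rnorm (u + v) ^+ 2 <= (rnorm u + rnorm v) ^+ 2.
  by rewrite ler_sqr ?nnegrE ?addr_ge0 ?rnorm_ge0 ?rnormD.
by have := sqr_ge0 (rnorm u - rnorm v); nra.
Qed.

Lemma sq_sum_leD a c M N : sq_sum_le a M -> sq_sum_le c N ->
  sq_sum_le (fun m => a m + c m) (2 * (M + N)).
Proof.
move=> aM cN n; apply: (@le_trans _ _ (2 * (\sum_(m < n) rnorm (a m) ^+ 2 +
    \sum_(m < n) rnorm (c m) ^+ 2))).
  rewrite -big_split mulr_sumr; apply: ler_sum => m _; exact: rnorm_sqrD.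
by rewrite ler_pM2l // lerD.
Qed.

Lemma sq_sum_leZ (x : C) a M : sq_sum_le a M ->
  sq_sum_le (fun m => x * a m) (rnorm x ^+ 2 * M).
Proof.
move=> aM n; rewrite (eq_bigr (fun m : 'I_n => rnorm x ^+ 2 * rnorm (a m) ^+ 2)).
  by rewrite -mulr_sumr ler_wpM2l ?sqr_ge0 //; exact: aM.
by move=> m _; rewrite rnormM exprMn.
Qed.

Lemma eq_sq_sum_le a c M : a =1 c -> sq_sum_le a M -> sq_sum_le c M.
Proof. by move=> /funext ->. Qed.

End SquareSums.

Section Szego.
Variables (R : realType) (H : completeNormedModType R[i]).
Variable ip : {dot H for Num.conj}.
Hypothesis ip_norm : forall u : H, `|u| ^+ 2 = ip u u.
Local Notation C := R[i].
Variables (b : C -> C) (k : C -> H).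
Hypothesis ip_kernel : forall z w, rnorm z < 1 -> rnorm w < 1 ->
  (1 - w^* * z) * ip (k w) (k z) = 1 - (b w)^* * b z.

(** A list of pairs [(c, w)] stands for the combination of the [k w] with
    coefficients [c], and [szego_coef] gives the power series of the same
    combination of Szego kernels.  Twisting the coefficients by powers of [w^*]
    is what makes [kernel_comb_step] telescope. *)
Definition in_disk (s : seq (C * C)) := all (fun p => rnorm p.2 < 1) s.
Definition kernel_comb n (s : seq (C * C)) : H :=
  \sum_(p <- s) (p.1 * p.2^* ^+ n) *: k p.2.
Definition szego_coef (s : seq (C * C)) n : C := \sum_(p <- s) p.1 * p.2^* ^+ n.
Definition weighted_coef (s : seq (C * C)) n : C :=
  \sum_(p <- s) p.1 * (b p.2)^* * p.2^* ^+ n.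

(** The defining relation of the kernel, [(1 - w^* z) <k w, k z> =
    1 - (b w)^* b z], summed against the coefficients. *)
Lemma kernel_comb_step s n : in_disk s ->
  rnorm (kernel_comb n s) ^+ 2 + rnorm (weighted_coef s n) ^+ 2 =
  rnorm (szego_coef s n) ^+ 2 + rnorm (kernel_comb n.+1 s) ^+ 2.
Proof.
move=> /allP sD; apply: complexI.
rewrite !RcD -!(ip_sqr ip_norm) -!mulC_conj.
rewrite /kernel_comb /szego_coef /weighted_coef !ip_suml.
rewrite ![(\sum_(p <- s) _)^*]rmorph_sum !mulr_suml -!big_split /=.
rewrite big_seq [RHS]big_seq; apply: eq_bigr => p ps.
rewrite !ip_sumr !mulr_sumr -!big_split /=.
rewrite big_seq [RHS]big_seq; apply: eq_bigr => q qs.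
have := ip_kernel (sD _ qs) (sD _ ps).
rewrite !ipZl !ipZr !rmorphM !rmorphXn /= !conjCK !exprS.
set t := ip _ _ => E.
have {1}-> : t = 1 - (b p.2)^* * b q.2 + p.2^* * q.2 * t by rewrite -E; ring.
ring.
Qed.

Lemma kernel_comb_small s (e : R) : in_disk s -> 0 < e ->
  exists n0, forall n, (n0 <= n)%N -> rnorm (kernel_comb n s) <= e.
Proof.
elim: s e => [|[c w] s IH] e /=; rewrite /kernel_comb.
  by move=> _ e0; exists 0%N => n _; rewrite big_nil rnorm0 ltW.
move=> /andP[w1 sD] e0; have e2 : 0 < e / 2 by rewrite divr_gt0.
have [n1 Hn1] := IH _ sD e2.
have B0 : 0 < rnorm c * rnorm (k w) + 1.
  by rewrite ltr_wpDl // mulr_ge0 ?rnorm_ge0.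
have w01 : 0 <= rnorm w < 1 by rewrite rnorm_ge0.
have [n2 Hn2] := expr_small w01 (divr_gt0 e2 B0).
exists (maxn n1 n2) => n; rewrite geq_max => /andP[/Hn1 le1 /Hn2].
rewrite ler_pdivlMr // => le2; rewrite big_cons /=.
apply: le_trans (rnormD _ _) _; rewrite (splitr e) lerD //.
rewrite rnormZ rnormM rnormX rnorm_conj; apply: le_trans le2.
rewrite mulrAC [leLHS]mulrC ler_wpM2l ?exprn_ge0 ?rnorm_ge0 //.
by rewrite lerDl.
Qed.

(** The kernel of H(b) is the Szego kernel minus a positive kernel; telescoping
    [kernel_comb_step] turns this into domination of norms. *)
Lemma kernel_comb_le s M : in_disk s -> sq_sum_le (szego_coef s) M ->
  rnorm (kernel_comb 0 s) ^+ 2 <= M.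
Proof.
move=> sD sM; have tel n : rnorm (kernel_comb 0 s) ^+ 2 <=
    \sum_(m < n) rnorm (szego_coef s m) ^+ 2 + rnorm (kernel_comb n s) ^+ 2.
  elim: n => [|n IH]; first by rewrite big_ord0 add0r.
  apply: le_trans IH _; rewrite big_ord_recr /= -addrA lerD2l.
  by rewrite -kernel_comb_step // lerDl sqr_ge0.
apply/ler_addgt0Pr => e e0.
have [n0 /(_ n0 (leqnn _)) Hn] : exists n0, forall n, (n0 <= n)%N ->
    rnorm (kernel_comb n s) <= Num.min e 1.
  by apply: kernel_comb_small => //; rewrite lt_min e0 ltr01.
move: Hn; rewrite le_min => /andP[ne n1].
apply: le_trans (tel n0) _; apply: lerD; first exact: sM.
by have := rnorm_ge0 (kernel_comb n0 s); nra.
Qed.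

Lemma kernel_comb_cat n s t :
  kernel_comb n (s ++ t) = kernel_comb n s + kernel_comb n t.
Proof. by rewrite /kernel_comb big_cat. Qed.

Lemma szego_coef_cat s t n :
  szego_coef (s ++ t) n = szego_coef s n + szego_coef t n.
Proof. by rewrite /szego_coef big_cat. Qed.

Definition scale_comb (c : C) (s : seq (C * C)) := [seq (c * p.1, p.2) | p <- s].

Lemma kernel_comb_scale n c s :
  kernel_comb n (scale_comb c s) = c *: kernel_comb n s.
Proof.
rewrite /kernel_comb big_map scaler_sumr; apply: eq_bigr => p _ /=.
by rewrite scalerA mulrA.
Qed.

Lemma szego_coef_scale c s n : szego_coef (scale_comb c s) n = c * szego_coef s n.
Proof.
rewrite /szego_coef big_map mulr_sumr; apply: eq_bigr => p _ /=.
by rewrite mulrA.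
Qed.

Lemma in_disk_scale c s : in_disk (scale_comb c s) = in_disk s.
Proof. by rewrite /in_disk all_map. Qed.

(** The graph of the contraction from square-summable sequences to H(b) that
    sends the Szego kernel at [w] to [k w], described by approximation. *)
Definition szego_image (x : H) (a : nat -> C) := forall e : R, 0 < e ->
  exists s, [/\ in_disk s, rnorm (x - kernel_comb 0 s) <= e &
    sq_sum_le (fun m => a m - szego_coef s m) e].

Lemma szego_image_kernel w : rnorm w < 1 -> szego_image (k w) (fun m => w^* ^+ m).
Proof.
move=> w1 e e0; exists [:: (1, w)]; split; first by rewrite /in_disk /= w1.
  by rewrite /kernel_comb big_seq1 /= mul1r expr0 scale1r subrr rnorm0 ltW.
move=> n; rewrite big1 ?ltW // => m _.
by rewrite /szego_coef big_seq1 /= mul1r subrr rnorm0 expr0n.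
Qed.

Lemma szego_imageZ c x a :
  szego_image x a -> szego_image (c *: x) (fun m => c * a m).
Proof.
move=> xa e e0; have B0 : 0 < rnorm c ^+ 2 + rnorm c + 1.
  by rewrite ltr_wpDl // addr_ge0 ?sqr_ge0 ?rnorm_ge0.
have [s [sD xs as_]] := xa _ (divr_gt0 e0 B0).
have Be z : 0 <= z -> z <= rnorm c ^+ 2 + rnorm c + 1 ->
    z * (e / (rnorm c ^+ 2 + rnorm c + 1)) <= e.
  by move=> z0 zB; rewrite mulrCA ler_piMr ?(ltW e0) // ler_pdivrMr // mul1r.
have c0 := rnorm_ge0 c.
exists (scale_comb c s); split; first by rewrite in_disk_scale.
  rewrite kernel_comb_scale -scalerBr rnormZ; apply: le_trans (Be _ c0 _).
    by rewrite ler_wpM2l.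
  by rewrite -addrA addrCA lerDl addr_ge0 ?sqr_ge0.
move=> n; under eq_bigr do rewrite szego_coef_scale -mulrBr.
apply: le_trans (sq_sum_leZ c as_ n) (Be _ (sqr_ge0 _) _).
by rewrite -addrA lerDl addr_ge0.
Qed.

Lemma szego_imageD x a y c : szego_image x a -> szego_image y c ->
  szego_image (x + y) (fun m => a m + c m).
Proof.
move=> xa yc e e0; have e4 : 0 < e / 4 by rewrite divr_gt0.
have [s [sD xs as_]] := xa _ e4; have [t [tD yt ct]] := yc _ e4.
exists (s ++ t); split; first by rewrite /in_disk all_cat; apply/andP.
  rewrite kernel_comb_cat opprD addrACA; apply: le_trans (rnormD _ _) _; lra.
move=> n; under eq_bigr do rewrite szego_coef_cat opprD addrACA.
by apply: le_trans (sq_sum_leD as_ ct n) _; lra.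
Qed.

Lemma szego_image0 : szego_image 0 (fun=> 0).
Proof.
move=> e e0; exists [::]; split=> //.
  by rewrite /kernel_comb big_nil subr0 rnorm0 ltW.
move=> n; rewrite big1 ?ltW // => m _.
by rewrite /szego_coef big_nil subr0 rnorm0 expr0n.
Qed.

Lemma szego_image_sum n (x : 'I_n -> H) (a : 'I_n -> nat -> C) :
  (forall i, szego_image (x i) (a i)) ->
  szego_image (\sum_i x i) (fun m => \sum_i a i m).
Proof.
move=> xa; elim: n x a xa => [|n IH] x a xa.
  rewrite big_ord0 (_ : (fun=> _) = fun=> 0); first exact: szego_image0.
  by apply/funext => m; rewrite big_ord0.
rewrite big_ord_recl (_ : (fun=> _) = fun m => a ord0 m + \sum_(i < n) a (lift ord0 i) m).
  by apply: szego_imageD (xa _) (IH _ _ _) => i; exact: xa.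
by apply/funext => m; rewrite big_ord_recl.
Qed.

Lemma szego_image_le x a M : szego_image x a -> sq_sum_le a M ->
  rnorm x ^+ 2 <= 4 * M.
Proof.
move=> xa aM; apply/ler_addgt0Pr => e e0.
have d0 : 0 < Num.min 1 (e / 6) by rewrite lt_min ltr01 divr_gt0.
set d := Num.min 1 (e / 6) in d0.
have [d1 d6] : d <= 1 /\ d <= e / 6 by split; rewrite ge_min lexx ?orbT.
have [s [sD xs as_]] := xa _ d0.
have Ms : sq_sum_le (szego_coef s) (2 * (M + d)).
  have sa : sq_sum_le (fun m => - (a m - szego_coef s m)) d.
    by move=> n; under eq_bigr do rewrite rnormN; exact: as_.
  apply: eq_sq_sum_le (sq_sum_leD aM sa) => m.
  by rewrite opprB addrCA subrr addr0.
have := kernel_comb_le sD Ms.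
have := rnorm_sqrD (x - kernel_comb 0 s) (kernel_comb 0 s).
rewrite subrK; have := rnorm_ge0 (x - kernel_comb 0 s); nra.
Qed.

(** This is where completeness of the space is used. *)
Lemma szego_image_closed a : (forall e : R, 0 < e -> exists x c,
    szego_image x c /\ sq_sum_le (fun m => a m - c m) e) ->
  exists x, szego_image x a.
Proof.
move=> Ha.
have /choice[xs /choice[cs Hxc]] n : exists x c, szego_image x c /\
    sq_sum_le (fun m => a m - c m) (n.+1%:R^-1).
  by apply: Ha; rewrite invr_gt0.
have sq_lt (x y : R) : 0 <= x -> 0 < y -> x ^+ 2 <= y ^+ 2 / 2 -> x < y by nra.
have close n m : rnorm (xs n - xs m) ^+ 2 <= 8 * (n.+1%:R^-1 + m.+1%:R^-1).
  have [[xn cn] [xm cm]] := (Hxc n, Hxc m).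
  have img : szego_image (xs n - xs m) (fun i => cs n i - cs m i).
    have := szego_imageD xn (szego_imageZ (-1) xm).
    by rewrite scaleN1r; under eq_fun do rewrite mulN1r.
  have le1 : sq_sum_le (fun i => cs n i - cs m i) (2 * (n.+1%:R^-1 + m.+1%:R^-1)).
    have cn' : sq_sum_le (fun i => - (a i - cs n i)) n.+1%:R^-1.
      by move=> N; under eq_bigr do rewrite rnormN; exact: cn.
    apply: eq_sq_sum_le (sq_sum_leD cn' cm) => i.
    by rewrite opprB addrA subrK.
  by have := szego_image_le img le1; rewrite mulrA -natrM.
have inv_small (e : R) : 0 < e -> exists N, forall n, (N <= n)%N -> n.+1%:R^-1 <= e.
  move=> e0; exists (Num.truncn e^-1).+1 => n Nn.
  rewrite -[e]invrK lef_pV2 ?posrE ?invr_gt0 //.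
  by apply: le_trans (ltW (truncnS_gt _)) _; rewrite ler_nat ltnW.
have /cauchy_cvg cvg_xs : cauchy (xs @ \oo).
  apply: cauchy_exP => eps eps0.
  have epsE : eps = (complex.Re eps)%:C%C by rewrite RRe_real // gtr0_real.
  have e0 : 0 < complex.Re eps by rewrite -ltcR -epsE.
  have [|N HN] := inv_small (complex.Re eps ^+ 2 / 32).
    by rewrite divr_gt0 ?exprn_gt0.
  exists (xs N); exists N => // n /= Nn; rewrite -ball_normE /= norm_rnorm epsE ltcR.
  apply: sq_lt; rewrite ?rnorm_ge0 //.
  apply: le_trans (close _ _) _; have := HN _ (leqnn N); have := HN _ Nn; move: (n.+1%:R^-1) (N.+1%:R^-1) => x y; lra.
exists (lim (xs @ \oo)) => e e0.
have e8 : 0 < e / 4 by rewrite divr_gt0.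
have [N HN] := inv_small _ e8.
have e2 : 0 < (e / 2)%:C%C by rewrite ltcR divr_gt0.
have /cvgrPdist_lt/(_ _ e2)[N' _ HN'] := cvg_xs.
pose n := maxn N N'.
have := HN' n (leq_maxr _ _); rewrite norm_rnorm ltcR => le_lim.
have := HN n (leq_maxl _ _) => le_n.
have [xn cn] := Hxc n; have [s [sD xsn css]] := xn _ e8.
exists s; split=> //.
  apply: le_trans (rnorm_triangle _ (xs n) _) _; lra.
move=> m; have := sq_sum_leD cn css m.
under eq_bigr do rewrite addrA subrK; move=> /le_trans; apply.
by move: (n.+1%:R^-1) le_n => x; lra.
Qed.

Definition delta_seq n : nat -> C := fun m => (m == n)%:R.

(** The last summand is the remainder that makes the induction close. *)
Lemma shifted_geometric_le (x : R) n N : 0 <= x < 1 ->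
  (1 - x) * (\sum_(m < N) (if (n < m)%N then x ^+ (m - n) else 0)) +
    (if (n < N)%N then x ^+ (N - n) else x) <= x.
Proof.
move=> /andP[x0 x1]; elim: N => [|N IH].
  by rewrite big_ord0 mulr0 add0r.
rewrite big_ord_recr /= mulrDr ltnS; move: IH.
have [/ltnW nN|Nn] := ltnP n N.
  by rewrite nN subSn // exprS; nra.
rewrite mulr0 addr0; case: (leqP n N) => // nN.
by have -> : N = n by [apply/eqP; rewrite eqn_leq Nn]; rewrite subSnn expr1.
Qed.

(** [delta_seq n] is the limit, as [t] tends to 0, of the sequence
    [t ^ (m - n)] for [n <= m], which is the Szego kernel at [t] stripped of
    its first [n] terms and renormalized. *)
Lemma szego_image_delta n : exists x, szego_image x (delta_seq n).
Proof.
have [m] := ubnP n; elim: m n => // m IH n /ltnSE nm.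
have /choice[x xP] (j : 'I_n) : exists x, szego_image x (delta_seq j).
  by apply: IH; exact: leq_trans (ltn_ord j) nm.
apply: szego_image_closed => e e0.
pose t := Num.min (1 / 2) (e / 2).
have [t0 t2 te] : [/\ 0 < t, t <= 1 / 2 & t <= e / 2].
  by rewrite lt_min !divr_gt0 // ge_min lexx ge_min lexx orbT.
have t1 : rnorm (t%:C%C : C) < 1 by rewrite rnorm_real gtr0_norm //; lra.
have tC0 : (t%:C%C : C) != 0 by rewrite (inj_eq (@complexI R) t 0) gt_eqF.
have tJ : (t%:C%C : C)^* = t%:C%C by rewrite conjCE conjc_real.
exists (t%:C%C ^- n *: (k t%:C%C - \sum_(j < n) t%:C%C ^+ j *: x j)).
exists (fun i => if (n <= i)%N then t%:C%C ^+ (i - n) else 0); split.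
  have := szego_imageZ (t%:C%C ^- n) (szego_imageD (szego_image_kernel t1)
    (szego_imageZ (-1) (szego_image_sum (fun j : 'I_n => szego_imageZ (t%:C%C ^+ j) (xP j))))).
  rewrite scaleN1r; congr szego_image; apply/funext => i.
  rewrite tJ mulN1r.
  have [ni|ni] := leqP n i.
    rewrite big1 ?subr0 => [|j _].
      by rewrite -{1}(subnKC ni) exprD mulKf ?expf_neq0.
    rewrite /delta_seq gtn_eqF ?mulr0 //; exact: leq_trans (ltn_ord j) ni.
  rewrite (bigD1 (Ordinal ni)) //= /delta_seq eqxx mulr1 big1 ?addr0 ?subrr ?mulr0 //.
  move=> j /negPf; rewrite -val_eqE /= eq_sym => ->; exact: mulr0.
move=> N; have t01 : 0 <= t ^+ 2 < 1 by apply/andP; split; nra.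
rewrite (eq_bigr (fun i : 'I_N => if (n < i)%N then (t ^+ 2) ^+ (i - n) else 0)).
  have := shifted_geometric_le n N t01.
  set S := \sum_(_ < _) _; set y := if _ then _ else _ => le1.
  have y0 : 0 <= y by rewrite /y; case: ifP => _; [apply: exprn_ge0|]; exact: sqr_ge0.
  have S0 : 0 <= S.
    by apply: sumr_ge0 => j _; case: ifP => // _; rewrite exprn_ge0 ?sqr_ge0.
  have tt4 : t ^+ 2 <= 1 / 4 by nra.
  have tte : t ^+ 2 <= e / 4 by nra.
  have : S * t ^+ 2 <= S * (1 / 4) by rewrite ler_wpM2l.
  nra.
move=> i _; rewrite /delta_seq.
case: (ltngtP n i) => [ni|ni|->].
- by rewrite sub0r rnormN -RcX rnorm_real ger0_norm ?exprn_ge0 ?ltW // exprAC.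
- by rewrite subr0 rnorm0 expr0n.
- by rewrite subnn expr0 subrr rnorm0 expr0n.
Qed.

Lemma tail_geometric_le (x : R) M n : 0 <= x < 1 ->
  (1 - x) * (\sum_(m < n) (if (m < M)%N then 0 else x ^+ m)) +
    (if (M <= n)%N then x ^+ n else x ^+ M) <= x ^+ M.
Proof.
move=> /andP[x0 x1]; elim: n => [|n IH].
  by rewrite big_ord0 mulr0 add0r leqn0; case: eqP => // ->.
rewrite big_ord_recr /= mulrDr; move: IH.
have [nM|Mn] := ltnP n M; last by rewrite (leq_trans Mn) // exprS; nra.
rewrite mulr0 addr0; case: (leqP M n.+1) => // Mn.
by have -> : M = n.+1 by apply/eqP; rewrite eqn_leq Mn.
Qed.

Lemma sum_delta_seq N (d : nat -> C) m :
  \sum_(i < N) d i * delta_seq i m = if (m < N)%N then d m else 0.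
Proof.
rewrite /delta_seq; case: ltnP => mN.
  rewrite (bigD1 (Ordinal mN)) //= eqxx mulr1 big1 ?addr0 //.
  by move=> j /negPf; rewrite -val_eqE /= eq_sym => ->; rewrite mulr0.
by rewrite big1 // => j _; rewrite gtn_eqF ?mulr0 // (leq_trans _ mN).
Qed.

(** The contraction above sends the [n]-th basis sequence to [e n] and the
    geometric sequence, which is the Szego kernel, to [k w].  The factor 4
    pays for describing the contraction by approximation. *)
Lemma kernel_power_series : exists e : nat -> H,
  (forall N (d : nat -> C),
      rnorm (\sum_(i < N) d i *: e i) ^+ 2 <= 4 * \sum_(i < N) rnorm (d i) ^+ 2) /\
  (forall r eps : R, 0 <= r < 1 -> 0 < eps -> exists M0, forall M, (M0 <= M)%N ->
      forall w, rnorm w <= r -> rnorm (k w - \sum_(i < M) w^* ^+ i *: e i) <= eps).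
Proof.
have /choice[e eP] := szego_image_delta; exists e; split=> [N d|].
  apply: szego_image_le.
    exact: szego_image_sum (fun i : 'I_N => szego_imageZ (d i) (eP i)).
  move=> n; pose G m := if (m < N)%N then rnorm (d m) ^+ 2 else 0.
  have G0 m : 0 <= G m by rewrite /G; case: ifP => // _; rewrite sqr_ge0.
  rewrite (eq_bigr (fun m : 'I_n => G m)) => [|m _]; last first.
    by rewrite sum_delta_seq /G; case: ifP => // _; rewrite rnorm0 expr0n.
  apply: (@le_trans _ _ (\sum_(m < N + n) G m)).
    by rewrite addnC big_split_ord /= lerDl sumr_ge0.
  rewrite big_split_ord /= [X in _ + X]big1 ?addr0 => [|m _].
    by apply: ler_sum => m _; rewrite /G ltn_ord.
  by rewrite /G ltnNge leq_addr.
move=> r eps /andP[r0 r1] eps0.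
have x01 : 0 <= r ^+ 2 < 1 by apply/andP; split; nra.
have d0 : 0 < eps ^+ 2 * (1 - r ^+ 2) / 4 by rewrite divr_gt0 // mulr_gt0; nra.
have [M0 HM0] := expr_small x01 d0; exists M0 => M /HM0 xM w wr.
have w1 : rnorm w < 1 by lra.
have := szego_imageD (szego_image_kernel w1)
    (szego_imageZ (-1) (szego_image_sum (fun i : 'I_M => szego_imageZ (w^* ^+ i) (eP i)))).
rewrite scaleN1r => img; set x := k w - _ in img *.
have : rnorm x ^+ 2 <= 4 * ((r ^+ 2) ^+ M / (1 - r ^+ 2)).
  apply: szego_image_le img _ => n.
  rewrite ler_pdivlMr ?subr_gt0; last by case/andP: x01.
  have := tail_geometric_le M n x01.
  set S := \sum_(_ < _) _; set S' := \sum_(_ < _) _ => le1.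
  have SS : S' <= S.
    apply: ler_sum => i _; rewrite sum_delta_seq mulN1r; case: ltnP => iM.
      by rewrite subrr rnorm0 expr0n.
    rewrite subr0 rnormX rnorm_conj exprAC.
    by rewrite lerXn2r ?nnegrE ?sqr_ge0 // lerXn2r ?nnegrE ?rnorm_ge0.
  have : 0 <= (if (M <= n)%N then (r ^+ 2) ^+ n else (r ^+ 2) ^+ M).
    by case: ifP => _; rewrite exprn_ge0 ?sqr_ge0.
  by case/andP: x01 => _ x1; nra.
have : 4 * ((r ^+ 2) ^+ M / (1 - r ^+ 2)) <= eps ^+ 2.
  rewrite mulrA ler_pdivrMr ?subr_gt0; last by case/andP: x01.
  lra.
move=> le1 le2; rewrite -ler_sqr ?nnegrE ?rnorm_ge0 ?(ltW eps0) //.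
exact: le_trans le2 le1.
Qed.

End Szego.

(** * Uniform approximation by polynomials *)

Section PolyApprox.
Variable R : realType.
Local Notation C := R[i].
Implicit Types (F G : C -> C) (r : R) (p q : {poly C}).

(** This is the form in which holomorphy is used: it is stable under the
    operations below, and means over roots of unity of polynomials are
    computed exactly. *)
Definition poly_approx F r := forall e : R, 0 < e ->
  exists p, forall z, rnorm z <= r -> rnorm (F z - p.[z]) <= e.

Lemma poly_approx_horner p r : poly_approx (fun z => p.[z]) r.
Proof. by move=> e e0; exists p => z _; rewrite subrr rnorm0 ltW. Qed.

Lemma eq_poly_approx F G r : (forall z, rnorm z <= r -> F z = G z) ->
  poly_approx F r -> poly_approx G r.
Proof. by move=> FG FP e /FP[p Hp]; exists p => z zr; rewrite -FG ?Hp. Qed.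

Lemma poly_approxS F r r' : r' <= r -> poly_approx F r -> poly_approx F r'.
Proof. by move=> rr FP e /FP[p Hp]; exists p => z zr; apply: Hp; lra. Qed.

Lemma poly_approx_cst c r : poly_approx (fun=> c) r.
Proof.
apply: eq_poly_approx (poly_approx_horner c%:P r) => z _.
by rewrite hornerC.
Qed.

Lemma poly_approxD F G r : poly_approx F r -> poly_approx G r ->
  poly_approx (fun z => F z + G z) r.
Proof.
move=> FP GP e e0; have e2 : 0 < e / 2 by rewrite divr_gt0.
have [[p Hp] [q Hq]] := (FP _ e2, GP _ e2); exists (p + q) => z zr.
rewrite hornerD opprD addrACA; apply: le_trans (rnormD _ _) _.
have := Hp _ zr; have := Hq _ zr; lra.
Qed.

Lemma horner_bounded p r : exists B, 0 <= B /\ forall z, rnorm z <= r -> rnorm p.[z] <= B.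
Proof.
exists (\sum_(i < size p) rnorm p`_i * `|r| ^+ i); split.
  by apply: sumr_ge0 => i _; rewrite mulr_ge0 ?rnorm_ge0 ?exprn_ge0.
move=> z zr; rewrite horner_coef; apply: le_trans (rnorm_sum _ _ _) _.
apply: ler_sum => i _; rewrite rnormM rnormX ler_wpM2l ?rnorm_ge0 //.
rewrite lerXn2r ?nnegrE ?rnorm_ge0 //.
by apply: le_trans zr (ler_norm _).
Qed.

Lemma poly_approx_bounded F r : poly_approx F r ->
  exists B, 0 <= B /\ forall z, rnorm z <= r -> rnorm (F z) <= B.
Proof.
move=> /(_ 1 ltr01)[p Hp]; have [B [B0 HB]] := horner_bounded p r.
exists (1 + B); split=> [|z zr]; first by rewrite addr_ge0.
rewrite -(subrK p.[z] (F z)); apply: le_trans (rnormD _ _) _.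
by rewrite lerD ?Hp ?HB.
Qed.

Lemma poly_approxM F G r : poly_approx F r -> poly_approx G r ->
  poly_approx (fun z => F z * G z) r.
Proof.
move=> FP GP e e0; have [B [B0 HB]] := poly_approx_bounded GP.
have d0 : 0 < e / 2 / (B + 1) by rewrite !divr_gt0 // ltr_wpDl.
have [p Hp] := FP _ d0; have [B' [B'0 HB']] := horner_bounded p r.
have d0' : 0 < e / 2 / (B' + 1) by rewrite !divr_gt0 // ltr_wpDl.
have [q Hq] := GP _ d0'; exists (p * q) => z zr.
have -> : F z * G z - (p * q).[z] =
    (F z - p.[z]) * G z + p.[z] * (G z - q.[z]) by rewrite hornerM; ring.
apply: le_trans (rnormD _ _) _; rewrite !rnormM [e]splitr lerD //.
  apply: (@le_trans _ _ (e / 2 / (B + 1) * (B + 1))).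
    by rewrite ler_pM ?rnorm_ge0 ?Hp // (le_trans (HB _ zr)) ?lerDl.
  by rewrite divfK // gt_eqF // ltr_wpDl.
apply: (@le_trans _ _ ((B' + 1) * (e / 2 / (B' + 1)))).
  by rewrite ler_pM ?rnorm_ge0 ?Hq // (le_trans (HB' _ zr)) ?lerDl.
by rewrite mulrC divfK // gt_eqF // ltr_wpDl.
Qed.

Lemma poly_approxX F r n : poly_approx F r -> poly_approx (fun z => F z ^+ n) r.
Proof.
move=> FP; elim: n => [|n IH]; first exact: poly_approx_cst.
by under eq_fun do rewrite exprS; exact: poly_approxM.
Qed.

Lemma poly_approxB F G r : poly_approx F r -> poly_approx G r ->
  poly_approx (fun z => F z - G z) r.
Proof.
move=> FP GP; apply: eq_poly_approx
  (poly_approxD FP (poly_approxM (poly_approx_cst (-1) r) GP)) => z _.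
by rewrite mulN1r.
Qed.

Lemma poly_approx_lim F r : (forall e : R, 0 < e -> exists G,
    poly_approx G r /\ forall z, rnorm z <= r -> rnorm (F z - G z) <= e) ->
  poly_approx F r.
Proof.
move=> FG e e0; have e2 : 0 < e / 2 by rewrite divr_gt0.
have [G [GP HG]] := FG _ e2; have [p Hp] := GP _ e2; exists p => z zr.
apply: le_trans (rnorm_triangle _ (G z) _) _.
have := HG _ zr; have := Hp _ zr; lra.
Qed.

(** The geometric series of [F] converges uniformly. *)
Lemma poly_approx_inv F r rho : 0 <= rho < 1 ->
  (forall z, rnorm z <= r -> rnorm (F z) <= rho) -> poly_approx F r ->
  poly_approx (fun z => (1 - F z)^-1) r.
Proof.
move=> rho01 Fr FP; have /andP[rho0 rho1] := rho01.
apply: poly_approx_lim => e e0.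
have d0 : 0 < e * (1 - rho) by rewrite mulr_gt0 // subr_gt0.
have [n /(_ n (leqnn n)) Hn] := expr_small rho01 d0.
exists (fun z => \sum_(i < n) F z ^+ i); split.
  elim: n {Hn} => [|n IH].
    by under eq_fun do rewrite big_ord0; exact: poly_approx_cst.
  under eq_fun do rewrite big_ord_recr /=.
  by apply: poly_approxD => //; exact: poly_approxX.
move=> z zr; have le1 : 1 - rho <= rnorm (1 - F z).
  by apply: le_trans (rnorm_ge_sub _ _); rewrite rnorm1 lerB ?Fr.
have gt0 : 0 < rnorm (1 - F z) by lra.
have nz : 1 - F z != 0 by apply: contraTneq gt0 => ->; rewrite rnorm0 ltxx.
have -> : (1 - F z)^-1 - \sum_(i < n) F z ^+ i = F z ^+ n / (1 - F z).
  have E : (1 - F z) * \sum_(i < n) F z ^+ i = 1 - F z ^+ n.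
    by rewrite -opprB mulNr -subrX1 opprB.
  by apply: (mulfI nz); rewrite mulrBr E mulrCA divff // mulr1; ring.
rewrite rnormM rnormV rnormX ler_pdivrMr //.
apply: (@le_trans _ _ (rho ^+ n)).
  by rewrite lerXn2r ?nnegrE ?rnorm_ge0 ?Fr.
by apply: le_trans Hn _; rewrite ler_pM2l.
Qed.

Lemma poly_approx_affine F r (c d : C) r' : rnorm c + rnorm d * r' <= r ->
  poly_approx F r -> poly_approx (fun z => F (c + d * z)) r'.
Proof.
move=> le_r FP e /FP[p Hp]; exists (p \Po (d%:P * 'X + c%:P)) => z zr.
have -> : (p \Po (d%:P * 'X + c%:P)).[z] = p.[c + d * z].
  by rewrite horner_comp !hornerE addrC.
apply: Hp.
apply: le_trans (rnormD _ _) _; rewrite rnormM; apply: le_trans le_r.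
by rewrite lerD2l ler_wpM2l ?rnorm_ge0.
Qed.

Lemma poly_approx_continuous F r z0 : rnorm z0 < r -> poly_approx F r ->
  forall e : R, 0 < e -> exists eta : R, 0 < eta /\
    forall z, rnorm (z - z0) <= eta -> rnorm (F z - F z0) <= e.
Proof.
move=> z0r FP e e0; have s0 : 0 < r - rnorm z0 by rewrite subr_gt0.
have : rnorm z0 + rnorm (1 : C) * (r - rnorm z0) <= r by rewrite rnorm1; lra.
move=> /poly_approx_affine/(_ FP)/(_ (e / 3))[|p Hp]; first by rewrite divr_gt0.
have [q Hq] : exists q, p = q * 'X + (p.[0])%:P.
  have /factor_theorem[q E] : root (p - p.[0]%:P) 0 by rewrite /root !hornerE subrr.
  by exists q; rewrite -[LHS](subrK p.[0]%:P) E subr0.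
have [B [B0 HB]] := horner_bounded q (r - rnorm z0).
have d0 : 0 < e / 3 / (B + 1) by rewrite !divr_gt0 // ltr_wpDl.
exists (Num.min (r - rnorm z0) (e / 3 / (B + 1))); split.
  by rewrite lt_min s0.
move=> z; rewrite le_min => /andP[le1 le2].
have -> : F z = F (z0 + 1 * (z - z0)) by rewrite mul1r addrC subrK.
have := Hp _ le1; have := Hp 0; rewrite rnorm0 mulr0 addr0.
move=> /(_ (ltW s0)) le3 le4.
have le5 : rnorm (p.[z - z0] - p.[0]) <= e / 3.
  rewrite {1}Hq hornerD hornerC addrK hornerM hornerX rnormM.
  apply: (@le_trans _ _ ((B + 1) * (e / 3 / (B + 1)))).
    by rewrite ler_pM ?rnorm_ge0 // (le_trans (HB _ le1)) ?lerDl.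
  by rewrite mulrC divfK // gt_eqF // ltr_wpDl.
apply: le_trans (rnorm_triangle _ p.[z - z0] _) _.
have := rnorm_triangle p.[z - z0] p.[0] (F z0).
rewrite (rdistC p.[0]); lra.
Qed.

End PolyApprox.

(** * Means over roots of unity, and a compactness lemma *)

Section RootsOfUnity.
Variable R : realType.
Local Notation C := R[i].
Implicit Types (F : C -> C) (w z : C).

(** [X ^ N - 1] splits with distinct roots, and a finite group of roots of
    unity of that size is cyclic. *)
Lemma prim_root_exists (F : numClosedFieldType) N : (0 < N)%N ->
  exists w : F, N.-primitive_root w.
Proof.
move=> N0; have [s E] := closed_field_poly_normal ('X^N - 1 : {poly F}).
rewrite (monicP (monicXnsubC 1 N0)) scale1r in E.
have s_unity : all N.-unity_root s.
  by apply/allP => z; rewrite unity_rootE -subr_eq0 -root_prod_XsubC -E rootE !hornerE.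
have : has N.-primitive_root s.
  apply: has_prim_root => //; last first.
    by rewrite -ltnS -(size_prod_XsubC s id) -E size_XnsubC.
  by rewrite -separable_prod_XsubC -E separable_Xn_sub_1 // pnatr_eq0 -lt0n.
by case/hasP => w _; exists w.
Qed.

Variables (N : nat) (w : C).
Hypothesis w_prim : N.-primitive_root w.

Lemma rnorm_prim_root : rnorm w = 1.
Proof.
have N0 := prim_order_gt0 w_prim.
apply/eqP; rewrite -(@pexpr_eq1 _ _ N) ?rnorm_ge0 // -rnormX.
by rewrite prim_expr_order // rnorm1.
Qed.

Lemma rnorm_root_exp j : rnorm (w ^+ j) = 1.
Proof. by rewrite rnormX rnorm_prim_root expr1n. Qed.

Lemma sum_root_powers m : \sum_(j < N) (w ^+ j) ^+ m = if (N %| m)%N then N%:R else 0.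
Proof.
under eq_bigr do rewrite exprAC.
rewrite (prim_order_dvd w_prim); case: eqP => [-> | /eqP wm].
  rewrite (eq_bigr (fun=> 1)) => [|j _]; last exact: expr1n.
  by rewrite sumr_const card_ord.
have wm1 : w ^+ m - 1 != 0 by rewrite subr_eq0.
apply: (mulfI wm1); rewrite -subrX1 mulr0 -exprM mulnC exprM.
by rewrite (prim_expr_order w_prim) expr1n subrr.
Qed.

(** The mean value property: only the constant coefficient survives. *)
Lemma mean_horner (p : {poly C}) (s : C) : (size p <= N)%N ->
  \sum_(j < N) p.[s * w ^+ j] = N%:R * p.[0].
Proof.
move=> pN; under eq_bigr do rewrite (horner_coef_wide _ pN).
rewrite exchange_big /=.
transitivity (\sum_(i < N) p`_i * s ^+ i * \sum_(j < N) (w ^+ j) ^+ i).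
  apply: eq_bigr => i _; rewrite mulr_sumr; apply: eq_bigr => j _.
  by rewrite exprMn mulrA.
have N0 := prim_order_gt0 w_prim.
rewrite (bigD1 (Ordinal N0)) //= sum_root_powers dvdn0 expr0 mulr1 horner_coef0.
rewrite big1 ?addr0 1?mulrC // => i /negPf iN0.
rewrite sum_root_powers gtnNdvd ?mulr0 //.
by rewrite lt0n -val_eqE /= in iN0 *; rewrite iN0.
Qed.

End RootsOfUnity.

Section MeanValue.
Variable R : realType.
Local Notation C := R[i].
Implicit Types (F : C -> C) (w z : C).

(** Subharmonicity of [|F|], up to an error that vanishes as the number of
    points grows. *)
Lemma submean F (s : R) : 0 <= s -> poly_approx F s -> forall e : R, 0 < e ->
  exists N0, forall N w, (N0 <= N)%N -> N.-primitive_root w ->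
  N%:R * rnorm (F 0) <= \sum_(j < N) rnorm (F (s%:C%C * w ^+ j)) + N%:R * e.
Proof.
move=> s0 FP e e0; have e2 : 0 < e / 2 by rewrite divr_gt0.
have [p Hp] := FP _ e2; exists (size p) => N w pN wN.
have le1 : rnorm (F 0) <= rnorm p.[0] + e / 2.
  have := Hp 0; rewrite rnorm0 => /(_ s0).
  by have := rnorm_ge_sub (F 0) p.[0]; lra.
have le2 : N%:R * rnorm p.[0] <= \sum_(j < N) (rnorm (F (s%:C%C * w ^+ j)) + e / 2).
  have -> : N%:R * rnorm p.[0] = rnorm (N%:R * p.[0]).
    by rewrite rnormM -Rc_nat rnorm_real ger0_norm.
  rewrite -(mean_horner wN (s%:C%C) pN); apply: le_trans (rnorm_sum _ _ _) _.
  apply: ler_sum => j _; set z := _ * _.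
  have zs : rnorm z <= s.
    by rewrite rnormM rnorm_real (rnorm_root_exp wN) mulr1 ger0_norm.
  have := Hp _ zs; have := rnorm_ge_sub p.[z] (F z); rewrite rdistC; lra.
rewrite big_split /= sumr_const card_ord -[X in _ + X]mulr_natl in le2.
have := ler_wpM2l (ler0n R N) le1; lra.
Qed.

Lemma Re_sum I (r : seq I) (f : I -> C) :
  complex.Re (\sum_(i <- r) f i) = \sum_(i <- r) complex.Re (f i).
Proof. by elim/big_rec2: _ => // i x y _ <-; rewrite ReD. Qed.

Lemma rnorm_sqrDC w z :
  rnorm (w + z) ^+ 2 = rnorm w ^+ 2 + rnorm z ^+ 2 + 2 * complex.Re (w^* * z).
Proof. by rewrite !rnorm_sqrE conjCE; case: w z => [a b] [c d] /=; ring. Qed.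

Lemma mean_sqr_dist N w (p : C) (s : R) : (1 < N)%N -> N.-primitive_root w ->
  \sum_(j < N) rnorm (p + s%:C%C * w ^+ j) ^+ 2 = N%:R * (rnorm p ^+ 2 + s ^+ 2).
Proof.
move=> N1 wN; under eq_bigr do rewrite rnorm_sqrDC mulrA.
rewrite big_split /= -mulr_sumr -Re_sum -mulr_sumr.
have := sum_root_powers wN 1; rewrite gtnNdvd // => E.
rewrite (_ : \sum_(j < N) w ^+ j = 0) ?mulr0 ?addr0 //.
rewrite (eq_bigr (fun=> rnorm p ^+ 2 + s ^+ 2)) => [|j _]; last first.
  by rewrite rnormM rnorm_real (rnorm_root_exp wN) mulr1 real_normK ?num_real.
by rewrite sumr_const card_ord mulr_natl.
Qed.

Lemma rnorm_le_ReIm z : rnorm z <= `|complex.Re z| + `|complex.Im z|.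
Proof.
rewrite -ler_sqr ?nnegrE ?addr_ge0 ?rnorm_ge0 // rnorm_sqrE.
rewrite -(real_normK (num_real (complex.Re z))) -(real_normK (num_real (complex.Im z))).
by have := normr_ge0 (complex.Re z); have := normr_ge0 (complex.Im z); nra.
Qed.

Lemma ReIm_le_rnorm z : `|complex.Re z| <= rnorm z /\ `|complex.Im z| <= rnorm z.
Proof.
split; rewrite -ler_sqr ?nnegrE ?rnorm_ge0 // rnorm_sqrE real_normK ?num_real //.
  by rewrite lerDl sqr_ge0.
by rewrite lerDr sqr_ge0.
Qed.

(** A supremum need not be attained since [m] has no continuity, but it is
    approached along points accumulating at some [p], by compactness of the
    closed disk. *)
Lemma sup_cluster_point (L : set C) (m : C -> R) (B : R) :
  L !=set0 -> (forall w, L w -> rnorm w <= 1) -> (forall w, L w -> m w <= B) ->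
  exists (S : R) (p : C), (forall w, L w -> m w <= S) /\
    forall eta : R, 0 < eta -> exists w, [/\ L w, rnorm (w - p) <= eta & S - eta < m w].
Proof.
move=> [w0 Lw0] L1 LB.
have hs : has_sup (m @` L).
  by split; [exists (m w0), w0|exists B => _ [w Lw <-]; exact: LB].
have mS w : L w -> m w <= sup (m @` L).
  by move=> Lw; apply: ub_le_sup; [case: hs|exists w].
set S := sup (m @` L) in mS *.
pose A (eta : R) := [set q : R * R | L (Complex q.1 q.2) /\ S - eta < m (Complex q.1 q.2)].
have A0 (eta : R) : 0 < eta -> A eta !=set0.
  move=> eta0; have [_ [w Lw <-] Sw] := sup_adherent eta0 hs.
  by exists (complex.Re w, complex.Im w); split=> /=; rewrite -[Complex _ _]/(Complex _ _);
    case: w Lw Sw.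
pose F := filter_from [set eta : R | 0 < eta] A.
have FF : ProperFilter F.
  apply: filter_from_proper; last exact: A0.
  apply: filter_from_filter; first by exists 1; exact: ltr01.
  move=> i j /= i0 j0; exists (Num.min i j); first by rewrite /= lt_min i0.
  move=> q [Lq Sq]; split; split=> //; apply: le_lt_trans Sq; rewrite lerB //;
  by rewrite ge_min lexx ?orbT.
have cpt : compact (`[-1, 1]%classic `*` `[-1, 1]%classic : set (R * R)).
  by apply: compact_setX; exact: segment_compact.
have [[x y] [_ cl]] : (`[-1, 1]%classic `*` `[-1, 1]%classic : set (R * R)) `&` cluster F !=set0.
  apply: cpt; exists 1 => /=; first exact: ltr01.
  move=> [x y] [/L1 /= xy1 _]; have [] := ReIm_le_rnorm (Complex x y).
  by move=> /le_trans/(_ xy1) /= + /le_trans/(_ xy1) /=; rewrite !ler_norml; split => /=; rewrite in_itv.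
exists S, (Complex x y); split=> // eta eta0.
have e2 : 0 < eta / 2 by rewrite divr_gt0.
have [] := cl (A eta) (ball x (eta / 2) `*` ball y (eta / 2)).
- by exists eta.
- by exists (ball x (eta / 2), ball y (eta / 2)) => //; split; exact: nbhsx_ballx.
move=> [x' y'] [[/= Lq Sq] [/= xx' yy']].
exists (Complex x' y'); split => //.
apply: le_trans (rnorm_le_ReIm _) _ => /=.
move: xx' yy'; rewrite -!ball_normE /= (distrC x) (distrC y); lra.
Qed.

End MeanValue.

(** * Decay of the defect of b near zeta *)

Section Barrier.
Variable R : realType.
Local Notation C := R[i].
Variables (b : C -> C) (zeta : C) (d : R).
Hypothesis d01 : 0 < d <= 1.
Hypothesis b_approx : forall r : R, r < 1 -> poly_approx b r.
Hypothesis b_half : forall z, rnorm z < 1 -> rnorm (z - zeta) < d -> 1 / 2 <= rnorm (b z).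
Hypothesis b_bdry : forall lam, rnorm lam = 1 -> rnorm (lam - zeta) < d ->
  forall e : R, 0 < e -> exists eta : R, 0 < eta /\
    forall z, rnorm z < 1 -> rnorm (z - lam) <= eta -> 1 - e <= rnorm (b z).

(** [1 / b] is holomorphic near each point where [b] does not vanish. *)
Lemma inv_b_approx p : rnorm p < 1 -> rnorm (p - zeta) < d ->
  exists s0 : R, 0 < s0 /\ forall s : R, s <= s0 ->
    poly_approx (fun h => (b (p + h))^-1) s.
Proof.
move=> p1 pz; have bp := b_half p1 pz.
have bp0 : b p != 0.
  by apply: contraTneq bp => ->; rewrite rnorm0 -ltNge divr_gt0.
pose r := (1 + rnorm p) / 2.
have [pr r1] : rnorm p < r /\ r < 1 by rewrite /r; split; lra.
have e0 : 0 < rnorm (b p) / 2 by lra.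
have [eta [eta0 Heta]] := poly_approx_continuous pr (b_approx r1) e0.
exists (Num.min eta (r - rnorm p)); split; first by rewrite lt_min eta0 subr_gt0.
move=> s; rewrite le_min => /andP[s_eta sr].
have bP : poly_approx (fun h => b (p + h)) s.
  have le1 : rnorm p + rnorm (1 : C) * s <= r by rewrite rnorm1; lra.
  apply: eq_poly_approx (poly_approx_affine le1 (b_approx r1)) => h _.
  by rewrite mul1r.
have half01 : 0 <= (1 / 2 : R) < 1 by apply/andP; split; lra.
have FP : poly_approx (fun h => 1 - b (p + h) * (b p)^-1) s.
  apply: poly_approxB; first exact: poly_approx_cst.
  by apply: poly_approxM => //; exact: poly_approx_cst.
have Fs h : rnorm h <= s -> rnorm (1 - b (p + h) * (b p)^-1) <= 1 / 2.
  move=> hs; have -> : 1 - b (p + h) * (b p)^-1 = (b p - b (p + h)) * (b p)^-1.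
    by rewrite mulrBl divff.
  rewrite rnormM rnormV rdistC ler_pdivrMr; last by lra.
  have := Heta (p + h); rewrite addrAC subrr add0r => /(_ (le_trans hs s_eta)); lra.
have := poly_approxM (poly_approx_inv half01 Fs FP) (poly_approx_cst (b p)^-1 s).
apply: eq_poly_approx => h _; rewrite opprB addrC subrK invfM invrK.
by rewrite -mulrA divff // mulr1.
Qed.

(** The coefficient 2 makes the Laplacian negative: the first term contributes
    [-8] and the second one [+4]. *)
Definition barrier (lam w : C) : R := 2 * (1 - rnorm w ^+ 2) + rnorm (w - lam) ^+ 2.

Lemma mean_barrier N w (lam p : C) (s : R) : (1 < N)%N -> N.-primitive_root w ->
  \sum_(j < N) barrier lam (p + s%:C%C * w ^+ j) = N%:R * (barrier lam p - s ^+ 2).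
Proof.
move=> N1 wN; rewrite /barrier big_split /= -mulr_sumr sumrB.
rewrite (mean_sqr_dist p s N1 wN) sumr_const card_ord -[1 *+ N]mulr_natl.
under [X in _ + X]eq_bigr do rewrite addrAC.
by rewrite (mean_sqr_dist (p - lam) s N1 wN); ring.
Qed.

(** [|1/b|] is subharmonic and the barrier is superharmonic, so their
    comparison on the part of the disk within [d / 4] of [lam] follows from its
    boundary values. *)
Lemma inv_b_le_barrier lam w : rnorm lam = 1 -> rnorm (lam - zeta) <= d / 2 ->
  rnorm w < 1 -> rnorm (w - lam) <= d / 4 ->
  (rnorm (b w))^-1 - 1 <= 2 / (d / 4) ^+ 2 * barrier lam w.
Proof.
move=> lam1 lamz w1 wlam; have /andP[d0 d1] := d01.
have aux (t y : R) : 0 <= t -> t <= 1 -> 0 <= y -> y <= 1 ->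
  (t + y) ^+ 2 <= y ^+ 2 + 3 * t by nra.
have aux' (t y : R) : 0 <= t -> t <= 1 -> 0 <= y -> y <= t + 1 / 4 ->
  (t + y) ^+ 2 <= y ^+ 2 + 4 * t by nra.
set rho := d / 4; set K := 2 / rho ^+ 2.
have rho0 : 0 < rho by rewrite /rho; lra.
have K0 : 0 < K by rewrite divr_gt0 ?exprn_gt0.
pose L := [set v : C | rnorm v < 1 /\ rnorm (v - lam) <= rho].
pose m v := (rnorm (b v))^-1 - 1 - K * barrier lam v.
have Lz v : rnorm (v - lam) <= rho -> rnorm (v - zeta) < d.
  move=> vl; apply: le_lt_trans (rnorm_triangle _ lam _) _.
  by rewrite /rho in vl; lra.
have inv2 v : L v -> (rnorm (b v))^-1 <= 2.
  move=> [v1 /Lz vz]; have := b_half v1 vz => bv.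
  by rewrite -[2]invrK lef_pV2 ?posrE; lra.
have bar0 v : rnorm v < 1 -> 0 <= barrier lam v.
  move=> v1; have := rnorm_ge0 v; have := sqr_ge0 (rnorm (v - lam)).
  by rewrite /barrier; nra.
have mB v : L v -> m v <= 1.
  move=> Lv; have := inv2 _ Lv; case: Lv => /bar0 + _; rewrite /m.
  by move=> /(mulr_ge0 (ltW K0)); lra.
rewrite -subr_le0 -/(m w) leNgt; apply/negP => mw0.
have Lw : L w by [].
have [|||S [p [LS cl]]] := @sup_cluster_point _ L m 1.
- by exists w.
- by move=> v [/ltW].
- exact: mB.
have S0 : 0 < S by apply: lt_le_trans mw0 (LS _ Lw).
have p_lam : rnorm (p - lam) <= rho.
  apply/ler_addgt0Pr => e /cl[v [[_ vl] vp _]].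
  apply: le_trans (rnorm_triangle _ v _) _; rewrite rdistC; lra.
have p1 : rnorm p <= 1.
  apply/ler_addgt0Pr => e /cl[v [[v1 _] vp _]].
  by have := rnorm_ge_sub p v; rewrite rdistC; lra.
have [p1' | p1'] := eqVneq (rnorm p) 1.
  (* on the circle [|b|] tends to 1 and the barrier is nonnegative *)
  have e0 : 0 < Num.min (S / 4) (1 / 2) by rewrite lt_min !divr_gt0.
  have [eta [eta0 Heta]] := b_bdry p1' (Lz _ p_lam) e0.
  have [|v [[v1 vl] vp Sv]] := cl (Num.min eta (S / 4)).
    by rewrite lt_min eta0 divr_gt0.
  move: vp; rewrite le_min => /andP[vp _].
  have eS : Num.min eta (S / 4) <= S / 4 by rewrite ge_min lexx orbT.
  have := Heta v v1 vp; set e := Num.min (S / 4) (1 / 2) => bv.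
  have [e4 e2] : e <= S / 4 /\ e <= 1 / 2 by split; rewrite ge_min lexx ?orbT.
  have bv0 : 0 < rnorm (b v) by lra.
  have : (rnorm (b v))^-1 <= 1 + S / 2.
    rewrite -[leLHS]mul1r ler_pdivrMr //; nra.
  have := mulr_ge0 (ltW K0) (bar0 _ v1); rewrite /m in Sv; lra.
have {p1 p1'} p1 : rnorm p < 1 by rewrite lt_neqAle p1'.
(* inside, [p] is a maximum point of [m] *)
have m_cont (e : R) : 0 < e -> exists eta : R, 0 < eta /\
    forall v, rnorm (v - p) <= eta -> m v <= m p + e.
  move=> e0; have bp := b_half p1 (Lz _ p_lam).
  have e1 : 0 < Num.min (1 / 4) (e / 16) by rewrite lt_min !divr_gt0.
  have pr : rnorm p < (1 + rnorm p) / 2 by lra.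
  have r1 : (1 + rnorm p) / 2 < 1 by lra.
  have [eta [eta0 Heta]] := poly_approx_continuous pr (b_approx r1) e1.
  exists (Num.min eta (Num.min 1 (e / (20 * K)))); split.
    by rewrite !lt_min eta0 ltr01 divr_gt0 // mulr_gt0.
  move=> v; rewrite !le_min => /and3P[/Heta le1 v1 vK].
  have {}vK : 10 * (K * rnorm (v - p)) <= e / 2.
    move: vK; rewrite ler_pdivlMr; last by rewrite pmulr_rgt0.
    by move: (rnorm (v - p)) => x; clearbody K; rewrite (_ : x * (20 * K) = 20 * (K * x)); [lra|ring].
  move: le1; rewrite le_min => /andP[le4 le16].
  have le_b : (rnorm (b v))^-1 <= (rnorm (b p))^-1 + e / 2.
    have := rnorm_ge_sub (b p) (b v); rewrite rdistC => le_bv.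
    have bv : 1 / 4 <= rnorm (b v) by lra.
    have bv0 : 0 < rnorm (b v) by lra.
    have bp0 : 0 < rnorm (b p) by lra.
    rewrite -lerBlDl -(ler_pM2r (mulr_gt0 bv0 bp0)).
    have -> : ((rnorm (b v))^-1 - (rnorm (b p))^-1) * (rnorm (b v) * rnorm (b p)) =
        rnorm (b p) - rnorm (b v) by field; rewrite !gt_eqF.
    apply: le_trans le_bv (le_trans le16 _).
    have le8 : 1 / 8 <= rnorm (b v) * rnorm (b p).
      by move: (rnorm (b v)) (rnorm (b p)) bv bp => x y; nra.
    by nra.
  have le_bar : barrier lam p - barrier lam v <= 10 * rnorm (v - p).
    have t0 := rnorm_ge0 (v - p).
    have leV : rnorm v ^+ 2 <= rnorm p ^+ 2 + 3 * rnorm (v - p).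
      apply: (@le_trans _ _ ((rnorm (v - p) + rnorm p) ^+ 2)).
        rewrite ler_sqr ?nnegrE ?addr_ge0 ?rnorm_ge0 //.
        by have := rnorm_triangle v p 0; rewrite !subr0.
      by apply: aux; rewrite ?rnorm_ge0 // ltW.
    have leX : rnorm (p - lam) ^+ 2 <= rnorm (v - lam) ^+ 2 + 4 * rnorm (v - p).
      have rho1 : rho <= 1 / 4 by rewrite /rho; lra.
      apply: (@le_trans _ _ ((rnorm (v - p) + rnorm (v - lam)) ^+ 2)).
        rewrite ler_sqr ?nnegrE ?addr_ge0 ?rnorm_ge0 //.
        by have := rnorm_triangle p v lam; rewrite (rdistC p v).
      apply: aux'; rewrite ?rnorm_ge0 //.
      by have := rnorm_triangle v p lam; lra.
    by rewrite /barrier; lra.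
  have := ler_wpM2l (ltW K0) le_bar; rewrite mulrBr mulrCA => le_K.
  rewrite /m; lra.
have Smp : S <= m p.
  apply/ler_addgt0Pr => e e0; have e2 : 0 < e / 2 by lra.
  have [eta [eta0 Heta]] := m_cont _ e2.
  have [|v [_ vp Sv]] := cl (Num.min eta (e / 2)); first by rewrite lt_min eta0.
  move: vp Sv; rewrite le_min => /andP[/Heta vp _].
  have : Num.min eta (e / 2) <= e / 2 by rewrite ge_min lexx orbT.
  lra.
have p_lam_lt : rnorm (p - lam) < rho.
  rewrite lt_neqAle p_lam andbT; apply/eqP => E.
  have : 2 <= K * barrier lam p.
    rewrite /barrier E mulrDr divfK ?gt_eqF ?exprn_gt0 // lerDr.
    by rewrite mulr_ge0 ?(ltW K0) //; have := rnorm_ge0 p; nra.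
  have /inv2 : L p by []. 
  by rewrite /m in Smp; lra.
have [s1 [s10 Hs1]] := inv_b_approx p1 (Lz _ p_lam).
pose s := Num.min s1 (Num.min (1 - rnorm p) (rho - rnorm (p - lam)) / 2).
have s0 : 0 < s by rewrite lt_min s10 divr_gt0 // lt_min !subr_gt0 p1.
have [ss1 sp sl] : [/\ s <= s1, s < 1 - rnorm p & s <= rho - rnorm (p - lam)].
  rewrite /s; set x := 1 - rnorm p; set y := rho - _.
  have [x0 y0] : 0 < x /\ 0 < y by rewrite !subr_gt0.
  have [mx my] : Num.min x y <= x /\ Num.min x y <= y by split; rewrite ge_min lexx ?orbT.
  have : Num.min s1 (Num.min x y / 2) <= Num.min x y / 2 by rewrite ge_min lexx orbT.
  by split; [rewrite ge_min lexx|lra|lra].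
have circle v : rnorm v = s -> L (p + v).
  move=> vs; split; first by apply: le_lt_trans (rnormD _ _) _; rewrite vs; lra.
  by rewrite addrAC; apply: le_trans (rnormD _ _) _; rewrite vs; lra.
have e0 : 0 < K * s ^+ 2 / 2 by rewrite pmulr_lgt0 // pmulr_rgt0 // exprn_gt0.
have [N0 HN] := submean (ltW s0) (Hs1 _ ss1) e0.
pose N := maxn N0 2.
have N1 : (1 < N)%N by rewrite leq_maxr.
have [om omN] := prim_root_exists R[i] (ltnW N1).
have := HN _ _ (leq_maxl _ _) omN; rewrite addr0 rnormV => le1.
have le2 : \sum_(j < N) m (p + s%:C%C * om ^+ j) <= N%:R * S.
  rewrite mulr_natl -[in leRHS](card_ord N) -sumr_const; apply: ler_sum => j _.
  apply: LS; apply: circle.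
  by rewrite rnormM rnorm_real (rnorm_root_exp omN) mulr1 gtr0_norm.
rewrite /m 2!sumrB -mulr_sumr (mean_barrier _ _ _ N1 omN) sumr_const card_ord in le2.
rewrite -[1 *+ N]mulr_natl mulr1 in le2.
rewrite (eq_bigr _ (fun j _ => rnormV _)) in le1.
set M := \sum_(_ < _) _ in le1 le2.
have Ngt0 : 0 < N%:R :> R by rewrite ltr0n ltnW.
have : N%:R * (K * s ^+ 2 / 2) <= 0.
  have := ler_wpM2l (ltW Ngt0) Smp; rewrite /m; nra.
by apply/negP; rewrite -ltNge mulr_gt0.
Qed.

(** At the radial projection [lam] of [z] on the circle, the barrier at [z] is
    comparable with [1 - |z|]. *)
Lemma one_sub_sqr_b_le (zeta1 : rnorm zeta = 1) : exists K : R, 0 < K /\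
  forall z, rnorm z < 1 -> rnorm (z - zeta) < d / 4 ->
    1 - rnorm (b z) ^+ 2 <= K * (1 - rnorm z ^+ 2).
Proof.
have /andP[d0 d1] := d01.
set K := 2 / (d / 4) ^+ 2.
have K0 : 0 < K by rewrite divr_gt0 ?exprn_gt0 //; lra.
exists (6 * K); split=> [|z z1 zz]; first by rewrite pmulr_rgt0.
have le1 : 1 - rnorm z <= rnorm (z - zeta).
  by have := rnorm_ge_sub zeta z; rewrite rdistC zeta1.
set r := rnorm z in z1 le1 *.
have r0 : 0 < r by lra.
pose lam := r^-1%:C%C * z.
have zE : z = r%:C%C * lam.
  by rewrite /lam mulrA -RcM divff ?gt_eqF // mul1r.
have lam1 : rnorm lam = 1.
  by rewrite rnormM rnorm_real gtr0_norm ?invr_gt0 // mulVf // gt_eqF.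
have zlam : rnorm (z - lam) = 1 - r.
  rewrite zE -[X in _ - X]mul1r -mulrBl rnormM lam1 mulr1 -[1]/((1 : R)%:C%C) -RcB.
  by rewrite rnorm_real distrC gtr0_norm // subr_gt0.
have lamz : rnorm (lam - zeta) <= d / 2.
  have := rnorm_triangle lam z zeta; rewrite (rdistC lam z) zlam.
  by move: zz le1; lra.
have zlam' : rnorm (z - lam) <= d / 4 by rewrite zlam; lra.
have := inv_b_le_barrier lam1 lamz z1 zlam'; rewrite -/K /barrier zlam -/r.
have bz : 1 / 2 <= rnorm (b z) by apply: b_half => //; lra.
set x := rnorm (b z) in bz * => le2.
have x0 : 0 < x by lra.
have le3 : 1 - x ^+ 2 <= 2 * (x^-1 - 1).
  rewrite -subr_ge0 -(pmulr_lge0 _ x0).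
  have -> : (2 * (x^-1 - 1) - (1 - x ^+ 2)) * x = (1 - x) ^+ 2 * (2 + x).
    by field; rewrite gt_eqF.
  by rewrite mulr_ge0 ?sqr_ge0 // addr_ge0 // ltW.
have : 2 * (1 - r ^+ 2) + (1 - r) ^+ 2 <= 3 * (1 - r ^+ 2) by nra.
move=> /(ler_wpM2l (ltW K0)); lra.
Qed.

End Barrier.

(** * Herglotz representations without mass near zeta *)

Section Herglotz.
Variable R : realType.
Local Notation C := R[i].
Implicit Types (F G : C -> C) (z w om : C).

Lemma poly_approx_conj F (r : R) : poly_approx F r -> poly_approx (fun u => (F u^*)^*) r.
Proof.
move=> FP e /FP[p Hp]; exists (map_poly Num.conj p) => z zr.
rewrite -[in p' in _.[p']](conjCK z) horner_map -rmorphB rnorm_conj; apply: Hp.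
by rewrite rnorm_conj.
Qed.

(** The mean of [f] is within [e] of [L], written without division. *)
Definition mean_near N (f : 'I_N -> C) (L : C) (e : R) :=
  rnorm (\sum_j f j - N%:R * L) <= N%:R * e.

Lemma rnorm_nat n : rnorm (n%:R : C) = n%:R.
Proof. by rewrite -Rc_nat rnorm_real ger0_norm. Qed.

Lemma mean_nearD N (f g : 'I_N -> C) L M e e' : mean_near f L e -> mean_near g M e' ->
  mean_near (fun j => f j + g j) (L + M) (e + e').
Proof.
rewrite /mean_near => le1 le2; rewrite big_split /= mulrDr opprD addrACA mulrDr.
by apply: le_trans (rnormD _ _) (lerD le1 le2).
Qed.

Lemma mean_nearZ N (f : 'I_N -> C) c L e : mean_near f L e ->
  mean_near (fun j => c * f j) (c * L) (rnorm c * e).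
Proof.
rewrite /mean_near => le1; rewrite -mulr_sumr mulrCA -mulrBr rnormM mulrCA.
by rewrite ler_wpM2l ?rnorm_ge0.
Qed.

Lemma mean_near_perturb N (f g : 'I_N -> C) L M e e' e'' :
  mean_near f L e -> (forall j, rnorm (g j - f j) <= e') -> rnorm (M - L) <= e'' ->
  mean_near g M (e + e' + e'').
Proof.
rewrite /mean_near => le1 le2 le3.
have -> : \sum_j g j - N%:R * M =
    (\sum_j f j - N%:R * L) + \sum_j (g j - f j) - N%:R * (M - L).
  by rewrite sumrB; ring.
rewrite [leRHS]mulrDr [X in _ <= X + _]mulrDr.
apply: le_trans (rnormB _ _) _; apply: lerD; last first.
  by rewrite rnormM rnorm_nat ler_wpM2l.
apply: le_trans (rnormD _ _) _; apply: lerD => //.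
apply: le_trans (rnorm_sum _ _ _) _.
rewrite mulr_natl -[N in leRHS]card_ord -sumr_const.
by apply: ler_sum => j _; exact: le2.
Qed.

Lemma mean_near_center F : poly_approx F 1 -> forall e : R, 0 < e ->
  exists N0, forall N om, (N0 <= N)%N -> N.-primitive_root om ->
    mean_near (fun j : 'I_N => F (om ^+ j)) (F 0) e.
Proof.
move=> FP e e0; have e2 : 0 < e / 2 by rewrite divr_gt0.
have [p Hp] := FP _ e2; exists (size p) => N om pN omN.
have E : mean_near (fun j : 'I_N => p.[om ^+ j]) p.[0] 0.
  have := mean_horner omN 1 pN; under eq_bigr do rewrite mul1r.
  by rewrite /mean_near => ->; rewrite subrr rnorm0 mulr0.
rewrite (_ : e = 0 + e / 2 + e / 2); last by lra.
apply: mean_near_perturb E _ _ => [j|]; apply: Hp.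
  by rewrite (rnorm_root_exp omN).
by rewrite rnorm0.
Qed.

(** Its real part is the Poisson kernel. *)
Definition schwarz_kernel om z := (om + z) / (om - z).

Lemma circle_sub_ge om z : rnorm om = 1 -> 1 - rnorm z <= rnorm (om - z).
Proof. by move=> om1; have := rnorm_ge_sub om z; rewrite om1. Qed.

Lemma circle_sub_neq0 om z : rnorm om = 1 -> rnorm z < 1 -> om - z != 0.
Proof.
move=> om1 z1; have := circle_sub_ge z om1 => le1.
by apply/eqP => E; move: le1; rewrite E rnorm0; lra.
Qed.

Lemma circle_conj_mul om : rnorm om = 1 -> om^* * om = 1.
Proof. by move=> om1; rewrite mulrC mulC_conj om1 expr1n. Qed.

Lemma schwarz_kernel_le om z : rnorm om = 1 -> rnorm z < 1 ->
  rnorm (schwarz_kernel om z) <= 2 / (1 - rnorm z).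
Proof.
move=> om1 z1; have z0 : 0 < 1 - rnorm z by rewrite subr_gt0.
rewrite /schwarz_kernel rnormM rnormV ler_pM ?rnorm_ge0 ?invr_ge0 ?rnorm_ge0 //.
  by apply: le_trans (rnormD _ _) _; rewrite om1; lra.
rewrite lef_pV2 ?posrE ?circle_sub_ge //.
by apply: lt_le_trans z0 _; exact: circle_sub_ge.
Qed.

Lemma schwarz_kernelE om z : rnorm om = 1 ->
  schwarz_kernel om z = (1 + om^* * z) * (1 - om^* * z)^-1.
Proof.
move=> om1; have E := circle_conj_mul om1.
have c0 : om^* != 0 by apply/eqP => c0; move: E; rewrite c0 mul0r => /eqP; rewrite eq_sym oner_eq0.
rewrite /schwarz_kernel -{1}E -[X in (X - _ * z)^-1]E -mulrDr -mulrBr invfM.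
by rewrite mulrACA divff // mul1r.
Qed.

(** The Schwarz integral formula, with the circle replaced by roots of unity.
    The kernel is a holomorphic function of the conjugate of the point of the
    circle, hence so is its product with [F^*], whose mean is its value at 0;
    for [F] itself, dividing [F - F z] by [om - z] leaves a holomorphic
    function of [om].  The subtracted constant is [i Im (F 0)]. *)
Lemma schwarz_formula F z : poly_approx F 1 -> rnorm z < 1 -> forall e : R, 0 < e ->
  exists N0, forall N om, (N0 <= N)%N -> N.-primitive_root om ->
    mean_near (fun j : 'I_N => (complex.Re (F (om ^+ j)))%:C%C * schwarz_kernel (om ^+ j) z)
      (F z - (F 0 - (F 0)^*) / 2) e.
Proof.
move=> FP z1 e e0; have z0 : 0 < 1 - rnorm z by rewrite subr_gt0.
pose A := 2 / (1 - rnorm z).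
have A0 : 0 < A by rewrite divr_gt0.
pose e1 := e / (16 * (A + 1)).
have e10 : 0 < e1 by rewrite divr_gt0 // mulr_gt0 // addr_gt0.
have [p Hp] := FP _ e10.
have [q Eq] : exists q, p = q * ('X - z%:P) + (p.[z])%:P.
  have /factor_theorem[q E] : root (p - p.[z]%:P) z by rewrite /root !hornerE subrr.
  by exists q; rewrite -E subrK.
(* the kernel as a function of the conjugate of the point of the circle *)
have SP : poly_approx (fun u => (1 + u * z) * (1 - u * z)^-1) 1.
  have uzP : poly_approx (fun u => u * z) 1.
    apply: poly_approxM (poly_approx_cst _ _).
    by apply: eq_poly_approx (poly_approx_horner 'X 1) => u _; rewrite hornerX.
  apply: poly_approxM; first by apply: poly_approxD => //; exact: poly_approx_cst.
  apply: (@poly_approx_inv _ _ _ (rnorm z)) => //.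
    by rewrite rnorm_ge0.
  by move=> u u1; rewrite rnormM ler_piMl ?rnorm_ge0.
have qP : poly_approx (fun om => (om + z) * q.[om]) 1.
  apply: poly_approxM (poly_approx_horner _ _).
  apply: poly_approxD (poly_approx_cst _ _).
  by apply: eq_poly_approx (poly_approx_horner 'X 1) => u _; rewrite hornerX.
have e40 : 0 < e / 16 by rewrite divr_gt0.
have pz0 : 0 < e / 16 / (rnorm p.[z] + 1) by rewrite divr_gt0 // ltr_wpDl ?rnorm_ge0.
have [N1 H1] := mean_near_center (poly_approxM (poly_approx_conj FP) SP) e40.
have [N2 H2] := mean_near_center qP e40.
have [N3 H3] := mean_near_center SP pz0.
exists (maxn N1 (maxn N2 N3)) => N om; rewrite !geq_max => /and3P[N1N N2N N3N] omN.
have omcN : N.-primitive_root om^* by rewrite fmorph_primitive_root.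
have om1 j : rnorm (om ^+ j) = 1 := rnorm_root_exp omN j.
have SE j : (1 + om^* ^+ j * z) * (1 - om^* ^+ j * z)^-1 = schwarz_kernel (om ^+ j) z.
  by rewrite schwarz_kernelE // rmorphXn.
have M1 : mean_near (fun j : 'I_N => (F (om ^+ j))^* * schwarz_kernel (om ^+ j) z) (F 0)^* (e / 16).
  have := H1 _ _ N1N omcN; rewrite mul0r addr0 subr0 invr1 !mulr1 rmorph0.
  rewrite /mean_near; under eq_bigr do rewrite SE rmorphXn /= conjCK.
  by [].
have M2 : mean_near (fun j : 'I_N => (om ^+ j + z) * q.[om ^+ j]) (z * q.[0]) (e / 16).
  by have := H2 _ _ N2N omN; rewrite add0r.
have M3 : mean_near (fun j : 'I_N => schwarz_kernel (om ^+ j) z) 1 (e / 16 / (rnorm p.[z] + 1)).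
  have := H3 _ _ N3N omcN; rewrite mul0r addr0 subr0 invr1 !mulr1.
  by rewrite /mean_near; under eq_bigr do rewrite SE.
have M4 : mean_near (fun j : 'I_N => p.[om ^+ j] * schwarz_kernel (om ^+ j) z)
    (p.[z] + z * q.[0]) (e / 16 + e / 16).
  have le1 : rnorm p.[z] * (e / 16 / (rnorm p.[z] + 1)) <= e / 16.
    rewrite mulrCA ler_piMr ?(ltW e40) // ler_pdivrMr ?ltr_wpDl ?rnorm_ge0 //.
    by rewrite mul1r lerDl.
  have := mean_nearD (mean_nearZ p.[z] M3) M2; rewrite mulr1 /mean_near.
  rewrite (eq_bigr (fun j : 'I_N => p.[om ^+ j] * schwarz_kernel (om ^+ j) z)).
    by move=> /le_trans; apply; rewrite ler_wpM2l // lerD2r.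
  move=> j _; have -> : p.[om ^+ j] = q.[om ^+ j] * (om ^+ j - z) + p.[z].
    by rewrite {1}Eq !hornerE.
  by rewrite /schwarz_kernel /=; field; exact: circle_sub_neq0.
have q0E : p.[0] = p.[z] - z * q.[0] by rewrite {1}Eq !hornerE; ring.
have F0 := Hp 0; have Fz := Hp z; rewrite rnorm0 ler01 in F0.
have {}F0 := F0 isT; have {}Fz := Fz (ltW z1).
have M5 : mean_near (fun j : 'I_N => F (om ^+ j) * schwarz_kernel (om ^+ j) z)
    (2 * F z - F 0) (e / 16 + e / 16 + e1 * A + 3 * e1).
  apply: mean_near_perturb M4 _ _ => [j|].
    rewrite -mulrBl rnormM ler_pM ?rnorm_ge0 ?schwarz_kernel_le //.
    by apply: Hp; rewrite om1.
  have -> : 2 * F z - F 0 - (p.[z] + z * q.[0]) =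
      (2 : C) * (F z - p.[z]) - (F 0 - p.[0]) by rewrite q0E; ring.
  apply: le_trans (rnormB _ _) _; rewrite rnormM rnorm_nat; lra.
have := mean_nearZ (2^-1) (mean_nearD M5 M1); rewrite rnormV rnorm_nat /mean_near.
rewrite (eq_bigr (fun j : 'I_N =>
  (complex.Re (F (om ^+ j)))%:C%C * schwarz_kernel (om ^+ j) z)); last first.
  by move=> j _; rewrite ReJ_add -conjCE /=; field.
rewrite (_ : 2^-1 * (2 * F z - F 0 + (F 0)^*) = F z - (F 0 - (F 0)^*) / 2); last by field.
move=> /le_trans; apply; rewrite ler_wpM2l //.
have : e1 * A + e1 <= e / 16.
  by rewrite -[X in _ + X]mulr1 -mulrDr /e1 invfM mulrA divfK // gt_eqF // addr_gt0.
have : 0 < e1 * A by rewrite mulr_gt0.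
lra.
Qed.

(** The Herglotz integral of the measure with masses [m j] at the points
    [om j]. *)
Definition herglotz_sum N (m : 'I_N -> R) (om : 'I_N -> C) z :=
  \sum_j (m j)%:C%C * schwarz_kernel (om j) z.

Section FarMeasure.
Variables (G : C -> C) (zeta : C) (d K : R).
Hypothesis zeta1 : rnorm zeta = 1.
Hypothesis d0 : 0 < d.
Hypothesis K0 : 0 < K.
Hypothesis G_approx : forall r : R, r < 1 -> poly_approx G r.
Hypothesis ReG_ge0 : forall z, rnorm z < 1 -> 0 <= complex.Re (G z).
Hypothesis ReG_le : forall z, rnorm z < 1 -> rnorm (z - zeta) < d ->
  complex.Re (G z) <= K * (1 - rnorm z ^+ 2).

(** The boundary values of [Re G] on the circle of radius [r], minus those
    near [zeta]. *)
Definition far_mass (r : R) N om (j : 'I_N) : R :=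
  if rnorm (r%:C%C * om ^+ j - zeta) < d then 0
  else N%:R^-1 * complex.Re (G (r%:C%C * om ^+ j)).

Lemma rnorm_dilate (r : R) z : 0 <= r -> rnorm (r%:C%C * z) = r * rnorm z.
Proof. by move=> r0; rewrite rnormM rnorm_real ger0_norm. Qed.

(** As [r] tends to 1 the masses discarded near [zeta] tend to 0, being at
    most [K * (1 - r ^ 2)] in total. *)
Lemma far_mass_approx z (e : R) : rnorm z < 1 -> 0 < e -> exists r0 : R, 0 <= r0 < 1 /\
  forall r, r0 <= r -> r < 1 -> exists N0, forall N om, (N0 <= N)%N ->
    N.-primitive_root om ->
    rnorm (G z - (G 0 - (G 0)^*) / 2 -
      herglotz_sum (far_mass r om) (fun j : 'I_N => om ^+ j) z) <= e.
Proof.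
move=> z1 e0; have z0 : 0 < 1 - rnorm z by rewrite subr_gt0.
pose A := 2 / (1 - rnorm z).
have A0 : 0 < A by rewrite divr_gt0.
have e3 : 0 < e / 3 by rewrite divr_gt0.
have zr : rnorm z < (1 + rnorm z) / 2 by lra.
have r1 : (1 + rnorm z) / 2 < 1 by lra.
have [eta [eta0 Heta]] := poly_approx_continuous zr (G_approx r1) e3.
have KA0 : 0 < 2 * K * A by apply: mulr_gt0 => //; exact: mulr_gt0.
pose t := Num.min 1 (Num.min eta (e / 3 / (2 * K * A))).
have t0 : 0 < t by rewrite !lt_min ltr01 eta0 /=; exact: divr_gt0.
have [t1 te tK] : [/\ t <= 1, t <= eta & t <= e / 3 / (2 * K * A)].
  by rewrite /t !ge_min !lexx !orbT.
exists (1 - t); split; first by apply/andP; split; lra.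
move=> r tr rlt1; have r_ge0 : 0 <= r by lra.
have FP : poly_approx (fun w => G (r%:C%C * w)) 1.
  have le1 : rnorm (0 : C) + rnorm (r%:C%C : C) * 1 <= r.
    by rewrite rnorm0 rnorm_real ger0_norm // add0r mulr1.
  apply: eq_poly_approx (poly_approx_affine le1 (G_approx rlt1)) => w _.
  by rewrite add0r.
have [N0 HN] := schwarz_formula FP z1 e3.
exists (maxn N0 1) => N om; rewrite geq_max => /andP[N0N N_gt0] omN.
have om1 (j : 'I_N) : rnorm (om ^+ j) = 1 := rnorm_root_exp omN j.
pose ReG j := complex.Re (G (r%:C%C * om ^+ j)).
have rom (j : 'I_N) : rnorm (r%:C%C * om ^+ j) = r by rewrite rnorm_dilate // om1 mulr1.
have mean : mean_near (fun j : 'I_N =>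
    (if rnorm (r%:C%C * om ^+ j - zeta) < d then 0 else ReG j)%:C%C *
      schwarz_kernel (om ^+ j) z) (G z - (G 0 - (G 0)^*) / 2) (e / 3 + e / 3 + e / 3).
  have := HN _ _ N0N omN; rewrite mulr0 => /mean_near_perturb; apply => [j|].
    rewrite -mulrBl -RcB rnormM rnorm_real -/(ReG j).
    case: ifP => [near|_]; last by rewrite subrr normr0 mul0r ltW.
    have ReG0 : 0 <= ReG j by apply: ReG_ge0; rewrite rom.
    rewrite sub0r normrN ger0_norm //.
    apply: (@le_trans _ _ (K * (1 - r ^+ 2) * A)).
      rewrite ler_pM ?rnorm_ge0 ?schwarz_kernel_le //.
      by rewrite -(rom j); apply: ReG_le; rewrite ?rom.
    have : (1 - r) * (2 * K * A) <= e / 3.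
      by rewrite -ler_pdivlMr //; apply: le_trans tK; rewrite lerBlDl -lerBlDr.
    apply: le_trans; have -> : K * (1 - r ^+ 2) * A = (1 - r ^+ 2) * (K * A) by ring.
    have -> : (1 - r) * (2 * K * A) = 2 * (1 - r) * (K * A) by ring.
    rewrite ler_pM2r; last exact: mulr_gt0.
    by have := sqr_ge0 (1 - r); lra.
  rewrite opprD addrACA opprK [- _ + _]addrC subrr addr0 rdistC.
  apply: Heta; rewrite -[X in _ - X]mul1r -mulrBl -[1]/((1 : R)%:C%C) -RcB.
  rewrite rnormM rnorm_real distrC ger0_norm ?subr_ge0 ?(ltW rlt1) //.
  by apply: (@le_trans _ _ (1 - r)); [rewrite ler_piMr ?subr_ge0 ?ltW|lra].
have NC : N%:R != 0 :> C by rewrite pnatr_eq0 -lt0n.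
have NR : 0 < N%:R :> R by rewrite ltr0n.
have sumE : herglotz_sum (far_mass r om) (fun j : 'I_N => om ^+ j) z =
    N%:R^-1 * \sum_(j < N) (if rnorm (r%:C%C * om ^+ j - zeta) < d then 0 else ReG j)%:C%C *
      schwarz_kernel (om ^+ j) z.
  rewrite mulr_sumr; apply: eq_bigr => j _; rewrite [RHS]mulrA; congr (_ * _).
  rewrite -Rc_nat -RcV -RcM /far_mass; congr (_%:C%C).
  by case: ifP => _; rewrite ?mulr0.
rewrite rdistC sumE -[X in _ - X](mulKf NC) -mulrBr rnormM rnormV rnorm_nat.
rewrite mulrC ler_pdivrMr //; apply: le_trans mean _.
by rewrite mulrC; lra.
Qed.

Lemma far_mass_ge0 (r : R) N om (j : 'I_N) : 0 <= r < 1 -> N.-primitive_root om ->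
  0 <= far_mass r om j.
Proof.
move=> /andP[r0 r1] omN; rewrite /far_mass; case: ifP => // _.
rewrite mulr_ge0 ?invr_ge0 //; apply: ReG_ge0.
by rewrite rnorm_dilate // (rnorm_root_exp omN) mulr1.
Qed.

Lemma sum_far_mass (r : R) N om (e : R) :
  rnorm (G 0 - (G 0 - (G 0)^*) / 2 -
      herglotz_sum (far_mass r om) (fun j : 'I_N => om ^+ j) 0) <= e ->
  N.-primitive_root om ->
  \sum_(j < N) far_mass r om j <= complex.Re (G 0) + e.
Proof.
move=> le_e omN; rewrite -lerBlDl; apply: le_trans le_e; rewrite rdistC.
apply: le_trans (Re_le_rnorm _); rewrite ReB lerB //.
  rewrite /herglotz_sum Re_sum ler_sum // => j _.
  rewrite /schwarz_kernel addr0 subr0 divff ?mulr1 //.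
  have := rnorm_root_exp omN j; apply: contra_eq_neq => ->.
  by rewrite rnorm0 eq_sym oner_neq0.
have -> : G 0 - (G 0 - (G 0)^*) / 2 = (G 0 + (G 0)^*) / 2 by field.
by rewrite conjCE -ReJ_add.
Qed.

(** The estimates below compare [G] at two points, so they follow from finite
    measures that represent [G] approximately at these points. *)
Lemma far_measure_approx z w (e : R) : rnorm z < 1 -> rnorm w < 1 -> 0 < e ->
  exists N (m : 'I_N -> R) (om : 'I_N -> C),
  [/\ forall j, 0 <= m j, forall j, rnorm (om j) = 1,
    forall j, m j = 0 \/ 3 * d / 4 <= rnorm (om j - zeta),
    \sum_j m j <= complex.Re (G 0) + 1 &
    rnorm (G z - (G 0 - (G 0)^*) / 2 - herglotz_sum m om z) <= e /\
    rnorm (G w - (G 0 - (G 0)^*) / 2 - herglotz_sum m om w) <= e].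
Proof.
move=> z1 w1 e0.
have [rz [/andP[rz0 rz1] Hz]] := far_mass_approx z1 e0.
have [rw [/andP[rw0 rw1] Hw]] := far_mass_approx w1 e0.
have [|r0 [/andP[r00 r01] H0]] := @far_mass_approx 0 1 _ ltr01; first by rewrite rnorm0.
pose r : R := Num.max (1 - d / 4) (Num.max rz (Num.max rw r0)).
have r1 : r < 1.
  by rewrite !gt_max rz1 rw1 r01 /= andbT ltrBlDr ltrDl divr_gt0.
have [dr rzr rwr r0r] : [/\ 1 - d / 4 <= r, rz <= r, rw <= r & r0 <= r].
  by rewrite /r !le_max !lexx !orbT.
have r_ge0 : 0 <= r by apply: le_trans rz0 rzr.
have [[Nz {}Hz] [Nw {}Hw] [N0 {}H0]] := And3 (Hz _ rzr r1) (Hw _ rwr r1) (H0 _ r0r r1).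
pose N := maxn 1 (maxn Nz (maxn Nw N0)).
have [Ngt0 NzN NwN N0N] : [/\ 0 < N, Nz <= N, Nw <= N & N0 <= N]%N.
  by rewrite /N !leq_max !leqnn !orbT.
have [om omN] := prim_root_exists R[i] Ngt0.
exists N, (far_mass r om), (fun j => om ^+ j); split.
- by move=> j; apply: far_mass_ge0; rewrite ?r_ge0.
- by move=> j; exact: (rnorm_root_exp omN).
- move=> j; rewrite /far_mass; case: ltP => [_|far]; [by left|right].
  have := rnorm_triangle (r%:C%C * om ^+ j) (om ^+ j) zeta.
  have -> : r%:C%C * om ^+ j - om ^+ j = (r - 1)%:C%C * om ^+ j by rewrite RcB; ring.
  rewrite rnormM (rnorm_root_exp omN) mulr1.
  by rewrite rnorm_real distrC ger0_norm ?subr_ge0 ?(ltW r1) //; lra.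
- by apply: sum_far_mass => //; exact: H0.
- by split; [exact: Hz|exact: Hw].
Qed.

Lemma far_circle_dist om z : 3 * d / 4 <= rnorm (om - zeta) ->
  rnorm (z - zeta) < d / 2 -> d / 4 <= rnorm (om - z).
Proof. by move=> far zz; have := rnorm_triangle om z zeta; lra. Qed.

Lemma sum_far_le N (m : 'I_N -> R) (B : R) (f : 'I_N -> R) : 0 <= B ->
  (forall j, 0 <= m j) -> (forall j, m j = 0 \/ f j <= B) ->
  \sum_j m j <= complex.Re (G 0) + 1 ->
  \sum_j m j * f j <= (complex.Re (G 0) + 1) * B.
Proof.
move=> B0 m0 mf mM; apply: (@le_trans _ _ (\sum_j m j * B)).
  apply: ler_sum => j _; have [->|fB] := mf j; first by rewrite !mul0r.
  by rewrite ler_wpM2l.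
by rewrite -mulr_suml ler_wpM2r.
Qed.

Lemma inv_circle_dist_le om z : d / 4 <= rnorm (om - z) -> (rnorm (om - z))^-1 <= 4 / d.
Proof.
move=> far; rewrite -[4 / d]invrK invfM invrK mulrC lef_pV2 ?posrE ?divr_gt0 //.
by apply: lt_le_trans far; rewrite divr_gt0.
Qed.

(** The Schwarz kernel is Lipschitz in [z] away from its pole, uniformly over
    the points that carry mass. *)
Lemma herglotz_lipschitz z w : rnorm z < 1 -> rnorm w < 1 ->
  rnorm (z - zeta) < d / 2 -> rnorm (w - zeta) < d / 2 ->
  rnorm (G z - G w) <= (complex.Re (G 0) + 1) * (2 * rnorm (z - w) * (4 / d) ^+ 2).
Proof.
move=> z1 w1 zz wz; apply/ler_addgt0Pr => e e0.
have e2 : 0 < e / 2 by rewrite divr_gt0.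
have [N [m [om [m0 om1 far mM [le1 le2]]]]] := far_measure_approx z1 w1 e2.
set c := _ / 2 in le1 le2.
have le3 : rnorm (herglotz_sum m om z - herglotz_sum m om w) <=
    (complex.Re (G 0) + 1) * (2 * rnorm (z - w) * (4 / d) ^+ 2).
  rewrite /herglotz_sum -sumrB; apply: le_trans (rnorm_sum _ _ _) _.
  have B0 : 0 <= 2 * rnorm (z - w) * (4 / d) ^+ 2.
    by rewrite mulr_ge0 ?sqr_ge0 // mulr_ge0 ?rnorm_ge0.
  pose f j := rnorm (schwarz_kernel (om j) z - schwarz_kernel (om j) w).
  apply: (@le_trans _ _ (\sum_j m j * f j)).
    by apply: ler_sum => j _; rewrite -mulrBr rnormM rnorm_real ger0_norm.
  apply: sum_far_le => // j; rewrite /f.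
    have [->|farj] := far j; [by left|right].
    have -> : schwarz_kernel (om j) z - schwarz_kernel (om j) w =
        2 * om j * (z - w) * (om j - z)^-1 * (om j - w)^-1.
      rewrite /schwarz_kernel; field.
      by rewrite !circle_sub_neq0.
    rewrite !rnormM rnorm_nat om1 mulr1 !rnormV -mulrA.
    rewrite ler_wpM2l ?mulr_ge0 ?rnorm_ge0 // expr2.
    by rewrite ler_pM ?invr_ge0 ?rnorm_ge0 // inv_circle_dist_le // far_circle_dist.
have -> : G z - G w = (G z - c - herglotz_sum m om z) +
    (herglotz_sum m om z - herglotz_sum m om w) - (G w - c - herglotz_sum m om w) by ring.
apply: le_trans (rnormB _ _) _; have := rnormD (G z - c - herglotz_sum m om z)
  (herglotz_sum m om z - herglotz_sum m om w).
lra.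
Qed.

Definition herglotz_kernel z w := (G z + (G w)^*) / (2 * (1 - w^* * z)).

Lemma kernel_denom_ge z w : rnorm z < 1 -> rnorm w < 1 ->
  Num.min (1 - rnorm z) (1 - rnorm w) <= rnorm (1 - w^* * z).
Proof.
move=> z1 w1; apply: (@le_trans _ _ (1 - rnorm z)); first by rewrite ge_min lexx.
have := rnorm_ge_sub (1 : C) (w^* * z); rewrite rnorm1 rnormM rnorm_conj.
by apply: le_trans; rewrite lerB // ler_piMl ?rnorm_ge0 // ltW.
Qed.

Lemma kernel_denom_neq0 z w : rnorm z < 1 -> rnorm w < 1 -> 1 - w^* * z != 0.
Proof.
move=> z1 w1; have := kernel_denom_ge z1 w1; apply: contraTneq => ->.
by rewrite rnorm0 -ltNge lt_min !subr_gt0 z1.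
Qed.

(** For a point mass the Herglotz kernel has rank one. *)
Lemma circle_kernelE om z w : rnorm om = 1 -> rnorm z < 1 -> rnorm w < 1 ->
  (schwarz_kernel om z + (schwarz_kernel om w)^*) / (2 * (1 - w^* * z)) =
  (1 - om^* * z)^-1 * ((1 - om^* * w)^-1)^*.
Proof.
move=> om1 z1 w1; have E := circle_conj_mul om1.
have om0 : om != 0 by apply: contra_eq_neq E => ->; rewrite mulr0 eq_sym oner_neq0.
have omE : om^* = om^-1 by apply: (mulIf om0); rewrite E mulVf.
rewrite /schwarz_kernel !(rmorphM, fmorphV, rmorphB, rmorphD, rmorph1) /= conjCK omE.
have nz := circle_sub_neq0 om1 z1.
have nw : 1 - om * w^* != 0.
  have := circle_sub_neq0 om1 w1; rewrite -conjC_eq0 rmorphB /= omE.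
  by apply: contra_neq => nw; rewrite -[om^-1]mulr1 -(mulKf om0 w^*) -mulrBr nw mulr0.
have nk := kernel_denom_neq0 z1 w1.
by field; rewrite om0 nz nw nk.
Qed.

(** By [circle_kernelE] the left-hand side is an integral of squared moduli of
    differences of the functions [(1 - om^* z)^-1], each Lipschitz near
    [zeta]; the square on the right is what makes the kernel vectors, rather
    than their squared norms, Lipschitz. *)
Lemma herglotz_kernel_lipschitz z w : rnorm z < 1 -> rnorm w < 1 ->
  rnorm (z - zeta) < d / 2 -> rnorm (w - zeta) < d / 2 ->
  rnorm (herglotz_kernel z z - herglotz_kernel z w - herglotz_kernel w z +
      herglotz_kernel w w) <=
    (complex.Re (G 0) + 1) * (rnorm (z - w) * (4 / d) ^+ 2) ^+ 2.
Proof.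
move=> z1 w1 zz wz; apply/ler_addgt0Pr => e e0.
set tau := Num.min (1 - rnorm z) (1 - rnorm w).
have tau0 : 0 < tau by rewrite lt_min !subr_gt0 z1.
have e2 : 0 < e * tau / 4 by rewrite divr_gt0 ?mulr_gt0.
have [N [m [om [m0 om1 far mM [le1 le2]]]]] := far_measure_approx z1 w1 e2.
set c := _ / 2 in le1 le2.
have c_imag : c + c^* = 0.
  by rewrite /c !(rmorphM, fmorphV, rmorphB, rmorph_nat) /= conjCK; field.
pose H x := herglotz_sum m om x.
pose L x y := (H x + (H y)^*) / (2 * (1 - y^* * x)).
have close x y : rnorm x < 1 -> rnorm y < 1 -> tau <= rnorm (1 - y^* * x) ->
    rnorm (G x - c - H x) <= e * tau / 4 -> rnorm (G y - c - H y) <= e * tau / 4 ->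
    rnorm (herglotz_kernel x y - L x y) <= e / 4.
  move=> x1 y1 tauxy lex ley; rewrite /herglotz_kernel /L -mulrBl.
  have -> : G x + (G y)^* - (H x + (H y)^*) = (G x - c - H x) + (G y - c - H y)^*.
    by rewrite !rmorphB /=; rewrite -[LHS]addr0 -[0]oppr0 -c_imag; ring.
  rewrite rnormM rnormV rnormM rnorm_nat ler_pdivrMr; last first.
    by rewrite mulr_gt0 // (lt_le_trans tau0).
  apply: le_trans (rnormD _ _) _; rewrite rnorm_conj.
  apply: (@le_trans _ _ (e * tau / 2)); first by lra.
  have := ler_wpM2l (ltW e0) tauxy; lra.
have tauzw := kernel_denom_ge z1 w1.
have tauwz : tau <= rnorm (1 - z^* * w) by rewrite /tau minC; exact: kernel_denom_ge.
have tauzz : tau <= rnorm (1 - z^* * z).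
  by apply: le_trans (kernel_denom_ge z1 z1); rewrite le_min !ge_min lexx.
have tauww : tau <= rnorm (1 - w^* * w).
  by apply: le_trans (kernel_denom_ge w1 w1); rewrite le_min !ge_min lexx orbT.
pose g j x := (1 - (om j)^* * x)^-1.
have LE x y : rnorm x < 1 -> rnorm y < 1 -> L x y = \sum_j (m j)%:C%C * (g j x * (g j y)^*).
  move=> x1 y1; rewrite /L /H /herglotz_sum rmorph_sum -big_split mulr_suml.
  apply: eq_bigr => j _; rewrite /g -(circle_kernelE (om1 j) x1 y1).
  by rewrite [in RHS]mulrA [in RHS]mulrDr rmorphM /= [X in _ + X * _](conjCE (m j)%:C%C) conjc_real.
have diffE : L z z - L z w - L w z + L w w =
    \sum_j (m j)%:C%C * ((g j z - g j w) * (g j z - g j w)^*).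
  rewrite !LE // -!sumrB -big_split; apply: eq_bigr => j _ /=.
  by rewrite rmorphB /=; ring.
have leL : rnorm (L z z - L z w - L w z + L w w) <=
    (complex.Re (G 0) + 1) * (rnorm (z - w) * (4 / d) ^+ 2) ^+ 2.
  rewrite diffE; apply: le_trans (rnorm_sum _ _ _) _.
  pose f j := rnorm (g j z - g j w) ^+ 2.
  apply: (@le_trans _ _ (\sum_j m j * f j)).
    apply: ler_sum => j _; rewrite rnormM rnorm_real ger0_norm //.
    by rewrite rnormM rnorm_conj.
  apply: (sum_far_le (sqr_ge0 _) m0 _ mM) => j; rewrite /f.
  have [->|farj] := far j; [by left|right].
  have om0 : om j != 0 by apply: contra_eq_neq (om1 j) => ->; rewrite rnorm0 eq_sym oner_neq0.
  have gE x : g j x = om j * (om j - x)^-1.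
    have E := circle_conj_mul (om1 j).
    rewrite /g -E -mulrBr invfM; congr (_ * _).
    by apply: (mulfI (_ : (om j)^* != 0)); rewrite ?conjC_eq0 // divff ?conjC_eq0 // E.
  have -> : g j z - g j w = om j * (z - w) * (om j - z)^-1 * (om j - w)^-1.
    by rewrite !gE; field; rewrite !circle_sub_neq0.
  rewrite !rnormM om1 mul1r !rnormV -mulrA.
  rewrite ler_sqr ?nnegrE ?mulr_ge0 ?invr_ge0 ?sqr_ge0 ?rnorm_ge0 ?(ltW d0) //.
  rewrite ler_wpM2l ?rnorm_ge0 // expr2.
  by rewrite ler_pM ?invr_ge0 ?rnorm_ge0 // inv_circle_dist_le // far_circle_dist.
have := close _ _ z1 z1 tauzz le1 le1; have := close _ _ z1 w1 tauzw le1 le2.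
have := close _ _ w1 z1 tauwz le2 le1; have := close _ _ w1 w1 tauww le2 le2.
move: leL; set A := L z z; set B := L z w; set D := L w z; set E := L w w.
set A' := herglotz_kernel z z; set B' := herglotz_kernel z w.
set D' := herglotz_kernel w z; set E' := herglotz_kernel w w => leL le3 le4 le5 le6.
have -> : A' - B' - D' + E' = (A - B - D + E) + ((A' - A) - (B' - B) - (D' - D) + (E' - E)).
  by ring.
have := rnormD (A - B - D + E) ((A' - A) - (B' - B) - (D' - D) + (E' - E)).
have := rnormD ((A' - A) - (B' - B) - (D' - D)) (E' - E).
have := rnormB ((A' - A) - (B' - B)) (D' - D).
have := rnormB (A' - A) (B' - B).
lra.
Qed.

End FarMeasure.

End Herglotz.

(** * Lipschitz regularity of the kernel vectors *)

Section KernelRegularity.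
Variables (R : realType) (H : completeNormedModType R[i]).
Variable ip : {dot H for Num.conj}.
Hypothesis ip_norm : forall u : H, `|u| ^+ 2 = ip u u.
Local Notation C := R[i].
Variables (b : C -> C) (k : C -> H).
Implicit Types (z w : C) (u : H).
Hypothesis ip_kernel : forall z w, rnorm z < 1 -> rnorm w < 1 ->
  (1 - w^* * z) * ip (k w) (k z) = 1 - (b w)^* * b z.

Lemma kernel_sqr_norm z : rnorm z < 1 ->
  (1 - rnorm z ^+ 2) * rnorm (k z) ^+ 2 = 1 - rnorm (b z) ^+ 2.
Proof.
move=> z1; apply: complexI; have := ip_kernel z1 z1.
rewrite (ip_sqr ip_norm) !(mulrC _^*) !mulC_conj (RcM (1 - rnorm z ^+ 2)) !RcB; exact.
Qed.

Lemma one_sub_sqr_gt0 z : rnorm z < 1 -> 0 < 1 - rnorm z ^+ 2.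
Proof. by move=> z1; have := rnorm_ge0 z; nra. Qed.

Lemma rnorm_b_le1 z : rnorm z < 1 -> rnorm (b z) <= 1.
Proof.
move=> z1; have := kernel_sqr_norm z1; have := one_sub_sqr_gt0 z1.
by have := sqr_ge0 (rnorm (k z)); have := rnorm_ge0 (b z); nra.
Qed.

Lemma ev_approx u (r : R) : r < 1 -> poly_approx (fun z => ip u (k z)) r.
Proof.
move=> r1; have [e [_ He]] := kernel_power_series ip_norm ip_kernel.
apply: (@poly_approxS _ _ (Num.max 0 r)); first by rewrite le_max lexx orbT.
move=> eps eps0; have u0 : 0 < rnorm u + 1 by rewrite ltr_wpDl ?rnorm_ge0.
have r01 : 0 <= Num.max 0 r < 1 by rewrite le_max lexx gt_max ltr01.
have [M /(_ M (leqnn M)) HM] := He _ _ r01 (divr_gt0 eps0 u0).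
exists (\poly_(i < M) ip u (e i)) => z /HM le1.
have -> : ip u (k z) - (\poly_(i < M) ip u (e i)).[z] =
    ip u (k z - \sum_(i < M) z^* ^+ i *: e i).
  rewrite ipBr ip_sumr horner_poly; congr (_ - _); apply: eq_bigr => i _.
  by rewrite ipZr rmorphXn /= conjCK mulrC.
apply: le_trans (cauchy_schwarz ip_norm _ _) _.
apply: (@le_trans _ _ (rnorm u * (eps / (rnorm u + 1)))).
  by rewrite ler_wpM2l ?rnorm_ge0.
by rewrite mulrCA ler_piMr ?(ltW eps0) // ler_pdivrMr // mul1r lerDl.
Qed.

(** The kernel relation at a fixed [w0] expresses [b] through the function
    [k w0] of the space. *)
Lemma b_approx w0 (r : R) : rnorm w0 < 1 -> b w0 != 0 -> r < 1 -> poly_approx b r.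
Proof.
move=> w01 b0 r1.
have : poly_approx (fun z => (1 - (1 - w0^* * z) * ip (k w0) (k z)) * ((b w0)^*)^-1) r.
  apply: poly_approxM (poly_approx_cst _ _).
  apply: poly_approxB (poly_approx_cst _ _) _.
  apply: poly_approxM (ev_approx _ r1).
  apply: poly_approxB (poly_approx_cst _ _) _.
  apply: poly_approxM (poly_approx_cst _ _) _.
  by apply: eq_poly_approx (poly_approx_horner 'X r) => z _; rewrite hornerX.
apply: eq_poly_approx => z zr; rewrite ip_kernel //; last exact: le_lt_trans zr r1.
by rewrite subKr mulrC mulKf // conjC_eq0.
Qed.

(** The Schwarz-Pick inequality, in the form of Cauchy-Schwarz for [k 0] and
    [k z]. *)
Lemma rnorm_b_le_rho (r : R) : rnorm (b 0) < 1 -> r < 1 -> exists rho : R,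
  0 <= rho < 1 /\ forall z, rnorm z <= r -> rnorm (b z) <= rho.
Proof.
move=> b01 r1; set beta := rnorm (b 0) in b01 *; have beta0 : 0 <= beta := rnorm_ge0 _.
pose s := Num.max 0 r; have s1 : s < 1 by rewrite gt_max ltr01.
have s0 : 0 <= s by rewrite le_max lexx.
pose tau := (1 - beta) * (1 - s ^+ 2) / 2.
have s20 : 0 < 1 - s ^+ 2 by nra.
have s21 : 1 - s ^+ 2 <= 1 by have := sqr_ge0 s; lra.
have tau0 : 0 < tau by rewrite /tau divr_gt0 // mulr_gt0 // subr_gt0.
have tau1 : tau <= 1 by rewrite /tau; nra.
exists (1 - tau / 2); split; first by apply/andP; split; lra.
move=> z zr; have zs : rnorm z <= s by apply: le_trans zr _; rewrite le_max lexx orbT.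
have z1 : rnorm z < 1 by apply: le_lt_trans zs s1.
have D0 : rnorm (0 : C) < 1 by rewrite rnorm0.
have := cauchy_schwarz ip_norm (k 0) (k z).
have := ip_kernel z1 D0; rewrite rmorph0 mul0r subr0 mul1r => ->.
have := rnorm_ge_sub (1 : C) ((b 0)^* * b z); rewrite rnorm1 rnormM rnorm_conj -/beta.
have := kernel_sqr_norm z1; have := kernel_sqr_norm D0.
rewrite rnorm0 expr0n subr0 mul1r -/beta.
have := rnorm_ge0 z; have bz0 := rnorm_ge0 (b z); have bz1 := rnorm_b_le1 z1.
have := rnorm_ge0 (k 0); have := rnorm_ge0 (k z).
move: (rnorm (k 0)) (rnorm (k z)) (rnorm z) zs z1 (rnorm (b z)) bz0 bz1.
move=> k0 kz x xs x1 y y0 y1 kz0 k00 x0 E0 Ez le1 le2.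
have le3 : (1 - beta) ^+ 2 <= (k0 * kz) ^+ 2.
  rewrite ler_sqr ?nnegrE ?mulr_ge0 ?subr_ge0 ?(ltW b01) //.
  apply: le_trans (le_trans le1 le2); rewrite lerB // ler_piMr //.
have x20 : 0 <= 1 - x ^+ 2 by nra.
have le4 : (1 - beta) ^+ 2 * (1 - x ^+ 2) <= (1 - beta ^+ 2) * (1 - y ^+ 2).
  rewrite -E0 -Ez; apply: le_trans (ler_wpM2r x20 le3) _.
  by rewrite exprMn -mulrA [kz ^+ 2 * _]mulrC.
have le5 : (1 - beta) * (1 - x ^+ 2) <= (1 + beta) * (1 - y ^+ 2).
  have b10 : 0 < 1 - beta by rewrite subr_gt0.
  rewrite -(ler_pM2l b10); apply: le_trans (le_trans _ le4) _.
    by rewrite mulrA -expr2.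
  by rewrite le_eqVlt; apply/orP; left; apply/eqP; ring.
have y20 : 0 <= 1 - y ^+ 2 by nra.
have le6 : (1 + beta) * (1 - y ^+ 2) <= 2 * (1 - y ^+ 2) by rewrite ler_wpM2r //; lra.
have le7 : (1 - beta) * (1 - s ^+ 2) <= (1 - beta) * (1 - x ^+ 2).
  by rewrite ler_wpM2l ?subr_ge0 ?(ltW b01) // lerB // ler_sqr.
have le8 : tau <= 1 - y ^+ 2 by rewrite /tau; lra.
by rewrite -ler_sqr ?nnegrE //; [nra|lra].
Qed.

Section NearBoundary.
Variables (zeta : C) (d K : R).
Hypothesis zeta1 : rnorm zeta = 1.
Hypothesis d01 : 0 < d <= 1.
Hypothesis K0 : 0 < K.
Hypothesis b_half : forall z, rnorm z < 1 -> rnorm (z - zeta) < d -> 1 / 2 <= rnorm (b z).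
Hypothesis diag_le : forall z, rnorm z < 1 -> rnorm (z - zeta) < d ->
  1 - rnorm (b z) ^+ 2 <= K * (1 - rnorm z ^+ 2).

Lemma kernel_norm_le z : rnorm z < 1 -> rnorm (z - zeta) < d -> rnorm (k z) ^+ 2 <= K.
Proof.
move=> z1 zz; have z2 := one_sub_sqr_gt0 z1; rewrite -(ler_pM2l z2).
by rewrite kernel_sqr_norm // mulrC diag_le.
Qed.

Lemma near_point (e : R) : 0 < e <= 1 -> exists w, rnorm w < 1 /\ rnorm (w - zeta) < e.
Proof.
move=> /andP[e0 e1]; exists ((1 - e / 2)%:C%C * zeta); rewrite rnormM zeta1 mulr1.
have -> : (1 - e / 2)%:C%C * zeta - zeta = - (e / 2)%:C%C * zeta.
  by rewrite RcB; rewrite -[1%:C%C]/(1 : C); ring.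
by rewrite rnormM rnormN zeta1 mulr1 !rnorm_real !ger0_norm; lra.
Qed.

(** The kernel is bounded near [(zeta, zeta)], so [b z * (b w)^*] tends to 1
    there; hence [b] stays near a point of the circle. *)
Lemma clark_parameter : exists (alpha : C) (eps : R), [/\ rnorm alpha = 1, 0 < eps <= d &
  forall z, rnorm z < 1 -> rnorm (z - zeta) < eps -> 1 <= rnorm (1 - alpha^* * b z)].
Proof.
have /andP[d0 d1] := d01.
pose eps := Num.min d (1 / (4 * K)).
have eps0 : 0 < eps by rewrite lt_min d0 divr_gt0 // mulr_gt0.
have [epsd epsK] : eps <= d /\ 4 * K * eps <= 1.
  split; first by rewrite ge_min lexx.
  by rewrite mulrC -ler_pdivlMr ?mulr_gt0 // ge_min lexx orbT.
have [w [w1 wz]] : exists w, rnorm w < 1 /\ rnorm (w - zeta) < eps.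
  by apply: near_point; rewrite eps0 (le_trans epsd).
have bw : 1 / 2 <= rnorm (b w) by apply: b_half => //; apply: lt_le_trans epsd.
have bw0 : 0 < rnorm (b w) by lra.
exists (- (rnorm (b w))^-1%:C%C * b w), eps; split.
- by rewrite rnormM rnormN rnorm_real gtr0_norm ?invr_gt0 // mulVf // gt_eqF.
- by rewrite eps0.
move=> z z1 zz; apply: le_trans (Re_le_rnorm _).
have le1 : rnorm (1 - (b w)^* * b z) <= 1 / 2.
  rewrite -ip_kernel // rnormM.
  have le2 : rnorm (ip (k w) (k z)) <= K.
    apply: le_trans (cauchy_schwarz ip_norm _ _) _.
    have := kernel_norm_le z1 (lt_le_trans zz epsd).
    have := kernel_norm_le w1 (lt_le_trans wz epsd).
    by have := sqr_ge0 (rnorm (k w) - rnorm (k z)); nra.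
  have le3 : rnorm (1 - w^* * z) <= 2 * eps.
    have -> : 1 - w^* * z = (zeta - w)^* * zeta - w^* * (z - zeta).
      by rewrite rmorphB mulrBl (circle_conj_mul zeta1); ring.
    apply: le_trans (rnormB _ _) _; rewrite !rnormM !rnorm_conj zeta1 mulr1.
    have : rnorm w * rnorm (z - zeta) <= rnorm (z - zeta).
      by rewrite ler_piMl ?rnorm_ge0 // ltW.
    by rewrite (rdistC zeta w); lra.
  apply: (@le_trans _ _ (2 * eps * K)); first by rewrite ler_pM ?rnorm_ge0.
  by lra.
have le2 : 1 / 2 <= complex.Re ((b w)^* * b z).
  by have := le_trans (Re_le_rnorm _) le1; rewrite ReB /=; lra.
have -> : (- (rnorm (b w))^-1%:C%C * b w)^* * b z = - ((rnorm (b w))^-1%:C%C * ((b w)^* * b z)).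
  rewrite rmorphM rmorphN /= [X in - X * _](conjCE (rnorm (b w))^-1%:C%C) conjc_real; ring.
rewrite opprK ReD Re_rM /= lerDl mulr_ge0 ?invr_ge0 ?rnorm_ge0 //; lra.
Qed.

Lemma Re_div (x y : C) : complex.Re (x / y) = complex.Re (x * y^*) / rnorm y ^+ 2.
Proof.
have [-> | y0] := eqVneq y 0; first by rewrite invr0 rmorph0 !mulr0 mul0r.
have ny : rnorm y ^+ 2 != 0 by rewrite expf_eq0 /=; apply: contra_neq y0; exact: rnorm0_eq0.
have -> : x / y = ((rnorm y ^+ 2)^-1)%:C%C * (x * y^*).
  by rewrite RcV -mulC_conj; field; rewrite conjC_eq0 y0.
by rewrite Re_rM mulrC.
Qed.

(** Dividing [k z] by [(1 - B z)^*], where [B = alpha^* b], gives vectors [l z]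
    whose Gram kernel is the Herglotz kernel of [G = (1 + B) / (1 - B)].  Near
    [zeta] the real part of [G] is at most [K (1 - |z|^2)], so its Clark measure
    has no mass there and [l] is Lipschitz; so are [G], hence [B], and finally
    [k = (1 - B)^* l]. *)
Lemma kernel_lipschitz : exists (A eps : R), [/\ 0 <= A, 0 < eps <= d &
  forall z w, rnorm z < 1 -> rnorm w < 1 -> rnorm (z - zeta) < eps ->
    rnorm (w - zeta) < eps -> rnorm (k z - k w) <= A * rnorm (z - w)].
Proof.
have D0 : rnorm (0 : C) < 1 by rewrite rnorm0.
have /andP[d0 d1] := d01.
have [b01|b01] := ltP (rnorm (b 0)) 1; last first.
  (* the degenerate case [|b(0)| = 1], where H(b) is zero *)
  have k0 z : rnorm z < 1 -> k z = 0.
    move=> z1; apply: rnorm0_eq0.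
    have b01' : rnorm (b 0) = 1 by apply/eqP; rewrite eq_le b01 rnorm_b_le1.
    have k00 : rnorm (k 0) = 0.
      have := kernel_sqr_norm D0; rewrite b01' rnorm0 expr1n expr0n subr0 mul1r subrr.
      by move=> /eqP; rewrite expf_eq0 /= => /eqP.
    have := ip_kernel z1 D0; rewrite (rnorm0_eq0 k00) linear0l mulr0 => /esym/eqP.
    rewrite subr_eq0 => /eqP/(congr1 (@rnorm R _)); rewrite rnorm1 rnormM rnorm_conj b01' mul1r.
    move=> bz; have := kernel_sqr_norm z1; rewrite -bz expr1n subrr => /eqP.
    by rewrite mulf_eq0 gt_eqF ?one_sub_sqr_gt0 //= expf_eq0 /= => /eqP.
  exists 0, d; split=> // [|z w z1 w1 _ _]; first by rewrite d0 lexx.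
  by rewrite !k0 // subrr rnorm0 mul0r.
have [alpha [eps [alpha1 /andP[eps0 epsd] Balpha]]] := clark_parameter.
pose B z := alpha^* * b z.
have B1 z : rnorm (B z) = rnorm (b z) by rewrite rnormM rnorm_conj alpha1 mul1r.
have [w0 [w01 w0z]] : exists w, rnorm w < 1 /\ rnorm (w - zeta) < d.
  by apply: near_point; rewrite d0.
have bw0 : b w0 != 0.
  by have := b_half w01 w0z; apply: contraTneq => ->; rewrite rnorm0 -ltNge divr_gt0.
have B_neq1 z : rnorm z < 1 -> 1 - B z != 0.
  move=> z1; have [rho [/andP[_ rho1] Hrho]] := rnorm_b_le_rho b01 z1.
  have := Hrho _ (lexx _); rewrite -B1 subr_eq0 => le1; apply: contraTneq le1 => <-.
  by rewrite rnorm1 -ltNge.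
pose G z := (1 + B z) * (1 - B z)^-1.
have G_approx (r : R) : r < 1 -> poly_approx G r.
  move=> r1; have [rho [rho01 Hrho]] := rnorm_b_le_rho b01 r1.
  have BP : poly_approx B r.
    by apply: poly_approxM (poly_approx_cst _ _) (b_approx w01 bw0 r1).
  apply: poly_approxM; first exact: poly_approxD (poly_approx_cst _ _) BP.
  by apply: poly_approx_inv rho01 _ BP => z zr; rewrite B1 Hrho.
have ReGE z : complex.Re (G z) = (1 - rnorm (b z) ^+ 2) / rnorm (1 - B z) ^+ 2.
  rewrite /G Re_div; congr (_ / _); rewrite -B1 rnorm_sqrE conjCE.
  by case: (B z) => x y /=; ring.
have ReG_ge0 z : rnorm z < 1 -> 0 <= complex.Re (G z).
  move=> z1; rewrite ReGE divr_ge0 ?sqr_ge0 //.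
  by have := rnorm_b_le1 z1; have := rnorm_ge0 (b z); nra.
have ReG_le z : rnorm z < 1 -> rnorm (z - zeta) < eps ->
    complex.Re (G z) <= K * (1 - rnorm z ^+ 2).
  move=> z1 zz; have le1 := Balpha _ z1 zz.
  have := ReG_ge0 _ z1; rewrite ReGE => ge0.
  have zd : rnorm (z - zeta) < d by exact: lt_le_trans zz epsd.
  apply: le_trans (diag_le z1 zd); rewrite ler_piMr //.
    by have := rnorm_b_le1 z1; have := rnorm_ge0 (b z); nra.
  by rewrite invf_le1 ?exprn_ege1 // exprn_gt0 // (lt_le_trans ltr01).
pose l z := ((1 - B z)^-1)^* *: k z.
have l_ip z w : rnorm z < 1 -> rnorm w < 1 -> ip (l w) (l z) = herglotz_kernel G z w.
  move=> z1 w1; rewrite ipZl ipZr conjCK.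
  have nz := B_neq1 _ z1; have nw := B_neq1 _ w1; have nk := kernel_denom_neq0 z1 w1.
  have -> : ip (k w) (k z) = (1 - (B w)^* * B z) / (1 - w^* * z).
    apply: (mulfI nk); rewrite ip_kernel // mulrCA divff // mulr1; congr (1 - _).
    rewrite /B rmorphM /= conjCK mulrACA [X in _ = X * _]mulrC (circle_conj_mul alpha1).
    by rewrite mul1r.
  have nw' : 1 - (B w)^* != 0 by rewrite -(rmorph1 Num.conj) -rmorphB conjC_eq0.
  have GJ : (G w)^* = (1 + (B w)^*) * (1 - (B w)^*)^-1.
    by rewrite /G rmorphM fmorphV rmorphB rmorphD rmorph1.
  rewrite /herglotz_kernel GJ /G fmorphV rmorphB rmorph1 /=.
  move: (B z) (B w)^* nz nw' => x y nz nw'.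
  by field; rewrite nk nw' nz.
pose M := complex.Re (G 0) + 1.
have M0 : 0 <= M by rewrite addr_ge0 // ReG_ge0.
pose A1 := M * (2 * (4 / eps) ^+ 2).
pose A2 : R := Num.sqrt M * (4 / eps) ^+ 2.
have A10 : 0 <= A1 by rewrite mulr_ge0 // mulr_ge0 // sqr_ge0.
have A20 : 0 <= A2 by rewrite mulr_ge0 ?sqrtr_ge0 ?sqr_ge0.
have G_lip z w : rnorm z < 1 -> rnorm w < 1 -> rnorm (z - zeta) < eps / 2 ->
    rnorm (w - zeta) < eps / 2 -> rnorm (G z - G w) <= A1 * rnorm (z - w).
  move=> z1 w1 zz wz.
  have := herglotz_lipschitz eps0 K0 G_approx ReG_ge0 ReG_le z1 w1 zz wz.
  by move=> /le_trans; apply; rewrite /A1 /M; lra.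
have l_lip z w : rnorm z < 1 -> rnorm w < 1 -> rnorm (z - zeta) < eps / 2 ->
    rnorm (w - zeta) < eps / 2 -> rnorm (l z - l w) <= A2 * rnorm (z - w).
  move=> z1 w1 zz wz.
  have := herglotz_kernel_lipschitz eps0 K0 G_approx ReG_ge0 ReG_le z1 w1 zz wz.
  rewrite -!l_ip // => le1.
  have A2zw : 0 <= A2 * rnorm (z - w) by exact: mulr_ge0 (rnorm_ge0 _).
  rewrite -ler_sqr ?nnegrE ?rnorm_ge0 //.
  have -> : rnorm (l z - l w) ^+ 2 = rnorm (ip (l z - l w) (l z - l w)).
    by rewrite (ip_sqr ip_norm) rnorm_real ger0_norm ?sqr_ge0.
  have -> : ip (l z - l w) (l z - l w) = ip (l z) (l z) - ip (l w) (l z) - ip (l z) (l w) + ip (l w) (l w).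
    by rewrite !ipBl !ipBr; ring.
  apply: le_trans le1 _; rewrite -/M.
  have -> : (A2 * rnorm (z - w)) ^+ 2 =
      Num.sqrt M ^+ 2 * (rnorm (z - w) * (4 / eps) ^+ 2) ^+ 2 by rewrite /A2; ring.
  by rewrite sqr_sqrtr.
pose e2 := eps / 2.
pose A3 : R := 2 * A2 + 2 * A1 * (K + 1).
exists A3, e2; split.
- apply: addr_ge0; first exact: mulr_ge0.
  by apply: mulr_ge0; [exact: mulr_ge0|rewrite addr_ge0 // ltW].
- by rewrite /e2; apply/andP; split; lra.
move=> z w z1 w1 zz wz.
have zeps : rnorm (z - zeta) < eps by rewrite /e2 in zz; lra.
have weps : rnorm (w - zeta) < eps by rewrite /e2 in wz; lra.
have kE x : rnorm x < 1 -> k x = (1 - B x)^* *: l x.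
  by move=> x1; rewrite /l scalerA -rmorphM /= mulfV ?B_neq1 // rmorph1 scale1r.
have lw : rnorm (l w) <= K + 1.
  have le1 := Balpha _ w1 weps.
  rewrite /l rnormZ rnorm_conj rnormV; apply: (@le_trans _ _ (rnorm (k w))).
    by rewrite ler_piMl ?rnorm_ge0 // invf_le1 // (lt_le_trans ltr01).
  have := kernel_norm_le w1 (lt_le_trans weps epsd).
  by have := rnorm_ge0 (k w); nra.
have B2 x : rnorm x < 1 -> rnorm (1 - B x) <= 2.
  move=> x1; apply: le_trans (rnormB _ _) _; rewrite rnorm1 B1.
  by have := rnorm_b_le1 x1; lra.
have Bzw : rnorm (B w - B z) <= 2 * A1 * rnorm (z - w).
  have -> : B w - B z = - ((G z - G w) * (1 - B z) * (1 - B w) / 2).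
    by rewrite /G; field; rewrite !B_neq1.
  rewrite rnormN !rnormM rnormV rnorm_nat.
  have := G_lip _ _ z1 w1 zz wz; have := B2 _ z1; have := B2 _ w1.
  move: (rnorm_ge0 (1 - B z)) (rnorm_ge0 (1 - B w)) (rnorm_ge0 (G z - G w)) => p0 q0 g0.
  move=> q2 p2 gA; rewrite ler_pdivrMr //.
  apply: (@le_trans _ _ (A1 * rnorm (z - w) * 2 * 2)); last by lra.
  by rewrite !ler_pM ?mulr_ge0.
have -> : k z - k w = (1 - B z)^* *: (l z - l w) + (B w - B z)^* *: l w.
  rewrite (kE z) // (kE w) // (_ : (1 - B w)^* = (1 - B z)^* - (B w - B z)^*).
    by rewrite scalerBl scalerBr opprB addrA addrAC.
  by rewrite -rmorphB /=; congr (_^*); ring.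
apply: le_trans (rnormD _ _) _; rewrite (rnormZ _ (l z - l w)) (rnormZ _ (l w)).
rewrite !rnorm_conj mulrDl; apply: lerD.
  by rewrite -mulrA ler_pM ?rnorm_ge0 ?B2 // l_lip.
apply: le_trans (ler_pM (rnorm_ge0 _) (rnorm_ge0 _) Bzw lw) _.
by rewrite le_eqVlt; apply/orP; left; apply/eqP; ring.
Qed.

End NearBoundary.

End KernelRegularity.

(** * Plane Lebesgue measure under linear maps *)

Section PlaneMeasure.
Variable R : realType.
Local Notation mu := (@lebesgue_measure R).
Local Notation mu2 := (@lebesgue_measure R \x @lebesgue_measure R)%E.
Local Open Scope ereal_scope.

Let affine (s a : R) : measurableTypeR R -> measurableTypeR R := fun x => (s * x + a)%R.

Lemma measurable_affine (s a : R) : measurable_fun setT (affine s a).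
Proof.
by apply: measurable_funD => //; apply: measurable_funM.
Qed.

(** Uniqueness of Lebesgue measure: the image of [mu] under [x |-> s x + a],
    scaled by [s], gives intervals their length. *)
Lemma integral_affine (f : R -> \bar R) (s a : R) : (0 < s)%R ->
  measurable_fun setT f -> (forall x, 0 <= f x) ->
  s%:E * \int[mu]_x f (s * x + a)%R = \int[mu]_x f x.
Proof.
move=> s0 mf f0.
have mA := measurable_affine s a.
pose nu := mscale (NngNum (ltW s0)) (pushforward mu (affine s a)).
have nuE A : measurable A -> mu A = nu mA A.
  apply: lebesgue_measure_unique => _ [[c d] _ <-].
  rewrite -[RHS]/(s%:E * mu (affine s a @^-1` `]c, d])).
  rewrite (_ : affine s a @^-1` _ = `]((c - a) / s)%R, ((d - a) / s)%R]%classic); last first.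
    apply/seteqP; split => x /=; rewrite !in_itv /= /affine => /andP[lo hi]; apply/andP; split.
    - by rewrite ltr_pdivrMr // ltrBlDr mulrC.
    - by rewrite ler_pdivlMr // lerBrDr mulrC.
    - by move: lo; rewrite ltr_pdivrMr // ltrBlDr mulrC.
    - by move: hi; rewrite ler_pdivlMr // lerBrDr mulrC.
  rewrite !lebesgue_measure_itv /= !lte_fin ltr_pM2r ?invr_gt0 // ltrD2r.
  case: ifP => _; last by rewrite mule0.
  rewrite -!EFinB -EFinM; congr EFin; field; by rewrite gt_eqF.
transitivity (\int[nu mA]_x f x); last first.
  by apply: eq_measure_integral => A mA' _; exact/esym/nuE.
rewrite ge0_integral_mscale //.
by rewrite ge0_integral_pushforward.
Qed.

Lemma integral_xy (F : R * R -> \bar R) : measurable_fun setT F -> (forall p, 0 <= F p) ->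
  \int[mu2]_p F p = \int[mu]_x \int[mu]_y F (x, y).
Proof. by move=> mF F0; rewrite fubini_tonelli1. Qed.

Lemma integral_yx (F : R * R -> \bar R) : measurable_fun setT F -> (forall p, 0 <= F p) ->
  \int[mu2]_p F p = \int[mu]_y \int[mu]_x F (x, y).
Proof. by move=> mF F0; rewrite (integral_xy mF F0); exact: (@fubini_tonelli _ _ _ _ _ mu mu F mF F0). Qed.

Section Plane.
Variable F : R * R -> \bar R.
Hypothesis mF : measurable_fun setT F.
Hypothesis F0 : forall p, 0 <= F p.

Lemma measurable_linear (a b c d : R) :
  measurable_fun setT (fun p : R * R => (a * p.1 + b * p.2, c * p.1 + d * p.2)%R).
Proof.
by apply: measurable_fun_pair; apply: measurable_funD; apply: measurable_funM.
Qed.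

Lemma integral_shear1 (a : R) :
  \int[mu2]_p F (p.1 + a * p.2, p.2)%R = \int[mu2]_p F p.
Proof.
have mFa : measurable_fun setT (fun p : R * R => F (p.1 + a * p.2, p.2)%R).
  apply: measurableT_comp => //; have := measurable_linear 1 a 0 1.
  by under eq_fun do rewrite !mul1r mul0r add0r.
rewrite (integral_yx mFa (fun p => F0 _)) (integral_yx mF F0).
apply: eq_integral => y _ /=.
have mFy : measurable_fun setT (fun x => F (x, y)) by exact: measurable_fun_pair1.
have := integral_affine (a * y)%R ltr01 mFy (fun x => F0 (x, y)).
by rewrite mul1e => <-; under [RHS]eq_integral do rewrite mul1r.
Qed.

Lemma integral_shear2 (a : R) :
  \int[mu2]_p F (p.1, p.2 + a * p.1)%R = \int[mu2]_p F p.
Proof.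
have mFa : measurable_fun setT (fun p : R * R => F (p.1, p.2 + a * p.1)%R).
  apply: measurableT_comp => //; have := measurable_linear 1 0 a 1.
  by under eq_fun do rewrite !mul1r mul0r addr0 addrC.
rewrite (integral_xy mFa (fun p => F0 _)) (integral_xy mF F0).
apply: eq_integral => x _ /=.
have mFx : measurable_fun setT (fun y => F (x, y)) by exact: measurable_fun_pair2.
have := integral_affine (a * x)%R ltr01 mFx (fun y => F0 (x, y)).
by rewrite mul1e => <-; under [RHS]eq_integral do rewrite mul1r.
Qed.

Lemma integral_dilation (s : R) : (0 < s)%R ->
  (s ^+ 2)%:E * \int[mu2]_p F (s * p.1, s * p.2)%R = \int[mu2]_p F p.
Proof.
move=> s0.
have mFs : measurable_fun setT (fun p : R * R => F (s * p.1, s * p.2)%R).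
  apply: measurableT_comp => //; have := measurable_linear s 0 0 s.
  by under eq_fun do rewrite !mul0r add0r addr0.
rewrite (integral_xy mFs (fun p => F0 _)) (integral_xy mF F0) /=.
have mG : measurable_fun setT (fun x : R => \int[lebesgue_measure]_y F (x, y)).
  exact: measurable_fun_fubini_tonelli_F.
have G0 x : 0 <= \int[lebesgue_measure]_y F (x, y) by apply: integral_ge0.
rewrite -(integral_affine 0 s0 mG G0) expr2 EFinM -muleA; congr (_ * _).
rewrite -ge0_integralZl //; last 3 first.
- exact: (@measurable_fun_fubini_tonelli_F _ _ _ _ _ mu _ mFs (fun p => F0 _)).
- by move=> x _; apply: integral_ge0.
- by rewrite lee_fin ltW.
apply: eq_integral => x _; rewrite addr0.
have mFx : measurable_fun setT (fun y => F (s * x, y)%R) by exact: measurable_fun_pair2.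
rewrite -(integral_affine 0 s0 mFx) //.
by congr (_ * _); apply: eq_integral => y _; rewrite addr0.
Qed.

End Plane.

(** A rotation that is not a half turn is a product of three shears. *)
Lemma integral_rotation_neq (F : R * R -> \bar R) (c s : R) :
  measurable_fun setT F -> (forall p, 0 <= F p) ->
  (c ^+ 2 + s ^+ 2 = 1)%R -> (1 + c != 0)%R ->
  \int[mu2]_p F (c * p.1 - s * p.2, s * p.1 + c * p.2)%R = \int[mu2]_p F p.
Proof.
move=> mF F0 cs c1; pose t := (s / (1 + c))%R.
have tE : (t * (1 + c) = s)%R by rewrite /t divfK.
have stE : (1 - s * t = c)%R.
  rewrite /t; apply: (mulIf c1); rewrite mulrBl -mulrA divfK //.
  by rewrite mul1r mulrDr mulr1 -!expr2; move: cs; lra.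
pose F1 p := F (p.1 + (- t) * p.2, p.2)%R.
pose F2 p := F1 (p.1, p.2 + s * p.1)%R.
have mF1 : measurable_fun setT F1.
  apply: measurableT_comp => //; have := measurable_linear 1 (- t) 0 1.
  by under eq_fun do rewrite !mul1r mul0r add0r.
have mF2 : measurable_fun setT F2.
  apply: measurableT_comp => //; have := measurable_linear 1 0 s 1.
  by under eq_fun do rewrite !mul1r mul0r addr0 addrC.
rewrite -(integral_shear1 mF F0 (- t)) -(integral_shear2 mF1 (fun p => F0 _) s).
rewrite -(integral_shear1 mF2 (fun p => F0 _) (- t)).
apply: eq_integral => -[x y] _; rewrite /F2 /F1 /=; congr (F (_, _)).
  transitivity ((1 - s * t) * x - t * (1 + (1 - s * t)) * y)%R; last by ring.
  by rewrite stE tE.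
transitivity (s * x + (1 - s * t) * y)%R; last by ring.
by rewrite stE.
Qed.

(** A half turn is the square of a quarter turn. *)
Lemma integral_rotation (F : R * R -> \bar R) (c s : R) :
  measurable_fun setT F -> (forall p, 0 <= F p) -> (c ^+ 2 + s ^+ 2 = 1)%R ->
  \int[mu2]_p F (c * p.1 - s * p.2, s * p.1 + c * p.2)%R = \int[mu2]_p F p.
Proof.
move=> mF F0 cs; have [c1 | c1] := eqVneq (1 + c)%R 0%R; last first.
  exact: integral_rotation_neq.
have {}c1 : c = (-1)%R by move: c1; lra.
have s0 : s = 0%R.
  by apply/eqP; rewrite -sqrf_eq0; apply/eqP; move: cs; rewrite c1 sqrrN expr1n; lra.
pose F1 p := F (0 * p.1 - 1 * p.2, 1 * p.1 + 0 * p.2)%R.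
have mF1 : measurable_fun setT F1.
  apply: measurableT_comp => //; have := measurable_linear 0 (-1) 1 0.
  by under eq_fun do rewrite mulNr.
have i1 : (0 ^+ 2 + 1 ^+ 2 = 1 :> R)%R by rewrite expr0n expr1n add0r.
have i2 : (1 + 0 != 0 :> R)%R by rewrite addr0 oner_neq0.
rewrite -(integral_rotation_neq mF F0 i1 i2).
rewrite -(integral_rotation_neq mF1 (fun p => F0 _) i1 i2).
apply: eq_integral => -[x y] _; rewrite /F1 /=; congr (F (_, _)); rewrite c1 s0; ring.
Qed.

End PlaneMeasure.

(** * The Littlewood-Paley integral of a polynomial *)

Section DiskMoments.
Variable R : realType.
Local Notation C := R[i].
Local Notation mu2 := (@lebesgue_measure R \x @lebesgue_measure R)%E.

Definition cplx (p : R * R) : C := Complex p.1 p.2.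
Definition sqr_dist0 (p : R * R) : R := p.1 ^+ 2 + p.2 ^+ 2.

Lemma rnorm_cplx p : rnorm (cplx p) ^+ 2 = sqr_dist0 p.
Proof. by rewrite rnorm_sqrE. Qed.

Lemma sqr_dist0_ge0 p : 0 <= sqr_dist0 p.
Proof. by rewrite addr_ge0 ?sqr_ge0. Qed.

Lemma measurable_sqr_dist0 : measurable_fun setT sqr_dist0.
Proof. by apply: measurable_funD; apply: measurable_funX. Qed.

Definition plane_disk (s : R) : set (R * R) := [set p | sqr_dist0 p < s].

Lemma measurable_plane_disk s : measurable (plane_disk s).
Proof.
rewrite (_ : plane_disk s = sqr_dist0 @^-1` `]-oo, s[).
  by rewrite -[X in measurable X]setTI; exact: measurable_sqr_dist0.
by apply/seteqP; split => p /=; rewrite in_itv.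
Qed.

Lemma unit_disk_plane : [set p : R * R | unit_disk (Complex p.1 p.2)] = plane_disk 1.
Proof.
apply/seteqP; split => p /=; rewrite unit_diskE /plane_disk /= -rnorm_cplx.
  by move=> p1; have := rnorm_ge0 (cplx p); nra.
by move=> p1; have := rnorm_ge0 (cplx p); nra.
Qed.

Definition moment n (s : R) : \bar R :=
  \int[mu2]_p (\1_(plane_disk s) p * sqr_dist0 p ^+ n)%:E.

Lemma measurable_moment n s :
  measurable_fun setT (fun p : R * R => (\1_(plane_disk s) p * sqr_dist0 p ^+ n)%:E).
Proof.
apply/measurable_EFinP; apply: measurable_funM.
  by apply: measurable_indic; exact: measurable_plane_disk.
by apply: measurable_funX; exact: measurable_sqr_dist0.
Qed.

Lemma moment_ge0 n s p : (0 <= (\1_(plane_disk s) p * sqr_dist0 p ^+ n)%:E)%E.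
Proof. by rewrite lee_fin mulr_ge0 // exprn_ge0 // sqr_dist0_ge0. Qed.

Lemma moment_dilation n (s : R) : 0 < s ->
  (moment n (s ^+ 2) = ((s ^+ 2) ^+ n.+1)%:E * moment n 1)%E.
Proof.
move=> s0; rewrite /moment.
rewrite -(integral_dilation (measurable_moment n (s ^+ 2)) (moment_ge0 n _) s0).
have -> : (((s ^+ 2) ^+ n.+1)%:E = (s ^+ 2)%:E * ((s ^+ 2) ^+ n)%:E)%E.
  by rewrite -EFinM -exprS.
rewrite -muleA; congr (_ * _)%E.
transitivity (\int[mu2]_p (((s ^+ 2) ^+ n)%:E *
    (\1_(plane_disk 1) p * sqr_dist0 p ^+ n)%:E))%E; last first.
  have m0 p : setT p -> (0 <= (\1_(plane_disk 1) p * sqr_dist0 p ^+ n)%:E)%E.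
    by move=> _; exact: moment_ge0.
  have s20 : (0 <= ((s ^+ 2) ^+ n)%:E)%E by rewrite lee_fin exprn_ge0 // sqr_ge0.
  have mm := measurable_moment n 1.
  by rewrite ge0_integralZl.
apply: eq_integral => p _; rewrite -EFinM; congr EFin.
have E : sqr_dist0 (s * p.1, s * p.2) = s ^+ 2 * sqr_dist0 p by rewrite /sqr_dist0 /=; ring.
rewrite E exprMn mulrCA; congr (_ * (_ * _)).
rewrite !indicE; congr (_ %:R); congr nat_of_bool.
apply/idP/idP; rewrite !inE /plane_disk /= E.
  by rewrite -{2}[s ^+ 2]mulr1 ltr_pM2l // exprn_gt0.
by rewrite -{2}[s ^+ 2]mulr1 ltr_pM2l // exprn_gt0.
Qed.

Lemma moment0_le : (moment 0 1 <= 4%:E)%E.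
Proof.
pose S : set (R * R) := `[-1, 1]%classic `*` `[-1, 1]%classic.
have mS : measurable S by exact: measurableX.
have SE : mu2 S = 4%:E.
  rewrite product_measure1E //= !lebesgue_measure_itv /= !lte_fin.
  have -> : (-1 < 1 :> R) by lra.
  by rewrite -EFinB -EFinM; congr EFin; ring.
rewrite -SE -(setIT S) -integral_indic //; apply: ge0_le_integral => //.
- by move=> p _; exact: moment_ge0.
- exact: measurable_moment.
- by apply/measurable_EFinP; exact: measurable_indic.
move=> p _; rewrite expr0 mulr1 lee_fin !indicE.
case: (boolP (p \in plane_disk 1)) => [|_]; last by rewrite ler0n.
rewrite inE /plane_disk /sqr_dist0 /= => p1.
have b1 (x y : R) : x ^+ 2 + y ^+ 2 < 1 -> -1 <= x <= 1 :> Prop.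
  by move=> xy; apply/andP; split; have := sqr_ge0 y; nra.
rewrite mem_set //; split => /=; rewrite in_itv /=; first exact: b1 p1.
by rewrite addrC in p1; exact: b1 p1.
Qed.

Section PlaneIntegral.
Local Open Scope ereal_scope.
Implicit Types f g : R * R -> R.

Definition plane_integral f : \bar R := \int[mu2]_p (f p)%:E.

Lemma plane_integralD f g : measurable_fun setT f -> (forall p, 0 <= f p)%R ->
  measurable_fun setT g -> (forall p, 0 <= g p)%R ->
  plane_integral (fun p => f p + g p)%R = plane_integral f + plane_integral g.
Proof.
move=> mf f0 mg g0; rewrite /plane_integral -ge0_integralD //.
- by move=> p _; rewrite lee_fin.
- exact/measurable_EFinP.
- by move=> p _; rewrite lee_fin.
- exact/measurable_EFinP.
Qed.

Lemma plane_integralZ f (c : R) : measurable_fun setT f -> (forall p, 0 <= f p)%R ->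
  (0 <= c)%R -> plane_integral (fun p => c * f p)%R = c%:E * plane_integral f.
Proof.
move=> mf f0 c0.
have mf' : measurable_fun setT (EFin \o f) by exact/measurable_EFinP.
have f0' p : setT p -> 0 <= (EFin \o f) p by rewrite lee_fin.
have c0' : 0 <= c%:E by rewrite lee_fin.
exact: (ge0_integralZl mu2 measurableT mf' f0' c0').
Qed.

Lemma plane_integral_le f g : measurable_fun setT f -> (forall p, 0 <= f p)%R ->
  measurable_fun setT g -> (forall p, f p <= g p)%R ->
  plane_integral f <= plane_integral g.
Proof.
move=> mf f0 mg fg; apply: ge0_le_integral => //.
- by move=> p _; rewrite lee_fin.
- exact/measurable_EFinP.
- exact/measurable_EFinP.
- by move=> p _; rewrite lee_fin.
Qed.

Lemma plane_integral_sum n (f : 'I_n -> R * R -> R) :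
  (forall i, measurable_fun setT (f i)) -> (forall i p, 0 <= f i p)%R ->
  plane_integral (fun p => \sum_i f i p)%R = \sum_i plane_integral (f i).
Proof.
move=> mf f0; elim: n f mf f0 => [|n IH] f mf f0.
  rewrite big_ord0 /plane_integral; under eq_integral do rewrite big_ord0.
  exact: integral0.
rewrite big_ord_recl -IH // -plane_integralD //; last 2 first.
- by apply: measurable_sum.
- by move=> p; apply: sumr_ge0.
by congr plane_integral; apply/funext => p; rewrite big_ord_recl.
Qed.

End PlaneIntegral.

Definition power_weight n (s : R) (p : R * R) : R := \1_(plane_disk s) p * sqr_dist0 p ^+ n.

Lemma power_weight_ge0 n s p : 0 <= power_weight n s p.
Proof. by rewrite mulr_ge0 // exprn_ge0 // sqr_dist0_ge0. Qed.

Lemma measurable_power_weight n s : measurable_fun setT (power_weight n s).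
Proof. by have /measurable_EFinP := measurable_moment n s. Qed.

Lemma power_weightE n s p : power_weight n s p = if sqr_dist0 p < s then sqr_dist0 p ^+ n else 0.
Proof.
rewrite /power_weight indicE; case: ifPn => ps.
  by rewrite mem_set ?mul1r.
by rewrite memNset ?mul0r //; exact/negP.
Qed.

Lemma momentE n s : moment n s = plane_integral (power_weight n s).
Proof. by []. Qed.

Lemma moment_le n : (moment n 1 <= moment 0 1)%E.
Proof.
apply: (@plane_integral_le (power_weight n 1) (power_weight 0 1));
  [exact: measurable_power_weight|exact: power_weight_ge0|
  exact: measurable_power_weight|move=> p].
rewrite !power_weightE; case: ifP => // p1.
by rewrite expr0 exprn_ile1 ?sqr_dist0_ge0 // ltW.
Qed.

(** The integral of [|z|^(2n)] over the unit disk. *)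
Definition mom n : R := fine (moment n 1).

Lemma momE n : moment n 1 = (mom n)%:E.
Proof.
rewrite /mom fineK // ge0_fin_numE; last by apply: integral_ge0 => p _; exact: moment_ge0.
by apply: le_lt_trans (le_trans (moment_le n) moment0_le) (ltry _).
Qed.

Lemma mom_ge0 n : 0 <= mom n.
Proof. by rewrite -lee_fin -momE; apply: integral_ge0 => p _; exact: moment_ge0. Qed.

Lemma mom0_le4 : mom 0 <= 4.
Proof. by rewrite -lee_fin -momE; exact: moment0_le. Qed.

(** Both bounds come from the annulus [s^2 <= |z|^2 < 1], on which
    [|z|^(2n)] lies between [s^(2n)] and 1; the other disk is a dilation of the
    unit disk. *)
Lemma mom_annulus n (s : R) : 0 < s < 1 ->
  mom n + s ^+ 2 * mom 0 <= (s ^+ 2) ^+ n.+1 * mom n + mom 0 /\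
  (s ^+ 2) ^+ n.+1 * mom n + (s ^+ 2) ^+ n * mom 0 <= mom n + (s ^+ 2) ^+ n * (s ^+ 2 * mom 0).
Proof.
move=> /andP[s0 s1]; set x := s ^+ 2.
have x01 : 0 < x < 1 by apply/andP; split; rewrite /x; nra.
have /andP[x0 x1] := x01.
have dil m : moment m x = (x ^+ m.+1 * mom m)%:E by rewrite /x moment_dilation // momE -EFinM.
have mw := measurable_power_weight; have w0 := power_weight_ge0.
have xn0 : 0 <= x ^+ n by rewrite exprn_ge0 // ltW.
have dil0 := dil 0%N; rewrite expr1 in dil0.
split; rewrite -lee_fin !EFinD.
  rewrite -dil0 -dil -!momE !momentE -plane_integralD // -plane_integralD //.
  apply: plane_integral_le; first exact: measurable_funD.
  - by move=> p; rewrite addr_ge0.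
  - exact: measurable_funD.
  move=> p; rewrite !power_weightE !expr0.
  have [px|px] := ltP (sqr_dist0 p) x; first by rewrite (lt_trans px x1).
  by case: ifP => p1; rewrite ?addr0 ?add0r // exprn_ile1 ?sqr_dist0_ge0 // ltW.
rewrite -dil -momE [X in (_ + X <= _)%E]EFinM [X in (_ <= _ + X)%E]EFinM -dil0 -!momE !momentE.
rewrite -!plane_integralZ // -plane_integralD //; last 2 first.
- by apply: measurable_funM.
- by move=> p; rewrite mulr_ge0.
rewrite -plane_integralD //; last 2 first.
- by apply: measurable_funM.
- by move=> p; rewrite mulr_ge0.
apply: plane_integral_le.
- by apply: measurable_funD => //; apply: measurable_funM.
- by move=> p; rewrite addr_ge0 // mulr_ge0.
- by apply: measurable_funD => //; apply: measurable_funM.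
move=> p; rewrite -!/(power_weight _ _ _) !power_weightE !expr0.
have [px|px] := ltP (sqr_dist0 p) x; first by rewrite (lt_trans px x1).
case: ifP => p1; rewrite ?mulr0 ?addr0 ?add0r // mulr1.
by rewrite lerXn2r ?nnegrE ?sqr_dist0_ge0 // ltW.
Qed.

Lemma bernoulli_pow (x : R) n : 0 <= x <= 1 -> 1 - n%:R * (1 - x) <= x ^+ n.
Proof.
move=> /andP[x0 x1]; elim: n => [|n IH]; first by rewrite expr0 mul0r subr0.
rewrite exprS -natr1 mulrDl mul1r.
have := ler_wpM2l x0 IH; have : 0 <= n%:R * (1 - x) :> R by rewrite mulr_ge0 // subr_ge0.
nra.
Qed.

(** Divide the bounds of [mom_annulus] by [1 - s^2] and let [s] tend to 1. *)
Lemma momS n : n.+1%:R * mom n = mom 0.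
Proof.
have geo (x : R) : 1 - x ^+ n.+1 = (1 - x) * \sum_(i < n.+1) x ^+ i.
  by rewrite -opprB subrX1 -mulNr opprB.
have m0 := mom_ge0 n; have m00 := mom_ge0 0.
have bounds (s : R) : 0 < s < 1 -> n.+1%:R * (1 - n%:R * (1 - s ^+ 2)) * mom n <= mom 0 /\
    (1 - n%:R * (1 - s ^+ 2)) * mom 0 <= n.+1%:R * mom n.
  move=> s01; have [lo hi] := mom_annulus n s01.
  set x := s ^+ 2 in lo hi *; have [x0 x1] : 0 < x /\ x < 1.
    by case/andP: s01 => s0 s1; rewrite /x; split; nra.
  have x01 : 0 <= x <= 1 by rewrite !ltW.
  have x10 : 0 < 1 - x by rewrite subr_gt0.
  have Slo : n.+1%:R * (1 - n%:R * (1 - x)) <= \sum_(i < n.+1) x ^+ i.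
    rewrite mulr_natl -[n.+1 in leLHS]card_ord -sumr_const; apply: ler_sum => i _.
    apply: le_trans (bernoulli_pow i x01); rewrite lerD2l lerN2 ler_wpM2r ?(ltW x10) //.
    by rewrite ler_nat -ltnS.
  have Shi : \sum_(i < n.+1) x ^+ i <= n.+1%:R.
    rewrite -[n.+1%:R]mulr_natl -[n.+1 in leRHS]card_ord mulr1 -sumr_const; apply: ler_sum => i _.
    by rewrite exprn_ile1 // ltW.
  have {}lo : (1 - x) * ((\sum_(i < n.+1) x ^+ i) * mom n) <= (1 - x) * mom 0.
    by rewrite mulrA -geo; lra.
  have {}hi : (1 - x) * (x ^+ n * mom 0) <= (1 - x) * ((\sum_(i < n.+1) x ^+ i) * mom n).
    by rewrite [leRHS]mulrA -geo; lra.
  rewrite ler_pM2l // in lo; rewrite ler_pM2l // in hi; split.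
    by apply: le_trans lo; rewrite ler_wpM2r.
  apply: le_trans (le_trans hi _); last by rewrite ler_wpM2r.
  by rewrite ler_wpM2r // bernoulli_pow.
have small (e : R) : 0 < e -> exists s : R, 0 < s < 1 /\ n%:R * (1 - s ^+ 2) <= e.
  move=> e0; pose t := Num.min (1 / 2) (e / (2 * n.+1%:R)).
  have t0 : 0 < t by rewrite lt_min !divr_gt0 // mulr_gt0.
  have [t2 te] : t <= 1 / 2 /\ t <= e / (2 * n.+1%:R) by split; rewrite ge_min lexx ?orbT.
  exists (1 - t); split; first by apply/andP; split; lra.
  have : 2 * n.+1%:R * t <= e by rewrite mulrC -ler_pdivlMr // mulr_gt0.
  have : 0 <= n%:R :> R by [].
  by rewrite -natr1; nra.
apply/eqP; rewrite eq_le; apply/andP; split; apply/ler_addgt0Pr => e e0.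
  have d0 : 0 < e / (n.+1%:R * mom n + 1) by rewrite divr_gt0 // ltr_wpDl // mulr_ge0.
  have [s [s01 se]] := small _ d0; have [lo _] := bounds s s01.
  have : n%:R * (1 - s ^+ 2) * (n.+1%:R * mom n + 1) <= e.
    by rewrite -ler_pdivlMr // ltr_wpDl // mulr_ge0.
  have : 0 <= n%:R * (1 - s ^+ 2).
    by rewrite mulr_ge0 // subr_ge0; case/andP: s01 => *; nra.
  nra.
have d0 : 0 < e / (mom 0 + 1) by rewrite divr_gt0 // ltr_wpDl.
have [s [s01 se]] := small _ d0; have [_ hi] := bounds s s01.
have : n%:R * (1 - s ^+ 2) * (mom 0 + 1) <= e by rewrite -ler_pdivlMr // ltr_wpDl.
have : 0 <= n%:R * (1 - s ^+ 2).
  by rewrite mulr_ge0 // subr_ge0; case/andP: s01 => *; nra.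
nra.
Qed.

(** The Littlewood-Paley weight [1 - |z|^2] of the unit disk. *)
Definition lp_weight (p : R * R) : R := \1_(plane_disk 1) p * (1 - sqr_dist0 p).

Lemma lp_weight_ge0 p : 0 <= lp_weight p.
Proof.
rewrite /lp_weight indicE; case: (boolP (p \in _)); last by rewrite mul0r.
by rewrite inE /plane_disk /= mul1r subr_ge0 => /ltW.
Qed.

Lemma measurable_lp_weight : measurable_fun setT lp_weight.
Proof.
apply: measurable_funM; first exact: measurable_indic (measurable_plane_disk 1).
by apply: measurable_funB => //; exact: measurable_sqr_dist0.
Qed.

Lemma measurable_lp_power n : measurable_fun setT (fun p => lp_weight p * sqr_dist0 p ^+ n).
Proof.
apply: measurable_funM; first exact: measurable_lp_weight.
by apply: measurable_funX; exact: measurable_sqr_dist0.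
Qed.

Lemma lp_power_ge0 n p : 0 <= lp_weight p * sqr_dist0 p ^+ n.
Proof. by rewrite mulr_ge0 ?lp_weight_ge0 // exprn_ge0 // sqr_dist0_ge0. Qed.

Lemma lp_power_integral n :
  plane_integral (fun p => lp_weight p * sqr_dist0 p ^+ n) = (mom n - mom n.+1)%:E.
Proof.
have E : (plane_integral (fun p => lp_weight p * sqr_dist0 p ^+ n)%R + (mom n.+1)%:E =
    (mom n)%:E)%E.
  rewrite -!momE !momentE -plane_integralD //; first last.
  - exact: power_weight_ge0.
  - exact: measurable_power_weight.
  - exact: lp_power_ge0.
  - exact: measurable_lp_power.
  congr plane_integral; apply/funext => p.
  by rewrite /lp_weight /power_weight exprS; ring.
by rewrite EFinB -E addeK.
Qed.

Definition poly_sum N (c : nat -> C) (z : C) : C := \sum_(n < N) c n * z ^+ n.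

Lemma sum_root_orth N (om : C) (n m : 'I_N) : N.-primitive_root om ->
  \sum_(j < N) (om ^+ j) ^+ n * ((om ^+ j) ^+ m)^* = if n == m then N%:R else 0.
Proof.
move=> omN.
wlog nm : n m / (m <= n)%N.
  move=> W; have [mn|/ltnW nm] := leqP m n; first exact: W.
  have := W m n nm; rewrite eq_sym => E.
  have {}E := congr1 Num.conj E; rewrite rmorph_sum in E.
  transitivity ((if n == m then N%:R else 0 : C)^*); last first.
    by case: ifP => _; rewrite ?rmorph_nat ?rmorph0.
  rewrite -E; apply: eq_bigr => j _.
  by rewrite rmorphM /= conjCK mulrC.
have := sum_root_powers omN (n - m); rewrite (_ : (N %| n - m)%N = (n == m)).
  move=> <-; apply: eq_bigr => j _.
  rewrite -{1}(subnK nm) exprD -mulrA mulC_conj !rnormX (rnorm_prim_root omN).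
  by rewrite !expr1n mulr1.
have [->|ne] := eqVneq n m; first by rewrite subnn dvdn0.
rewrite gtnNdvd //; last by apply: leq_ltn_trans (leq_subr _ _) (ltn_ord n).
by rewrite subn_gt0 ltn_neqAle nm andbT eq_sym.
Qed.

Lemma parseval_roots N (c : nat -> C) (om z : C) : N.-primitive_root om ->
  \sum_(j < N) rnorm (poly_sum N c (om ^+ j * z)) ^+ 2 =
  N%:R * \sum_(n < N) rnorm (c n) ^+ 2 * (rnorm z ^+ 2) ^+ n.
Proof.
move=> omN; apply: complexI; rewrite Rc_sum.
transitivity (\sum_(n < N) \sum_(m < N) (c n * z ^+ n) * (c m * z ^+ m)^* *
   (\sum_(j < N) (om ^+ j) ^+ n * ((om ^+ j) ^+ m)^*)).
  under eq_bigr => j _.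
    rewrite -mulC_conj /poly_sum rmorph_sum mulr_suml.
    under eq_bigr => n _ do rewrite mulr_sumr.
    over.
  rewrite exchange_big; apply: eq_bigr => n _; rewrite exchange_big; apply: eq_bigr => m _.
  rewrite mulr_sumr; apply: eq_bigr => j _.
  by rewrite !exprMn !rmorphM /=; ring.
rewrite RcM Rc_nat Rc_sum mulr_sumr; apply: eq_bigr => n _.
rewrite (bigD1 n) //= sum_root_orth // eqxx big1 ?addr0 => [|m nm].
  by rewrite mulC_conj rnormM rnormX mulrC exprMn exprAC.
by rewrite sum_root_orth // eq_sym (negPf nm) mulr0.
Qed.

Lemma measurable_poly_sum N (c : nat -> C) :
  measurable_fun setT (fun p => complex.Re (poly_sum N c (cplx p))) /\
  measurable_fun setT (fun p => complex.Im (poly_sum N c (cplx p))).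
Proof.
have ReM (x y : C) : complex.Re (x * y) =
  complex.Re x * complex.Re y - complex.Im x * complex.Im y by case: x y => [? ?] [? ?].
have ImM (x y : C) : complex.Im (x * y) =
  complex.Re x * complex.Im y + complex.Im x * complex.Re y by case: x y => [? ?] [? ?].
have ImD (x y : C) : complex.Im (x + y) = complex.Im x + complex.Im y.
  by case: x y => [? ?] [? ?].
have mX n : measurable_fun setT (fun p => complex.Re (cplx p ^+ n)) /\
    measurable_fun setT (fun p => complex.Im (cplx p ^+ n)).
  elim: n => [|n [IH1 IH2]]; first by split; exact: measurable_cst.
  by split; under eq_fun do rewrite exprS ?ReM ?ImM /=;
    [apply: measurable_funB|apply: measurable_funD]; apply: measurable_funM.
rewrite /poly_sum; elim: N => [|N [IH1 IH2]].
  by split; under eq_fun do rewrite big_ord0; exact: measurable_cst.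
have [m1 m2] := mX N; split; under eq_fun do rewrite big_ord_recr /= ?ReD ?ImD ?ReM ?ImM;
  apply: measurable_funD => //; [apply: measurable_funB|apply: measurable_funD];
  exact: measurable_funM.
Qed.

Lemma measurable_poly_sum_sqr N (c : nat -> C) :
  measurable_fun setT (fun p => rnorm (poly_sum N c (cplx p)) ^+ 2).
Proof.
have [m1 m2] := measurable_poly_sum N c.
by under eq_fun do rewrite rnorm_sqrE; apply: measurable_funD; exact: measurable_funX.
Qed.

(** Orthogonality of the monomials: the integral does not change when the
    integrand is averaged over the rotations by the [N]-th roots of unity. *)
Lemma lp_poly_integral N (c : nat -> C) : (0 < N)%N ->
  plane_integral (fun p => lp_weight p * rnorm (poly_sum N c (cplx p)) ^+ 2) =
  (\sum_(n < N) rnorm (c n) ^+ 2 * (mom n - mom n.+1))%:E.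
Proof.
move=> N0; have [om omN] := prim_root_exists R[i] N0.
pose f p := lp_weight p * rnorm (poly_sum N c (cplx p)) ^+ 2.
have mf : measurable_fun setT f.
  by apply: measurable_funM; [exact: measurable_lp_weight|exact: measurable_poly_sum_sqr].
have f0 p : 0 <= f p by rewrite mulr_ge0 ?lp_weight_ge0 ?sqr_ge0.
pose rot (w : C) (p : R * R) := (complex.Re w * p.1 - complex.Im w * p.2,
   complex.Im w * p.1 + complex.Re w * p.2).
have rotE w p : cplx (rot w p) = w * cplx p 
  by case: w => x y; case: p => u v; rewrite /cplx /rot /= [y * u + _]addrC.
have mrot w : measurable_fun setT (fun p => f (rot w p)).
  apply: measurableT_comp => //.
  have := measurable_linear (complex.Re w) (- complex.Im w) (complex.Im w) (complex.Re w).
  by under eq_fun do rewrite mulNr.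
have rot_inv w : rnorm w = 1 -> plane_integral (fun p => f (rot w p)) = plane_integral f.
  move=> w1; have cs : complex.Re w ^+ 2 + complex.Im w ^+ 2 = 1.
    by rewrite -rnorm_sqrE w1 expr1n.
  apply: (@integral_rotation _ (EFin \o f)) => //.
  exact/measurable_EFinP.
pose g (j : 'I_N) (p : R * R) := f (rot (om ^+ j) p).
have mg j : measurable_fun setT (g j) by exact: mrot.
have g0 j p : 0 <= g j p by exact: f0.
have sumE : (N%:R%:E * plane_integral f = plane_integral (fun p => \sum_(j < N) f (rot (om ^+ j) p))%R)%E.
  rewrite (plane_integral_sum mg g0) (eq_bigr (fun=> plane_integral f)) => [|j _].
    by rewrite sumr_const card_ord mule_natl.
  by apply: rot_inv; rewrite (rnorm_root_exp omN).
have avg : (fun p => \sum_(j < N) f (rot (om ^+ j) p)) =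
    (fun p => N%:R * \sum_(n < N) rnorm (c n) ^+ 2 * (lp_weight p * sqr_dist0 p ^+ n)).
  apply/funext => p; rewrite /f.
  have wrot j : lp_weight (rot (om ^+ j) p) = lp_weight p.
    have E : sqr_dist0 (rot (om ^+ j) p) = sqr_dist0 p.
      by rewrite -!rnorm_cplx rotE rnormM (rnorm_root_exp omN) mul1r.
    rewrite /lp_weight E !indicE; congr (_ %:R * _); congr nat_of_bool.
    by apply/idP/idP; rewrite !inE /plane_disk /= E.
  under eq_bigr do rewrite wrot rotE.
  rewrite -mulr_sumr parseval_roots // rnorm_cplx mulrCA mulr_sumr; congr (_ * _).
  by apply: eq_bigr => n _; ring.
have term0 n p : 0 <= rnorm (c n) ^+ 2 * (lp_weight p * sqr_dist0 p ^+ n).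
  by rewrite mulr_ge0 ?sqr_ge0 // lp_power_ge0.
have mterm n : measurable_fun setT (fun p => rnorm (c n) ^+ 2 * (lp_weight p * sqr_dist0 p ^+ n)).
  by apply: measurable_funM => //; exact: measurable_lp_power.
have msum : measurable_fun setT (fun p => \sum_(n < N) rnorm (c n) ^+ 2 * (lp_weight p * sqr_dist0 p ^+ n)).
  by apply: measurable_sum => n; exact: mterm.
rewrite avg plane_integralZ // in sumE; last by move=> p; apply: sumr_ge0.
have NE : N%:R != 0 :> R by rewrite pnatr_eq0 -lt0n.
have {sumE avg} -> : plane_integral f =
    plane_integral (fun p => \sum_(n < N) rnorm (c n) ^+ 2 * (lp_weight p * sqr_dist0 p ^+ n)).
  have := congr1 (fun t => (N%:R^-1)%:E * t)%E sumE.
  by rewrite !muleA -!EFinM mulVf // !mul1e.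
rewrite plane_integral_sum //.
rewrite -sumEFin; apply: eq_bigr => n _; rewrite plane_integralZ //.
- by rewrite lp_power_integral.
- exact: measurable_lp_power.
- exact: lp_power_ge0.
- exact: sqr_ge0.
Qed.

End DiskMoments.

(** * Termwise differentiation of power series *)

Section PowerSeries.
Variable R : realType.
Local Notation C := R[i].
Implicit Types (a : nat -> C) (z h : C).

Definition deriv_coef a n : C := n.+1%:R * a n.+1.

Definition taylor_rem n z h : C := (z + h) ^+ n - z ^+ n - n%:R * h * z ^+ n.-1.

Lemma taylor_remS n z h :
  taylor_rem n.+2 z h = (z + h) * taylor_rem n.+1 z h + n.+1%:R * h ^+ 2 * z ^+ n.
Proof. by rewrite /taylor_rem /= !exprS -(natr1 n.+1); ring. Qed.

Lemma taylor_rem_le n z h (r : R) : rnorm z + rnorm h <= r ->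
  rnorm (taylor_rem n.+2 z h) <= n.+2%:R * n.+1%:R * rnorm h ^+ 2 * r ^+ n.
Proof.
move=> zhr; have z0 := rnorm_ge0 z; have h0 := rnorm_ge0 h.
have r0 : 0 <= r by lra.
have zr : rnorm z <= r by lra.
have rN k : rnorm (k%:R : C) = k%:R by rewrite -Rc_nat rnorm_real ger0_norm.
have zn k : rnorm (z ^+ k) <= r ^+ k by rewrite rnormX lerXn2r ?nnegrE.
have zh : rnorm (z + h) <= r by apply: le_trans (rnormD _ _) zhr.
elim: n => [|n IH].
  rewrite taylor_remS (_ : taylor_rem 1 z h = 0); last by rewrite /taylor_rem /=; ring.
  rewrite mulr0 add0r expr0 mulr1 mul1r rnormX !mulr1.
  by rewrite ler_peMl ?sqr_ge0 // ler1n.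
rewrite taylor_remS; apply: le_trans (rnormD _ _) _.
have le1 : rnorm ((z + h) * taylor_rem n.+2 z h) <=
    r * (n.+2%:R * n.+1%:R * rnorm h ^+ 2 * r ^+ n).
  by rewrite rnormM ler_pM ?rnorm_ge0.
have le2 : rnorm (n.+2%:R * h ^+ 2 * z ^+ n.+1) <= n.+2%:R * rnorm h ^+ 2 * r ^+ n.+1.
  rewrite (rnormM (n.+2%:R * h ^+ 2)) (rnormM n.+2%:R) rN (rnormX h).
  by apply: ler_wpM2l => //; rewrite mulr_ge0 // sqr_ge0.
apply: le_trans (lerD le1 le2) _.
have -> : r * (n.+2%:R * n.+1%:R * rnorm h ^+ 2 * r ^+ n) + n.+2%:R * rnorm h ^+ 2 * r ^+ n.+1
    = n.+2%:R * n.+2%:R * rnorm h ^+ 2 * r ^+ n.+1.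
  by rewrite (exprS r n) -(natr1 n.+1); move: (n.+1%:R : R) (r ^+ n) => x y; ring.
rewrite !ler_wpM2r ?exprn_ge0 ?sqr_ge0 //.
by rewrite ler_nat.
Qed.

Lemma sum_sqr_geometric (r : R) N : 0 <= r < 1 ->
  (1 - r) ^+ 3 * (\sum_(n < N) n.+2%:R * n.+1%:R * r ^+ n) <= 2.
Proof.
move=> /andP[r0 r1]; have s0 : 0 < 1 - r by rewrite subr_gt0.
have V : (1 - r) * (\sum_(n < N) r ^+ n) <= 1.
  by rewrite -opprB mulNr -subrX1 opprB gerBl exprn_ge0.
have U : (1 - r) * (\sum_(n < N) n.+1%:R * r ^+ n) <= \sum_(n < N) r ^+ n.
  have : (1 - r) * (\sum_(n < N) n.+1%:R * r ^+ n) + N%:R * r ^+ N = \sum_(n < N) r ^+ n.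
    elim: N {V} => [|N IH]; first by rewrite !big_ord0 mulr0 mul0r addr0.
    by rewrite !big_ord_recr /= -IH exprS -(natr1 N); ring.
  move=> <-; rewrite lerDl mulr_ge0 // exprn_ge0 //.
have T : (1 - r) * (\sum_(n < N) n.+2%:R * n.+1%:R * r ^+ n) <=
    2 * \sum_(n < N) n.+1%:R * r ^+ n.
  have : (1 - r) * (\sum_(n < N) n.+2%:R * n.+1%:R * r ^+ n) + N.+1%:R * N%:R * r ^+ N =
      2 * \sum_(n < N) n.+1%:R * r ^+ n.
    elim: N {V U} => [|N IH]; first by rewrite !big_ord0 !mulr0 mul0r addr0.
    rewrite !big_ord_recr /= [in RHS]mulrDr -IH exprS -(natr1 N.+1) -(natr1 N); ring.
  by move=> <-; rewrite lerDl mulr_ge0 ?mulr_ge0 // exprn_ge0.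
have T' := ler_wpM2l (sqr_ge0 (1 - r)) T.
have U' := ler_wpM2l (ltW s0) U.
have -> : (1 - r) ^+ 3 * (\sum_(n < N) n.+2%:R * n.+1%:R * r ^+ n) =
  (1 - r) ^+ 2 * ((1 - r) * (\sum_(n < N) n.+2%:R * n.+1%:R * r ^+ n)) by rewrite exprSr mulrA.
apply: le_trans T' _; rewrite mulrCA expr2 -mulrA.
by move: U' V; lra.
Qed.

(** The bound does not depend on [N]; it alone yields the convergence of the
    derived series and the differentiability of the sum. *)
Lemma poly_sum_taylor a (S : R) N z h (r : R) : (forall n, rnorm (a n) <= S) ->
  rnorm z + rnorm h <= r -> r < 1 ->
  rnorm (poly_sum N.+2 a (z + h) - poly_sum N.+2 a z - h * poly_sum N.+1 (deriv_coef a) z) <=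
  2 * S / (1 - r) ^+ 3 * rnorm h ^+ 2.
Proof.
move=> aS zhr r1; have z0 := rnorm_ge0 z; have h0 := rnorm_ge0 h.
have r0 : 0 <= r by lra.
have r01 : 0 <= r < 1 by rewrite r0.
have S0 : 0 <= S by apply: le_trans (aS 0%N); exact: rnorm_ge0.
have -> : poly_sum N.+2 a (z + h) - poly_sum N.+2 a z - h * poly_sum N.+1 (deriv_coef a) z =
    \sum_(n < N) a n.+2 * taylor_rem n.+2 z h.
  rewrite /poly_sum !(big_ord_recl N.+1) !(big_ord_recl N) /= /deriv_coef /taylor_rem /bump /=.
  rewrite !expr0 !add1n !expr1 !mulr1.
  transitivity (\sum_(i < N) a i.+2 * (z + h) ^+ i.+2 - \sum_(i < N) a i.+2 * z ^+ i.+2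
      - h * \sum_(i < N) i.+2%:R * a i.+2 * z ^+ i.+1).
    ring.
  rewrite mulr_sumr -!sumrB; apply: eq_bigr => n _; ring.
apply: le_trans (rnorm_sum _ _ _) _.
apply: (@le_trans _ _ (S * rnorm h ^+ 2 * \sum_(n < N) n.+2%:R * n.+1%:R * r ^+ n)).
  rewrite mulr_sumr; apply: ler_sum => n _; rewrite rnormM.
  apply: le_trans (ler_pM (rnorm_ge0 _) (rnorm_ge0 _) (aS _) (taylor_rem_le n zhr)) _.
  by rewrite le_eqVlt; apply/orP; left; apply/eqP; ring.
have s3 : 0 < (1 - r) ^+ 3 by rewrite exprn_gt0 // subr_gt0.
rewrite [leRHS]mulrAC ler_pdivlMr //.
have := ler_wpM2l (mulr_ge0 S0 (sqr_ge0 (rnorm h))) (sum_sqr_geometric N r01).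
lra.
Qed.

Definition cvg_to (s : nat -> C) (l : C) := forall e : R, 0 < e ->
  exists N0, forall N, (N0 <= N)%N -> rnorm (s N - l) <= e.

Lemma cauchy_complex (s : nat -> C) :
  (forall e : R, 0 < e -> exists N0, forall N M, (N0 <= N)%N -> (N0 <= M)%N ->
    rnorm (s N - s M) <= e) -> exists l, cvg_to s l.
Proof.
move=> Cs.
have real_cvg (g : C -> R) : (forall x y, `|g x - g y| <= rnorm (x - y)) ->
    exists l : R, forall e : R, 0 < e -> exists N0, forall N, (N0 <= N)%N -> `|g (s N) - l| <= e.
  move=> gle; have /cauchy_cvg cvg_g : cauchy ((g \o s) @ \oo).
    apply: cauchy_exP => e e0; have e2 : 0 < e / 2 by rewrite divr_gt0.
    have [N0 HN] := Cs _ e2; exists (g (s N0)); exists N0 => // n /= Nn.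
    rewrite -ball_normE /=; apply: le_lt_trans (gle _ _) _.
    by apply: le_lt_trans (HN _ _ (leqnn _) Nn) _; lra.
  exists (lim (g \o s @ \oo)) => e e0.
  have /cvgrPdist_le/(_ _ e0)[N0 _ HN] := cvg_g.
  by exists N0 => N /HN; rewrite distrC.
have ReP (x y : C) : `|complex.Re x - complex.Re y| <= rnorm (x - y).
  by rewrite -ReB; case: (ReIm_le_rnorm (x - y)).
have ImP (x y : C) : `|complex.Im x - complex.Im y| <= rnorm (x - y).
  have -> : complex.Im x - complex.Im y = complex.Im (x - y) by case: x y => [? ?] [? ?].
  by case: (ReIm_le_rnorm (x - y)).
have [[lr Hr] [li Hi]] := (real_cvg _ ReP, real_cvg _ ImP).
exists (Complex lr li) => e e0; have e2 : 0 < e / 2 by rewrite divr_gt0.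
have [[N1 H1] [N2 H2]] := (Hr _ e2, Hi _ e2).
exists (maxn N1 N2) => N; rewrite geq_max => /andP[/H1 le1 /H2 le2].
apply: le_trans (rnorm_le_ReIm _) _.
have -> : complex.Re (s N - Complex lr li) = complex.Re (s N) - lr by case: (s N).
have -> : complex.Im (s N - Complex lr li) = complex.Im (s N) - li by case: (s N).
lra.
Qed.

Section Derivative.
Variables (a : nat -> C) (S : R) (f : C -> C).
Hypothesis aS : forall n, rnorm (a n) <= S.
Hypothesis f_series : forall z, rnorm z < 1 -> cvg_to (fun N => poly_sum N a z) (f z).

Lemma S_ge0 : 0 <= S. Proof. by apply: le_trans (aS 0%N); exact: rnorm_ge0. Qed.

(** Difference quotients of the partial sums at a fixed small step converge,
    and they are uniformly close to the partial sums of the derived series. *)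
Lemma deriv_series_cauchy z : rnorm z < 1 ->
  exists l, cvg_to (fun N => poly_sum N.+1 (deriv_coef a) z) l.
Proof.
move=> z1; apply: cauchy_complex => e e0.
pose r := (1 + rnorm z) / 2; have z0 := rnorm_ge0 z.
have [zr r1] : rnorm z < r /\ r < 1 by rewrite /r; split; lra.
pose Q := 2 * S / (1 - r) ^+ 3.
have Q0 : 0 <= Q.
  by rewrite divr_ge0 ?exprn_ge0 ?subr_ge0 ?(ltW r1) // mulr_ge0 // S_ge0.
pose t := Num.min (r - rnorm z) (e / (4 * (Q + 1))).
have Q10 : 0 < 4 * (Q + 1) by rewrite mulr_gt0 // ltr_wpDl.
have t0 : 0 < t by rewrite lt_min subr_gt0 zr divr_gt0.
have [tr te] : t <= r - rnorm z /\ t <= e / (4 * (Q + 1)).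
  by split; rewrite ge_min lexx ?orbT.
have {}te : t * (4 * (Q + 1)) <= e by rewrite -ler_pdivlMr.
pose h : C := t%:C%C.
have hn : rnorm h = t by rewrite rnorm_real gtr0_norm.
have zhr : rnorm z + rnorm h <= r by rewrite hn; lra.
have zh1 : rnorm (z + h) < 1 by apply: le_lt_trans (rnormD _ _) _; lra.
have d0 : 0 < e * t / 8 by rewrite divr_gt0 // mulr_gt0.
have [[N1 H1] [N2 H2]] := (f_series z1 d0, f_series zh1 d0).
exists (maxn N1 N2) => N M; rewrite !geq_max => /andP[N1N N2N] /andP[N1M N2M].
have up n k : (n <= k)%N -> (n <= k.+2)%N by move=> nk; rewrite ltnW // ltnW // ltnS.
have le1 := poly_sum_taylor N aS zhr r1; have le2 := poly_sum_taylor M aS zhr r1.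
have le3 := H1 _ (up _ _ N1N); have le4 := H1 _ (up _ _ N1M).
have le5 := H2 _ (up _ _ N2N); have le6 := H2 _ (up _ _ N2M).
move: le1 le2 le3 le4 le5 le6; rewrite -/Q hn.
set A := poly_sum N.+2 a z; set A' := poly_sum N.+2 a (z + h).
set B := poly_sum M.+2 a z; set B' := poly_sum M.+2 a (z + h).
set D := poly_sum N.+1 _ z; set D' := poly_sum M.+1 _ z => le1 le2 le3 le4 le5 le6.
have E : h * (D - D') = (B' - B - h * D') - (A' - A - h * D) +
    ((A' - f (z + h)) - (B' - f (z + h))) - ((A - f z) - (B - f z)) by ring.
have : t * rnorm (D - D') <= 2 * Q * t ^+ 2 + e * t / 2.
  rewrite -hn -rnormM E hn.
  have := rnormB (B' - B - h * D' - (A' - A - h * D) +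
    ((A' - f (z + h)) - (B' - f (z + h)))) ((A - f z) - (B - f z)).
  have := rnormD (B' - B - h * D' - (A' - A - h * D)) ((A' - f (z + h)) - (B' - f (z + h))).
  have := rnormB (B' - B - h * D') (A' - A - h * D).
  have := rnormB (A' - f (z + h)) (B' - f (z + h)).
  have := rnormB (A - f z) (B - f z).
  lra.
have -> : 2 * Q * t ^+ 2 + e * t / 2 = t * (2 * Q * t + e / 2) by ring.
rewrite ler_pM2l // => /le_trans; apply; nra.
Qed.

(** Near the boundary only a Lipschitz bound will be known for [f]; the last
    clause passes it to the derivative. *)
Lemma power_series_derivative z : rnorm z < 1 -> exists l : C,
  [/\ cvg_to (fun N => poly_sum N.+1 (deriv_coef a) z) l,
    derivable f z 1, derive1 f z = l &
    forall (A d : R), 0 < d -> (forall w, rnorm w < 1 -> rnorm (w - z) < d ->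
      rnorm (f w - f z) <= A * rnorm (w - z)) -> rnorm l <= A].
Proof.
move=> z1; have [l Hl] := deriv_series_cauchy z1; exists l.
pose r := (1 + rnorm z) / 2; have z0 := rnorm_ge0 z.
have [zr r1] : rnorm z < r /\ r < 1 by rewrite /r; split; lra.
pose Q := 2 * S / (1 - r) ^+ 3.
have Q0 : 0 <= Q.
  by rewrite divr_ge0 ?exprn_ge0 ?subr_ge0 ?(ltW r1) // mulr_ge0 // S_ge0.
have taylor h : rnorm z + rnorm h <= r -> rnorm (f (z + h) - f z - h * l) <= Q * rnorm h ^+ 2.
  move=> zhr; apply/ler_addgt0Pr => e e0.
  have h0 := rnorm_ge0 h; have zh1 : rnorm (z + h) < 1.
    by apply: le_lt_trans (rnormD _ _) _; lra.
  have d0 : 0 < e / 3 by rewrite divr_gt0.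
  have h1 : 0 < rnorm h + 1 by lra.
  have [[N1 H1] [N2 H2]] := (f_series z1 d0, f_series zh1 d0).
  have [N3 H3] := Hl _ (divr_gt0 d0 h1).
  pose N := maxn N1 (maxn N2 N3).
  have [N1N N2N N3N] : [/\ N1 <= N, N2 <= N & N3 <= N]%N by rewrite /N !leq_max !leqnn !orbT.
  have up n k : (n <= k)%N -> (n <= k.+2)%N by move=> nk; rewrite ltnW // ltnW // ltnS.
  have le1 := poly_sum_taylor N aS zhr r1.
  have le2 := H1 _ (up _ _ N1N); have le3 := H2 _ (up _ _ N2N); have le4 := H3 _ N3N.
  move: le1 le2 le3 le4; rewrite -/Q.
  set A := poly_sum N.+2 a z; set A' := poly_sum N.+2 a (z + h).
  set D := poly_sum N.+1 _ z => le1 le2 le3 le4.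
  have -> : f (z + h) - f z - h * l = (A' - A - h * D) - (A' - f (z + h)) + (A - f z) + h * (D - l).
    by ring.
  have le5 : rnorm (h * (D - l)) <= e / 3.
    rewrite rnormM; apply: (@le_trans _ _ (rnorm h * (e / 3 / (rnorm h + 1)))).
      by rewrite ler_wpM2l.
    by rewrite mulrCA ler_piMr ?(ltW d0) // ler_pdivrMr // mul1r lerDl.
  have := rnormD ((A' - A - h * D) - (A' - f (z + h)) + (A - f z)) (h * (D - l)).
  have := rnormD ((A' - A - h * D) - (A' - f (z + h))) (A - f z).
  have := rnormB (A' - A - h * D) (A' - f (z + h)).
  lra.
have quot h : h != 0 -> rnorm z + rnorm h <= r -> rnorm (l - h^-1 * (f (z + h) - f z)) <= Q * rnorm h.
  move=> h0 zhr; have nh : 0 < rnorm h.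
    by rewrite lt_neqAle rnorm_ge0 andbT eq_sym; apply: contra_neq h0; exact: rnorm0_eq0.
  rewrite -(ler_pM2l nh) -rnormM mulrBr mulrA divff // mul1r rdistC.
  by apply: le_trans (taylor _ zhr) _; rewrite expr2 mulrCA.
have cvg_l : h^-1 *: (f (h *: 1 + z) - f z) @[h --> 0^'] --> l.
  apply/cvgrPdist_le => e e0.
  have eE : e = (complex.Re e)%:C%C by rewrite RRe_real // gtr0_real.
  have {}e0 : 0 < complex.Re e by rewrite -ltcR -eE.
  pose t := Num.min (r - rnorm z) (complex.Re e / (Q + 1)).
  have Q10 : 0 < Q + 1 by rewrite ltr_wpDl.
  have t0 : 0 < t by rewrite lt_min subr_gt0 zr divr_gt0.
  have [tr te] : t <= r - rnorm z /\ t <= complex.Re e / (Q + 1).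
    by split; rewrite ge_min lexx ?orbT.
  have tC0 : 0 < t%:C%C :> C by rewrite ltcR.
  near=> h.
  have h0 : h != 0 by near: h; exact: nbhs_dnbhs_neq.
  have ht : rnorm h <= t.
    have : `|h| < t%:C%C by near: h; exact: dnbhs0_lt.
    by rewrite norm_rnorm ltcR => /ltW.
  rewrite norm_rnorm eE lecR.
  rewrite -[h *: 1]/(h * 1) mulr1 [h + z]addrC.
  apply: le_trans (quot _ h0 _) _; first by lra.
  apply: (@le_trans _ _ (Q * (complex.Re e / (Q + 1)))); first by rewrite ler_wpM2l // (le_trans ht).
  by rewrite mulrCA ler_piMr ?(ltW e0) // ler_pdivrMr // mul1r lerDl.
split; first exact: Hl.
- by apply/cvg_ex; exists l.
- by rewrite derive1E; apply/cvg_lim.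
move=> A d d0 fA; apply/ler_addgt0Pr => e e0.
pose t := Num.min (r - rnorm z) (Num.min (d / 2) (e / (Q + 1))).
have Q10 : 0 < Q + 1 by rewrite ltr_wpDl.
have t0 : 0 < t by rewrite !lt_min subr_gt0 zr !divr_gt0.
have [tr td te] : [/\ t <= r - rnorm z, t <= d / 2 & t <= e / (Q + 1)].
  by rewrite /t !ge_min !lexx !orbT.
pose h : C := t%:C%C.
have hn : rnorm h = t by rewrite rnorm_real gtr0_norm.
have h0 : h != 0 by apply/eqP => h0; move: t0; rewrite -hn h0 rnorm0 ltxx.
have zhr : rnorm z + rnorm h <= r by rewrite hn; lra.
have zh1 : rnorm (z + h) < 1 by apply: le_lt_trans (rnormD _ _) _; lra.
have zhz : z + h - z = h by rewrite addrAC subrr add0r.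
have := fA _ zh1; rewrite zhz hn => le1.
have {}le1 : rnorm (f (z + h) - f z) <= A * t by apply: le1; lra.
have le2 : rnorm (h^-1 * (f (z + h) - f z)) <= A.
  by rewrite rnormM rnormV hn mulrC ler_pdivrMr.
have := rnorm_ge_sub l (h^-1 * (f (z + h) - f z)); have := quot _ h0 zhr; rewrite hn.
have : (Q + 1) * t <= e by rewrite mulrC -ler_pdivlMr.
nra.
Unshelve. all: by end_near.
Qed.

End Derivative.

End PowerSeries.

(** * Parseval's identity on the circle *)

Section CircleIntegral.
Variable R : realType.
Local Notation C := R[i].
Local Notation mu := (@lebesgue_measure R).

Lemma expi_pow (t : R) n : expi t ^+ n = expi (n%:R * t).
Proof.
elim: n => [|n IH]; first by rewrite mul0r /expi cos0 sin0.
rewrite exprS IH -natr1 mulrDl mul1r addrC /expi cosD sinD /=.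
by congr Complex; rewrite addrC mulrC.
Qed.

Lemma expi_conj (t : R) : (expi t)^* = expi (- t).
Proof. by rewrite /expi conjC_Complex cosN sinN. Qed.

Lemma rnorm_expi (t : R) : rnorm (expi t) = 1.
Proof.
apply/eqP; rewrite -(@pexpr_eq1 _ _ 2) ?rnorm_ge0 // rnorm_sqrE /=.
by rewrite cos2Dsin2.
Qed.

Lemma expi_orth (t : R) n m : expi t ^+ n * (expi t ^+ m)^* = expi ((n%:R - m%:R) * t).
Proof.
rewrite expi_pow (expi_pow t m) expi_conj mulrBl /expi cosD sinD /= !cosN !sinN.
by congr Complex; rewrite addrC.
Qed.

(** A primitive of [Re (w e^(i k t))]; it is periodic for nonzero integers
    [k], and [k = 0] gives the diagonal terms of Parseval's identity. *)
Definition circle_prim (w : C) (k : R) (t : R) : R :=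
  if k == 0 then complex.Re w * t
  else (complex.Re w * sin (k * t) + complex.Im w * cos (k * t)) / k.

Lemma is_derive_scale (k t : R) : is_derive t 1 ( *%R k) k.
Proof.
have -> : *%R k = k \*: (id : R -> R) by apply/funext => x.
apply: is_derive_eq.
by rewrite /GRing.scale /= mulr1.
Qed.

Lemma is_derive_circle_prim (w : C) (k t : R) :
  is_derive t 1 (circle_prim w k) (complex.Re (w * expi (k * t))).
Proof.
have -> : complex.Re (w * expi (k * t)) =
    complex.Re w * cos (k * t) - complex.Im w * sin (k * t) by case: w => x y.
have [->|k0] := eqVneq k 0.
  rewrite (_ : circle_prim w 0 = *%R (complex.Re w)); last first.
    by apply/funext => x; rewrite /circle_prim eqxx.
  by rewrite mul0r cos0 sin0 mulr1 mulr0 subr0; exact: is_derive_scale.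
rewrite (_ : circle_prim w k = (complex.Re w / k) \*: (sin \o ( *%R k)) +
    (complex.Im w / k) \*: (cos \o ( *%R k))); last first.
  apply/funext => x; rewrite /circle_prim (negbTE k0) /GRing.scale /= fctE /= .
  by rewrite mulrDl; congr (_ + _); rewrite mulrAC.
have ds := is_derive1_comp (is_derive_sin (k * t)) (is_derive_scale k t).
have dc := is_derive1_comp (is_derive_cos (k * t)) (is_derive_scale k t).
apply: is_derive_eq; rewrite /GRing.scale /=.
by move: (cos _) (sin _) => c s; field.
Qed.

Lemma circle_prim_period (w : C) n m :
  circle_prim w (n%:R - m%:R) (2 * pi) - circle_prim w (n%:R - m%:R) 0 =
  if n == m then 2 * pi * complex.Re w else 0.
Proof.
rewrite /circle_prim subr_eq0 eqr_nat; case: ifP => _; first by ring.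
have E : expi ((n%:R - m%:R) * (2 * pi)) = 1 :> C.
  rewrite -expi_orth (_ : expi (2 * pi) = 1 :> C) ?expr1n ?conjC1 ?mulr1 //.
  by rewrite mulr_natl /expi cos2pi sin2pi.
case: E => -> ->.
by rewrite !mulr0 sin0 cos0 mulr0 subrr.
Qed.

Lemma circle_sqr_expand N (c : nat -> C) t : rnorm (poly_sum N c (expi t)) ^+ 2 =
  \sum_(n < N) \sum_(m < N) complex.Re (c n * (c m)^* * expi ((n%:R - m%:R) * t)).
Proof.
have -> : rnorm (poly_sum N c (expi t)) ^+ 2 =
    complex.Re (poly_sum N c (expi t) * (poly_sum N c (expi t))^*) by rewrite mulC_conj.
rewrite /poly_sum rmorph_sum mulr_suml Re_sum; apply: eq_bigr => n _.
rewrite mulr_sumr Re_sum; apply: eq_bigr => m _; congr complex.Re.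
by rewrite -expi_orth rmorphM; ring.
Qed.

Lemma continuous_of_derive (F g : R -> R) :
  (forall t : R, is_derive t 1 F (g t)) -> continuous F.
Proof.
by move=> dF t; apply: differentiable_continuous; apply/derivable1_diffP; case: (dF t).
Qed.

Lemma continuous_circle_sqr N (c : nat -> C) :
  continuous (fun t : R => rnorm (poly_sum N c (expi t)) ^+ 2).
Proof.
have -> : (fun t : R => rnorm (poly_sum N c (expi t)) ^+ 2) =
  \sum_(n < N) \sum_(m < N) (fun t => complex.Re (c n * (c m)^* * expi ((n%:R - m%:R) * t))).
  apply/funext => t; rewrite circle_sqr_expand fct_sumE; apply: eq_bigr => n _.
  by rewrite fct_sumE.
have cterm (w : C) k : continuous (fun t : R => complex.Re (w * expi (k * t))).
  have -> : (fun t : R => complex.Re (w * expi (k * t))) =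
      complex.Re w \*: (cos \o ( *%R k)) - complex.Im w \*: (sin \o ( *%R k)).
    by apply/funext => t; rewrite !fctE /=; case: w.
  apply: (@continuous_of_derive _ (fun t => complex.Re w * (- sin (k * t) * k) -
    complex.Im w * (cos (k * t) * k))) => t.
  have ds := is_derive1_comp (is_derive_sin (k * t)) (is_derive_scale k t).
  have dc := is_derive1_comp (is_derive_cos (k * t)) (is_derive_scale k t).
  by apply: is_derive_eq.
have csum (h : 'I_N -> R -> R) : (forall i, continuous (h i)) -> continuous (\sum_i h i).
  move=> ch t; apply: (big_ind (fun f : R -> R => {for t, continuous f})).
  - exact: cst_continuous.
  - by move=> f g cf cg; exact: continuousD.
  - by move=> i _; exact: ch.
by apply: (csum) => n; apply: (csum) => m; exact: cterm.
Qed.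

Lemma circle_poly_integral N (c : nat -> C) :
  (\int[mu]_(t in `[0%R, (2 * pi)%R]) (rnorm (poly_sum N c (expi t)) ^+ 2)%:E =
   (2 * pi * \sum_(n < N) rnorm (c n) ^+ 2)%:E)%E.
Proof.
pose F : R -> R := \sum_(n < N) \sum_(m < N) circle_prim (c n * (c m)^*) (n%:R - m%:R).
have dF (t : R) : is_derive t 1 F (rnorm (poly_sum N c (expi t)) ^+ 2).
  rewrite circle_sqr_expand /F; apply: is_derive_sum => n; apply: is_derive_sum => m.
  exact: is_derive_circle_prim.
have cF := continuous_of_derive dF.
have pi20 : 0 < 2 * pi :> R by rewrite mulr_gt0 // pi_gt0.
rewrite (@continuous_FTC2 _ _ F) //.
- rewrite -EFinB; congr EFin; rewrite /F !fct_sumE -sumrB mulr_sumr.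
  apply: eq_bigr => n _; rewrite !fct_sumE -sumrB.
  rewrite (bigD1 n) //= circle_prim_period eqxx big1 ?addr0.
    by rewrite mulC_conj.
  by move=> m mn; rewrite circle_prim_period eq_sym val_eqE (negbTE mn).
- exact: continuous_subspaceT (@continuous_circle_sqr N c).
- split; first by move=> t _; case: (dF t).
    by apply: cvg_at_right_filter; exact: cF.
  by apply: cvg_at_left_filter; exact: cF.
- by move=> t _; rewrite derive1E; case: (dF t).
Qed.

End CircleIntegral.

(** * Power series with square-summable coefficients *)

Section Limits.
Variable R : realType.
Local Notation C := R[i].
Local Notation mu := (@lebesgue_measure R).

Lemma fatou_bound d (T : measurableType d) (m : {measure set T -> \bar R})
    (D : set T) (g : nat -> T -> R) (f : T -> R) (K : \bar R) : measurable D ->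
  (forall n, measurable_fun D (g n)) -> (forall n x, D x -> 0 <= g n x) ->
  (forall x, D x -> g ^~ x @ \oo --> f x) ->
  (forall n, \int[m]_(x in D) (g n x)%:E <= K)%E ->
  (\int[m]_(x in D) (f x)%:E <= K)%E.
Proof.
move=> mD mg g0 gf gK.
have mg' n : measurable_fun D (EFin \o g n) by exact/measurable_EFinP.
have g0' n x : D x -> (0 <= (EFin \o g n) x)%E by move=> Dx; rewrite lee_fin g0.
have := fatou m mD mg' g0'.
have -> : (\int[m]_(x in D) limn_einf ((fun n => EFin \o g n) ^~ x))%E =
    (\int[m]_(x in D) (f x)%:E)%E.
  apply: eq_integral => x; rewrite inE => Dx.
  have /cvg_limn_einf_sup[-> _] // : (fun n => (g n x)%:E) @ \oo --> (f x)%:E.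
  by apply: cvg_EFin; [exact: nearW|exact: gf].
move/le_trans; apply; rewrite limn_einf_lim; apply: lime_le; first exact: is_cvg_einfs.
apply: nearW => n; apply: le_trans (gK n); apply: ereal_inf_lbound => /=.
by exists n => //=.
Qed.

Lemma cvg_to_sqr (s : nat -> C) l : cvg_to s l -> (fun n => rnorm (s n) ^+ 2) @ \oo --> rnorm l ^+ 2.
Proof.
move=> sl; have cs : (fun n => rnorm (s n)) @ \oo --> rnorm l.
  apply/cvgrPdist_le => e e0; have [N0 HN] := sl _ e0; exists N0 => // n /= /HN.
  apply: le_trans; rewrite ler_norml rdistC; apply/andP; split.
    by have := rnorm_ge_sub (s n) l; rewrite (rdistC l); lra.
  by have := rnorm_ge_sub l (s n); lra.
by under eq_fun do rewrite expr2; rewrite expr2; exact: cvgM.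
Qed.

Section PowerSeriesNorms.
Variables (a : nat -> C) (A : R).
Hypothesis aA : forall N, \sum_(n < N) rnorm (a n) ^+ 2 <= A.

(** The partial sums obey the bound on each circle by Parseval's identity, and
    Fatou's lemma passes it to the limit. *)
Lemma H2_norm_le (f : C -> C) :
  (forall z, rnorm z < 1 -> cvg_to (fun N => poly_sum N a z) (f z)) ->
  (H2_norm_sqr f <= A%:E)%E.
Proof.
move=> f_series; apply: ge_ereal_sup => _ [r rI <-].
move: rI; rewrite /= in_itv /= => /andP[r0 r1].
have pi20 : 0 < 2 * pi :> R by rewrite mulr_gt0 // pi_gt0.
have rn : rnorm (real_complex R r) = r by rewrite rnorm_real ger0_norm.
have z1 (t : R) : rnorm (real_complex R r * expi t) < 1 by rewrite rnormM rnorm_expi mulr1 rn.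
have psE N (t : R) : poly_sum N a (real_complex R r * expi t) =
    poly_sum N (fun n => a n * real_complex R r ^+ n) (expi t).
  by apply: eq_bigr => n _; rewrite exprMn mulrA.
have -> : A%:E = ((2 * pi)^-1%:E * (2 * pi * A)%:E)%E.
  by rewrite -EFinM mulrA mulVf ?mul1r // gt_eqF.
apply: lee_wpmul2l; first by rewrite lee_fin invr_ge0 ltW.
apply: (@fatou_bound _ _ mu _
  (fun N t => rnorm (poly_sum N a (real_complex R r * expi t)) ^+ 2)).
- exact: measurable_itv.
- move=> N; apply: (@measurable_funS _ _ _ _ setT) => //.
  apply: continuous_measurable_fun.
  by under eq_fun do rewrite psE; exact: continuous_circle_sqr.
- by move=> N t _; exact: sqr_ge0.
- by move=> t _; apply: cvg_to_sqr; exact: f_series.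
move=> N; under eq_integral do rewrite psE.
rewrite circle_poly_integral lee_fin ler_wpM2l ?(ltW pi20) //.
apply: le_trans (aA N); apply: ler_sum => n _.
rewrite rnormM rnormX rn exprMn ler_piMr ?sqr_ge0 // exprn_ile1 ?exprn_ge0 //.
by rewrite exprn_ile1 // ltW.
Qed.

(** The coefficients of the derivative grow by a factor [n + 1], which the
    differences [mom n - mom n.+1] of order [n ^ -2] compensate. *)
Lemma lp_integral_le (g : C -> C) :
  (forall z, rnorm z < 1 -> cvg_to (fun N => poly_sum N.+1 (deriv_coef a) z) (g z)) ->
  measurable_fun setT (fun p => lp_weight p * rnorm (g (cplx p)) ^+ 2) /\
  (plane_integral (fun p => lp_weight p * rnorm (g (cplx p)) ^+ 2)%R <= (4 * A)%:E)%E.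
Proof.
move=> g_series.
pose h N (p : R * R) := lp_weight p * rnorm (poly_sum N.+1 (deriv_coef a) (cplx p)) ^+ 2.
have mh N : measurable_fun setT (h N).
  by apply: measurable_funM; [exact: measurable_lp_weight|exact: measurable_poly_sum_sqr].
have cvg_h p : h ^~ p @ \oo --> lp_weight p * rnorm (g (cplx p)) ^+ 2.
  have [p1|p1] := ltP (sqr_dist0 p) 1; last first.
    have w0 : lp_weight p = 0.
      by rewrite /lp_weight indicE memNset ?mul0r //= /plane_disk /=; apply/negP; rewrite -leNgt.
    rewrite /h w0 mul0r; under eq_fun do rewrite mul0r; exact: cvg_cst.
  apply: cvgMr; apply: cvg_to_sqr; apply: g_series.
  by move: p1; rewrite -rnorm_cplx; have := rnorm_ge0 (cplx p); nra.
split; first by apply: measurable_fun_cvg => // p _; exact: cvg_h.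
rewrite /plane_integral; apply: (@fatou_bound _ _ (mu \x mu)%E setT h) => //.
  by move=> n p _; rewrite mulr_ge0 ?lp_weight_ge0 ?sqr_ge0.
move=> N; rewrite [leLHS](lp_poly_integral (deriv_coef a)) // lee_fin.
apply: le_trans (ler_wpM2l _ (aA N.+2)) => //.
rewrite [X in _ <= 4 * X]big_ord_recl mulrDr mulr_sumr -[leLHS]add0r; apply: lerD; first by rewrite mulr_ge0 ?sqr_ge0.
apply: ler_sum => n _; rewrite /deriv_coef /=.
rewrite rnormM exprMn -Rc_nat rnorm_real normr_nat.
rewrite mulrAC ler_wpM2r ?sqr_ge0 //.
have := momS R n; have := momS R n.+1; have := mom_ge0 R n.+1; have := mom0_le4 R.
rewrite -(natr1 n.+1); move: (mom R n) (mom R n.+1) (mom R 0) => x y m.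
have : 0 <= n.+1%:R :> R by [].
move: (n.+1%:R : R) => k k0 m4 y0 E1 E2.
have -> : k ^+ 2 * (x - y) = k * (k * x - k * y) by ring.
by rewrite E2 -E1; nra.
Qed.

End PowerSeriesNorms.

End Limits.

(** * Bounding the local Dirichlet integral *)

Section LocalDirichlet.
Variable R : realType.
Local Notation C := R[i].
Local Notation mu := (@lebesgue_measure R).
Variable zeta : C.

Definition dist_to (p : R * R) : R := rnorm (cplx p - zeta).

Lemma dist_to_ge0 p : 0 <= dist_to p. Proof. exact: rnorm_ge0. Qed.

Lemma dist_to_sqr p : dist_to p ^+ 2 =
  (p.1 - complex.Re zeta) ^+ 2 + (p.2 - complex.Im zeta) ^+ 2.
Proof. by rewrite rnorm_sqrE /cplx; case: zeta. Qed.

Lemma measurable_dist_to : measurable_fun setT dist_to.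
Proof.
have -> : dist_to = Num.sqrt \o (fun p : R * R =>
    (p.1 - complex.Re zeta) ^+ 2 + (p.2 - complex.Im zeta) ^+ 2).
  by apply/funext => p /=; rewrite -dist_to_sqr sqrtr_sqr ger0_norm ?dist_to_ge0.
apply: measurableT_comp; first by apply: continuous_measurable_fun; exact: sqrt_continuous.
by apply: measurable_funD; apply: measurable_funX; apply: measurable_funB.
Qed.

Lemma measurable_inv_dist : measurable_fun setT (fun p => (dist_to p)^-1).
Proof.
have -> : (fun p => (dist_to p)^-1) = (@powR R ^~ (-1)) \o dist_to.
  by apply/funext => p /=; rewrite powR_inv1 ?dist_to_ge0.
apply: measurableT_comp; [exact: measurable_powR|exact: measurable_dist_to].
Qed.

Definition square_around (s : R) : set (R * R) :=
  `]complex.Re zeta - s, complex.Re zeta + s[%classic `*`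
  `]complex.Im zeta - s, complex.Im zeta + s[%classic.

Lemma measurable_square s : measurable (square_around s).
Proof. by apply: measurableX. Qed.

Lemma square_integral s : 0 < s ->
  plane_integral (\1_(square_around s) : R * R -> R) = (4 * s ^+ 2)%:E.
Proof.
move=> s0; have <- : (mu \x mu)%E (square_around s) = (4 * s ^+ 2)%:E.
  rewrite product_measure1E //= !lebesgue_measure_itv /= !lte_fin.
  have E (x : R) : x - s < x + s by lra.
  by rewrite !E -!EFinB -EFinM; congr EFin; ring.
by rewrite /plane_integral integral_indic ?setIT //; exact: measurable_square.
Qed.

Lemma dist_to_square p s : dist_to p < s -> square_around s p.
Proof.
move=> ps; have := dist_to_sqr p; have := dist_to_ge0 p => d0 E.
have sq (x : R) : x ^+ 2 <= dist_to p ^+ 2 -> - s < x < s.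
  by move=> xd; apply/andP; split; nra.
have h1 : - s < p.1 - complex.Re zeta < s by apply: sq; rewrite E lerDl sqr_ge0.
have h2 : - s < p.2 - complex.Im zeta < s by apply: sq; rewrite E lerDr sqr_ge0.
by split; rewrite /= in_itv /=; apply/andP; split; lra.
Qed.

(** A dyadic majorant of [1 / dist_to] whose integral is a geometric sum. *)
Definition dyadic (n : nat) (p : R * R) : R :=
  \sum_(k < n) 2 ^+ k * \1_(square_around (2 * 2 ^- k)) p.

Lemma measurable_square_indic s : measurable_fun setT (\1_(square_around s) : R * R -> R).
Proof. by apply: measurable_indic; exact: measurable_square. Qed.

Lemma dyadic_ge0 n p : 0 <= dyadic n p.
Proof. by apply: sumr_ge0 => k _; rewrite mulr_ge0 ?exprn_ge0. Qed.

Lemma measurable_dyadic n : measurable_fun setT (dyadic n).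
Proof.
by apply: measurable_sum => k; apply: measurable_funM => //; exact: measurable_square_indic.
Qed.

Lemma dyadic_integral n : (plane_integral (dyadic n) <= 32%:E)%E.
Proof.
rewrite /dyadic plane_integral_sum.
- have -> : (\sum_(k < n) plane_integral (fun p => 2 ^+ k * \1_(square_around (2 * 2 ^- k)) p)%R
      = (\sum_(k < n) 16 * 2 ^- k)%:E)%E.
    rewrite -sumEFin; apply: eq_bigr => k _; rewrite plane_integralZ ?exprn_ge0 //.
    - rewrite square_integral ?mulr_gt0 ?invr_gt0 ?exprn_gt0 // -EFinM; congr EFin.
      by field; rewrite expf_eq0 pnatr_eq0 andbF.
    - exact: measurable_square_indic.
  rewrite lee_fin -mulr_sumr.
  have -> : \sum_(k < n) 2 ^- k = 2 - 2 * 2 ^- n :> R.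
    elim: n => [|n IH]; first by rewrite big_ord0 expr0 invr1; ring.
    rewrite big_ord_recr /= IH exprS invfM.
    by move: ((2 ^+ n)^-1) => x; field.
  have : 0 <= (2 ^+ n)^-1 :> R by rewrite invr_ge0 exprn_ge0.
  by lra.
- by move=> k; apply: measurable_funM => //; exact: measurable_square_indic.
- by move=> k p; rewrite mulr_ge0 ?exprn_ge0.
Qed.

Lemma inv_dist_le_dyadic n p : 2 ^- n <= dist_to p < 2 -> (dist_to p)^-1 <= dyadic n.+1 p.
Proof.
have pos k : 0 < 2 ^+ k :> R by rewrite exprn_gt0.
move=> /andP[lo hi]; elim: n lo => [|n IH] lo.
  rewrite /dyadic big_ord1 expr0 invr1 mulr1 mul1r indicE mem_set; last exact: dist_to_square.
  by rewrite invf_le1 ?(lt_le_trans _ lo) // -[leLHS]invr1 -(expr0 2).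
rewrite /dyadic big_ord_recr -/(dyadic n.+1 p) /=.
have [lo'|lo'] := leP (2 ^- n) (dist_to p).
  by rewrite (le_trans (IH lo')) // lerDl mulr_ge0 ?exprn_ge0.
rewrite indicE mem_set; last first.
  apply: dist_to_square; apply: lt_le_trans lo' _.
  by rewrite exprS invfM mulrA mulfV // mul1r.
rewrite mulr1 (le_trans _ (_ : 2 ^+ n.+1 <= _)) ?lerDr ?dyadic_ge0 //.
by rewrite -[leRHS]invrK lef_pV2 ?posrE ?invr_gt0 ?pos // (lt_le_trans _ lo) // invr_gt0.
Qed.

(** The truncations of [1 / dist_to] lie below the dyadic majorants: the disk
    is contained in the largest square, of half-side 2. *)
Lemma inv_dist_integral : rnorm zeta = 1 ->
  (plane_integral (fun p => \1_(plane_disk 1) p * (dist_to p)^-1)%R <= 32%:E)%E.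
Proof.
move=> zeta1.
pose h n (p : R * R) := \1_(plane_disk 1 `&` dist_to @^-1` `[2 ^- n, +oo[) p * (dist_to p)^-1.
have h0 n p : 0 <= h n p by rewrite mulr_ge0 ?invr_ge0 ?dist_to_ge0.
have mh n : measurable_fun setT (h n).
  apply: measurable_funM; last exact: measurable_inv_dist.
  apply: measurable_indic; apply: measurableI; first exact: measurable_plane_disk.
  by rewrite -[X in measurable X]setTI; apply: measurable_dist_to.
rewrite /plane_integral; apply: (@fatou_bound _ _ _ (mu \x mu)%E setT h) => //.
- move=> p _; have [p1|p1] := pselect (plane_disk 1 p); last first.
    rewrite indicE memNset // mul0r (_ : h ^~ p = cst 0); first exact: cvg_cst.
    by apply/funext => n; rewrite /h indicE memNset ?mul0r // => -[].
  have [d0|d0] := eqVneq (dist_to p) 0.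
    rewrite d0 invr0 mulr0 (_ : h ^~ p = cst 0); first exact: cvg_cst.
    by apply/funext => n; rewrite /h d0 invr0 mulr0.
  have dp : 0 < dist_to p by rewrite lt_neqAle eq_sym d0 dist_to_ge0.
  have half : `|2^-1 : R| < 1 by rewrite ger0_norm // invf_lt1 // ltr1n.
  have /cvgrPdist_le/(_ _ dp)[N0 _ HN] := cvg_expr half.
  apply: cvg_near_cst; exists N0 => // n /= /HN.
  rewrite /= sub0r normrN ger0_norm ?exprn_ge0 // exprVn => dn.
  apply/eqP; rewrite /h !indicE !mem_set //.
  by split => //=; rewrite in_itv /= andbT.
move=> n; apply: le_trans (dyadic_integral n.+1).
apply: plane_integral_le => //; first exact: measurable_dyadic.
move=> p; rewrite /h indicE.
case: (boolP (p \in _)) => [|_]; last by rewrite mul0r dyadic_ge0.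
rewrite inE => -[p1 /=]; rewrite in_itv /= andbT mul1r => dn.
apply: inv_dist_le_dyadic; rewrite dn /=.
have := rnormB (cplx p) zeta; rewrite zeta1 -/(dist_to p).
have : rnorm (cplx p) < 1.
  by move: p1; rewrite /plane_disk /= -rnorm_cplx; have := rnorm_ge0 (cplx p); nra.
by lra.
Qed.

(** Away from [zeta] the weight is at most [(1 - |z|^2) / d^2], and the
    Littlewood-Paley integral takes over; near [zeta] it is at most
    [2 / |z - zeta|], which is integrable in the plane. *)
Lemma local_dirichlet_le (f : C -> C) (d B K : R) :
  rnorm zeta = 1 -> 0 < d ->
  (forall z, rnorm z < 1 -> rnorm (z - zeta) < d -> rnorm (derive1 f z) <= B) ->
  measurable_fun setT (fun p => lp_weight p * rnorm (derive1 f (cplx p)) ^+ 2) ->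
  (plane_integral (fun p => lp_weight p * rnorm (derive1 f (cplx p)) ^+ 2)%R <= K%:E)%E ->
  (local_dirichlet_integral zeta f <= (d ^- 2 * K + 64 * B ^+ 2)%:E)%E.
Proof.
move=> zeta1 d0 fB mlp lpK.
pose I := plane_integral (fun p => lp_weight p * rnorm (derive1 f (cplx p)) ^+ 2 * (dist_to p)^-1 ^+ 2).
have -> : local_dirichlet_integral zeta f = (pi^-1%:E * I)%E.
  rewrite /local_dirichlet_integral unit_disk_plane integral_mkcond; congr (_ * _)%E.
  apply: eq_integral => p _; rewrite patchE /lp_weight indicE.
  case: ifPn => p1; last by rewrite !mul0r.
  rewrite mul1r -rnorm_cplx /= -/(dist_to p) exprVn; congr EFin.
  by rewrite mulrA; congr (_ / _); rewrite mulrC.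
have mI : measurable_fun setT (fun p => lp_weight p * rnorm (derive1 f (cplx p)) ^+ 2 * (dist_to p)^-1 ^+ 2).
  by apply: measurable_funM => //; apply: measurable_funX; exact: measurable_inv_dist.
have lp0 p : 0 <= lp_weight p * rnorm (derive1 f (cplx p)) ^+ 2.
  by rewrite mulr_ge0 ?lp_weight_ge0 ?sqr_ge0.
have I0 p : 0 <= lp_weight p * rnorm (derive1 f (cplx p)) ^+ 2 * (dist_to p)^-1 ^+ 2.
  by rewrite mulr_ge0 ?sqr_ge0.
have m1 : measurable_fun setT (fun p : R * R => \1_(plane_disk 1) p * (dist_to p)^-1).
  apply: measurable_funM; last exact: measurable_inv_dist.
  by apply: measurable_indic; exact: measurable_plane_disk.
have n1 p : 0 <= \1_(plane_disk 1) p * (dist_to p)^-1 :> R.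
  by rewrite mulr_ge0 ?invr_ge0 ?dist_to_ge0.
have d2 : 0 <= d ^- 2 by rewrite invr_ge0 exprn_ge0 ?ltW.
have B2 : 0 <= 2 * B ^+ 2 by rewrite mulr_ge0 ?sqr_ge0.
have IK : (I <= (d ^- 2 * K + 64 * B ^+ 2)%:E)%E.
  apply: (@le_trans _ _ (plane_integral (fun p =>
    d ^- 2 * (lp_weight p * rnorm (derive1 f (cplx p)) ^+ 2) +
    2 * B ^+ 2 * (\1_(plane_disk 1) p * (dist_to p)^-1)))); last first.
    rewrite plane_integralD //; last 4 first.
    - exact: measurable_funM.
    - by move=> p; rewrite mulr_ge0.
    - exact: measurable_funM.
    - by move=> p; rewrite mulr_ge0.
    rewrite !plane_integralZ // EFinD; apply: leeD.
      by rewrite EFinM; apply: lee_wpmul2l; rewrite ?lee_fin.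
    have -> : 64 * B ^+ 2 = 2 * B ^+ 2 * 32 by ring.
    by rewrite [in leRHS]EFinM; apply: lee_wpmul2l; [rewrite lee_fin|exact: inv_dist_integral].
  apply: plane_integral_le => //.
    by apply: measurable_funD; apply: measurable_funM.
  move=> p; have [p1|p1] := pselect (plane_disk 1 p); last first.
    by rewrite /lp_weight indicE memNset // !mul0r !mulr0 addr0.
  have pE : lp_weight p = 1 - rnorm (cplx p) ^+ 2.
    by rewrite /lp_weight indicE mem_set // mul1r rnorm_cplx.
  have p0 := rnorm_ge0 (cplx p).
  have {}p1 : rnorm (cplx p) < 1 by move: p1; rewrite /plane_disk /= -rnorm_cplx; nra.
  have dp0 := dist_to_ge0 p.
  have [dd|dd] := ltP (dist_to p) d; last first.
    rewrite -[leLHS]addr0; apply: lerD; last by rewrite mulr_ge0.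
    rewrite [leRHS]mulrC ler_wpM2l //.
    have dp : 0 < dist_to p by apply: lt_le_trans dd.
    by rewrite exprVn lef_pV2 ?posrE ?exprn_gt0 // lerXn2r ?nnegrE // ltW.
  rewrite -[leLHS]add0r; apply: lerD; first by rewrite mulr_ge0.
  rewrite pE indicE mem_set ?mul1r; last first.
    by rewrite /plane_disk /= -rnorm_cplx; nra.
  have gB := fB _ p1 dd.
  have z1 : 1 - rnorm (cplx p) ^+ 2 <= 2 * dist_to p.
    have := rnorm_ge_sub zeta (cplx p); rewrite zeta1 rdistC -/(dist_to p).
    by nra.
  have [->|dN] := eqVneq (dist_to p) 0; first by rewrite invr0 expr0n /= !mulr0.
  apply: (@le_trans _ _ (2 * dist_to p * B ^+ 2 * (dist_to p)^-1 ^+ 2)).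
    rewrite ler_wpM2r ?sqr_ge0 //; apply: ler_pM => //; [by nra|exact: sqr_ge0|].
    by rewrite lerXn2r ?nnegrE ?rnorm_ge0 // (le_trans (rnorm_ge0 _) gB).
  by rewrite le_eqVlt; apply/orP; left; apply/eqP; field.
have I00 : (0 <= I)%E by apply: integral_ge0 => p _; rewrite lee_fin.
apply: le_trans IK; rewrite -[leRHS]mul1e; apply: lee_wpmul2r => //.
by rewrite lee_fin invf_le1 ?pi_gt0 // (le_trans _ (pi_ge2 R)) // ler1n.
Qed.

End LocalDirichlet.

(** * The embedding *)

Section Embedding.
Variables (R : realType) (H : completeNormedModType R[i]).
Variable ip : {dot H for Num.conj}.
Hypothesis ip_norm : forall u : H, `|u| ^+ 2 = ip u u.
Local Notation C := R[i].
Variables (b : C -> C) (k : C -> H).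
Hypothesis ip_kernel : forall z w, rnorm z < 1 -> rnorm w < 1 ->
  (1 - w^* * z) * ip (k w) (k z) = 1 - (b w)^* * b z.

(** The boundary regularity of the kernel is inherited, with the norm of [u]
    as a factor, by every function it represents. *)
Lemma local_embedding (zeta : C) (A d : R) : rnorm zeta = 1 -> 0 < d ->
  (forall z w, rnorm z < 1 -> rnorm w < 1 -> rnorm (z - zeta) < d ->
    rnorm (w - zeta) < d -> rnorm (k z - k w) <= A * rnorm (z - w)) ->
  forall (u : H) (f : C -> C), (forall z, rnorm z < 1 -> f z = ip u (k z)) ->
  holomorphic_disk f /\
  (H2_norm_sqr f + local_dirichlet_integral zeta f <=
    ((4 + 16 * d ^- 2 + 64 * A ^+ 2) * rnorm u ^+ 2)%:E)%E.
Proof.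
move=> zeta1 d0 kA u f fE.
have [e [e_bessel e_series]] := kernel_power_series ip_norm ip_kernel.
pose a n := ip u (e n).
have u0 := rnorm_ge0 u.
have aA N : \sum_(n < N) rnorm (a n) ^+ 2 <= 4 * rnorm u ^+ 2.
  set s := \sum_(n < N) _; have s0 : 0 <= s by apply: sumr_ge0 => n _; exact: sqr_ge0.
  have := cauchy_schwarz ip_norm u (\sum_(n < N) a n *: e n).
  have -> : ip u (\sum_(n < N) a n *: e n) = s%:C%C.
    rewrite ip_sumr /s Rc_sum; apply: eq_bigr => n _.
    by rewrite ipZr -/(a n) mulrC mulC_conj.
  rewrite rnorm_real ger0_norm // => cs.
  have := e_bessel N a; rewrite -/s.
  move: (rnorm_ge0 (\sum_(n < N) a n *: e n)) cs.
  move: (rnorm _) (rnorm u) u0 => v x x0 v0 cs vs.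
  have [->|sN] := eqVneq s 0; first by rewrite mulr_ge0 ?sqr_ge0.
  have sp : 0 < s by rewrite lt_neqAle eq_sym sN.
  rewrite -(ler_pM2l sp) -expr2.
  apply: (@le_trans _ _ ((x * v) ^+ 2)); first by rewrite lerXn2r ?nnegrE // mulr_ge0.
  by rewrite exprMn; have := ler_wpM2l (sqr_ge0 x) vs; lra.
have f_series z : rnorm z < 1 -> cvg_to (fun N => poly_sum N a z) (f z).
  move=> z1 eps eps0; have u1 : 0 < rnorm u + 1 by rewrite ltr_wpDl.
  have z01 : 0 <= rnorm z < 1 by rewrite rnorm_ge0.
  have [N0 HN] := e_series _ _ z01 (divr_gt0 eps0 u1).
  exists N0 => N /HN/(_ z (lexx _)) le; rewrite fE //.
  have -> : poly_sum N a z = ip u (\sum_(n < N) z^* ^+ n *: e n).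
    rewrite ip_sumr; apply: eq_bigr => n _.
    by rewrite ipZr rmorphXn /= conjCK mulrC.
  rewrite -ipBr; apply: le_trans (cauchy_schwarz ip_norm _ _) _; rewrite rdistC.
  apply: le_trans (ler_wpM2l u0 le) _.
  by rewrite mulrCA ler_piMr ?(ltW eps0) // ler_pdivrMr // mul1r lerDl.
have aS n : rnorm (a n) <= 2 * rnorm u.
  rewrite -ler_sqr ?nnegrE ?rnorm_ge0 ?mulr_ge0 //.
  apply: le_trans (_ : 4 * rnorm u ^+ 2 <= _); last by rewrite exprMn; lra.
  by apply: le_trans (aA n.+1); rewrite big_ord_recr /= lerDr sumr_ge0 // => i _; exact: sqr_ge0.
have deriv := power_series_derivative aS f_series.
have f_holo : holomorphic_disk f.
  by move=> z; rewrite unit_diskE => /deriv[l []].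
split=> //.
have g_series z : rnorm z < 1 ->
    cvg_to (fun N => poly_sum N.+1 (deriv_coef a) z) (derive1 f z).
  by move=> /deriv[l [sl _ -> _]].
have gB z : rnorm z < 1 -> rnorm (z - zeta) < d -> rnorm (derive1 f z) <= A * rnorm u.
  move=> z1 zd; have [l [_ _ -> lA]] := deriv _ z1.
  apply: (lA _ (d - rnorm (z - zeta))); first by rewrite subr_gt0.
  move=> w w1 wz; have wd : rnorm (w - zeta) < d.
    by have := rnorm_triangle w z zeta; lra.
  rewrite !fE // -ipBr; apply: le_trans (cauchy_schwarz ip_norm _ _) _.
  by have := ler_wpM2l u0 (kA _ _ w1 z1 wd zd); lra.
have [mlp lp_le] := lp_integral_le aA g_series.
have H2 := H2_norm_le aA f_series.
have Dz := local_dirichlet_le zeta1 d0 gB mlp lp_le.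
apply: le_trans (leeD H2 Dz) _; rewrite -EFinD lee_fin.
by move: (d ^- 2) => x; lra.
Qed.

End Embedding.

Lemma nbhs_rnorm (R : realType) (x : R[i]) (P : set R[i]) : nbhs x P ->
  exists d : R, 0 < d /\ forall y, rnorm (y - x) < d -> P y.
Proof.
move=> /nbhs_ballP[e e0 eP].
have eE : e = (complex.Re e)%:C%C by rewrite RRe_real // gtr0_real.
exists (complex.Re e); split; first by rewrite -ltcR -eE.
move=> y yx; apply: eP; rewrite -ball_normE /= norm_rnorm eE ltcR rdistC.
exact: yx.
Qed.

Lemma not_boundary_spectrum (R : realType) (b : R[i] -> R[i]) (lam : R[i]) :
  rnorm lam = 1 -> ~ boundary_spectrum b lam ->
  forall e : R, 0 < e -> exists eta : R, 0 < eta /\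
    forall z, rnorm z < 1 -> rnorm (z - lam) <= eta -> 1 - e <= rnorm (b z).
Proof.
move=> lam1 nspec e e0.
have : (1 <= limf_einf (fun z => (rnorm (b z))%:E) (within (@unit_disk R) (nbhs lam)))%E.
  rewrite leNgt; apply/negP => lim1; apply: nspec; split=> //.
  by rewrite norm_rnorm lam1.
rewrite /limf_einf leeNr limf_esupE => le1.
have e1 : (-1 < (- (1 - e))%:E)%E by rewrite lte_fin; lra.
have /ereal_inf_lt[_ [P /= wP <-] lt] := le_lt_trans le1 e1.
have [d [d0 dP]] := nbhs_rnorm wP.
exists (d / 2); split; first by rewrite divr_gt0.
move=> z z1 zl; have Pz : P z by apply: dP; [lra|rewrite unit_diskE].
rewrite -lerN2 -lee_fin; apply: le_trans (ltW lt); apply: ereal_sup_ubound.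
by exists z.
Qed.

Theorem theorem1p1 (R : realType) (b : R[i] -> R[i]) (zeta : R[i])
  (b_holo : holomorphic_disk b)
  (b_norm : Hinfty_norm b = 1%E)
  (zeta_circle : `|zeta| = 1)
  (zeta_spec : ~ closure (boundary_spectrum b) zeta)
  (Hb : de_branges_rovnyak b) :
  embeds_local_dirichlet Hb zeta.
Proof.
have zeta1 := rnorm_eq1 zeta_circle.
have disk0 : `|0 : R[i]| < 1 by rewrite normr0.
pose kd (z : R[i]) : disk R := insubd (exist (fun z : R[i] => `|z| < 1) 0 disk0) z.
have kdE z : rnorm z < 1 -> val (kd z) = z.
  by rewrite -unit_diskE => z1; rewrite insubdK.
pose ip := inner Hb; pose k z := kernel_at Hb (kd z).
have ip_norm : forall u : Defs.space Hb, `|u| ^+ 2 = ip u u := @inner_norm _ _ _ Hb.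
have ip_kernel z w : rnorm z < 1 -> rnorm w < 1 ->
    (1 - w^* * z) * ip (k w) (k z) = 1 - (b w)^* * b z.
  move=> z1 w1; rewrite /ip /k -reproducing kernel_atE /dbr_kernel !kdE // mulrC divfK //.
  apply/eqP => /subr0_eq wz1; have : rnorm (w^* * z) < 1.
    by rewrite rnormM rnorm_conj; have := rnorm_ge0 z; have := rnorm_ge0 w; nra.
  by rewrite -wz1 rnorm1 ltxx.
(* [zeta] has a whole neighbourhood free of spectrum, so that [|b|] tends to 1
   along an arc and not only at [zeta] *)
have [d0 [d0_gt0 spec]] : exists d : R, 0 < d /\
    forall lam, rnorm (lam - zeta) < d -> ~ boundary_spectrum b lam.
  apply: contrapT => no_d; apply: zeta_spec => B /nbhs_rnorm[d [d_gt0 dB]].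
  apply: contrapT => noB; apply: no_d; exists d; split=> // lam lam_d lam_spec.
  by apply: noB; exists lam; split=> //; exact: dB.
have zeta_spec' : ~ boundary_spectrum b zeta by apply: spec; rewrite subrr rnorm0.
have half0 : 0 < 1 / 2 :> R by rewrite divr_gt0.
have [eta [eta0 b_eta]] := not_boundary_spectrum zeta1 zeta_spec' half0.
(* near [zeta] itself, [|b|] is also bounded below, so that [1 / b] makes sense *)
pose d := Num.min 1 (Num.min d0 eta).
have [d_gt0 d_le1 d_led0 d_leeta] : [/\ 0 < d, d <= 1, d <= d0 & d <= eta].
  by rewrite /d !lt_min ltr01 d0_gt0 eta0 !ge_min !lexx !orbT.
clearbody d.
have d01 : 0 < d <= 1 by rewrite d_gt0.
have b_half z : rnorm z < 1 -> rnorm (z - zeta) < d -> 1 / 2 <= rnorm (b z).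
  by move=> z1 zd; have := b_eta z z1; lra.
have b_bdry lam : rnorm lam = 1 -> rnorm (lam - zeta) < d -> forall e : R, 0 < e ->
    exists eta : R, 0 < eta /\
      forall z, rnorm z < 1 -> rnorm (z - lam) <= eta -> 1 - e <= rnorm (b z).
  move=> lam1 lamd; apply: (not_boundary_spectrum lam1); apply: spec.
  exact: lt_le_trans lamd d_led0.
(* [b] is recovered from one function of the space at a point where it does
     not vanish *)
have [w0 [w01 w0d]] := near_point zeta1 d01.
have bw0 : b w0 != 0.
  by apply/eqP => E; have := b_half _ w01 w0d; rewrite E rnorm0; lra.
have b_app (r : R) : r < 1 -> poly_approx b r := b_approx ip_norm ip_kernel w01 bw0.
have [K [K0 diag]] := one_sub_sqr_b_le d01 b_app b_half b_bdry zeta1.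
have d4 : 0 < d / 4 <= 1 by apply/andP; split; lra.
have b_half4 z : rnorm z < 1 -> rnorm (z - zeta) < d / 4 -> 1 / 2 <= rnorm (b z).
  by move=> z1 zd; apply: b_half => //; lra.
have [A [eps [A0 /andP[eps0 _] kA]]] :=
  kernel_lipschitz ip_norm ip_kernel zeta1 d4 K0 b_half4 diag.
have embed (u : Defs.space Hb) (f : R[i] -> R[i]) : restrict_disk f = ev Hb u ->
    holomorphic_disk f /\ (H2_norm_sqr f + local_dirichlet_integral zeta f <=
      ((4 + 16 * eps ^- 2 + 64 * A ^+ 2) * rnorm u ^+ 2)%:E)%E.
  move=> fu; apply: (local_embedding ip_norm ip_kernel zeta1 eps0 kA) => z z1.
  by rewrite /ip /k -reproducing -fu /restrict_disk kdE.
split=> [u f /embed[f_holo le]|].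
  split=> //; apply: le_lt_trans (ltry _); apply: le_trans le.
  rewrite -[leLHS]add0e; apply: leeD => //; apply: ereal_sup_ge.
  pose r0 : R := 0.
  exists ((2 * pi)^-1%:E * \int[lebesgue_measure]_(t in `[0%R, (2 * pi)%R])
    (rnorm (f (real_complex R r0 * expi t)) ^+ 2)%:E)%E.
    by exists r0 => //=; rewrite in_itv /= lexx ltr01.
  apply: mule_ge0; first by rewrite lee_fin invr_ge0 mulr_ge0 // pi_ge0.
  by apply: integral_ge0 => t _; rewrite lee_fin sqr_ge0.
exists (4 + 16 * eps ^- 2 + 64 * A ^+ 2); split; last by move=> u f /embed[].
have : 0 <= eps ^- 2 by rewrite invr_ge0 exprn_ge0 // ltW.
by have := sqr_ge0 A; lra.
Qed.
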